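(* Let $\{\mathrm G_1,\mathrm G_2\}$ be a dual reductive pair acting on $\mathbb C^n$, with Schur basis $\{|k,m,\lambda\rangle\}$ and operators $\hat\Pi_k^{m_1m_2}$, $\hat\Pi_k^{\lambda_1\lambda_2}$, $\hat\Pi_k$, dimensions $d^k_L,d^k_V,d^k=d^k_Ld^k_V$ as in the context. For $i=1,2$ let $\mathcal T_{\mathrm G_i}$ be the generalised twirling map defined via the Cartan decomposition of $\mathrm G_i$, with normalised Haar measure on $\mathrm K_i$ and an arbitrary normalised measure $d\mu_i(A^{(i)})$ on $\mathrm A_i$. Then for every density operator $\rho$ on $\mathbb C^n$: $$\mathcal T_{\mathrm G_1}(\rho)=\sum_k\frac{1}{d^k_V}\left(\frac{\beta^{\mathrm G_1}_k}{d^k}\right)\sum_{m_1,m_2=1}^{d^k_L}\operatorname{Tr}\left(\rho\hat\Pi_k^{m_1m_2\dagger}\right)\hat\Pi_k^{m_1m_2},$$ $$\mathcal T_{\mathrm G_2}(\rho)=\sum_k\frac{1}{d^k_L}\left(\frac{\beta^{\mathrm G_2}_k}{d^k}\right)\sum_{\lambda_1,\lambda_2=1}^{d^k_V}\operatorname{Tr}\left(\rho\hat\Pi_k^{\lambda_1\lambda_2\dagger}\right)\hat\Pi_k^{\lambda_1\lambda_2},$$ where $$\beta_k^{\mathrm G_i}=\operatorname{Tr}\left(\left[\int A^{(i)}_{\mathrm n}A^{(i)\dagger}_{\mathrm n}\,d\mu_i\big(A^{(i)}\big)\right]\hat\Pi_k^\dagger\right),$$ and $\beta_k^{\mathrm G_i}=d^k$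 whenever $\mathrm G_i$ is compact.
   Context: A reductive group is an algebraic subgroup of a general linear group all of whose rational representations are completely reducible. A pair $\{\mathrm G_1,\mathrm G_2\}$ of reductive subgroups of $\mathrm{GL}(n,\mathbb C)$ is a dual reductive pair if the matrix algebras generated by $\mathrm G_1$ and by $\mathrm G_2$ are mutual commutants in $\operatorname{End}(\mathbb C^n)$. For such a pair one uses a Schur basis: an orthonormal basis $\{|k,m,\lambda\rangle\}$ of $\mathbb C^n$ ($k$ indexing isotypic blocks, $m=1,\dots,d^k_L$, $\lambda=1,\dots,d^k_V$) in which every element $G_1\in\mathrm G_1$ and $G_2\in\mathrm G_2$ decompose as $$G_1=\sum_k\frac{1}{d^k_L}\sum_{\lambda_1,\lambda_2}\operatorname{Tr}\left(G_1\hat\Pi_k^{\lambda_1\lambda_2\dagger}\right)\hat\Pi_k^{\lambda_1\lambda_2},\qquad G_2=\sum_k\frac{1}{d^k_V}\sum_{m_1,m_2}\operatorname{Tr}\left(G_2\hat\Pi_k^{m_1m_2\dagger}\right)\hat\Pi_k^{m_1m_2},$$ where $\hat\Pi_k^{\lambda_1\lambda_2}=\sum_{m}|k,m,\lambda_1\rangle\langle k,m,\lambda_2|$, $\hat\Pi_k^{m_1m_2}=\sum_{\lambda}|k,m_1,\lambda\rangle\langle k,m_2,\lambda|$, $\hat\Pi_k=\sum_{m,\lambda}|k,m,\lambda\rangle\langle k,m,\lambda|$, $d^k=d^k_Ld^k_V$; i.e. $\mathrm G_1$ acts irreducibly on the index $\lambda$ and $\mathrm G_2$ on the index $m$ within each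 block, with inequivalent irreducibles for distinct $k$. Each reductive group $\mathrm G$ has a Cartan decomposition: every $G\in\mathrm G$ can be written $G=KAK'$ with $K,K'$ in a maximal compact subgroup $\mathrm K$ (represented by unitary matrices on $\mathbb C^n$) and $A$ in a maximal abelian subgroup $\mathrm A$; write $A_{\mathrm n}=A/\|A\|$ (operator norm). The generalised twirling map is $$\mathcal T_{\mathrm G}(\rho)=\int (KA_{\mathrm n}K')\rho(KA_{\mathrm n}K')^\dagger\,d\mu(K)\,d\mu(A)\,d\mu(K'),$$ with $d\mu(K)$ the normalised (left and right invariant) Haar measure on $\mathrm K$ (counting measure normalised if $\mathrm K$ is finite) and $d\mu(A)$ any normalised measure on $\mathrm A$. *)

(* Defs.v *)
(* mathcomp 2.5 + mathcomp-analysis 1.16 + real-closed (complex). *)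
From HB Require Import structures.
From mathcomp Require Import all_boot all_order all_algebra.
From mathcomp Require Import all_classical all_reals all_analysis.
From mathcomp Require Import complex.
Import numFieldTopology.Exports numFieldNormedType.Exports.
Import Order.TTheory GRing.Theory Num.Theory.

Set Implicit Arguments.
Unset Strict Implicit.
Unset Printing Implicit Defensive.

Local Open Scope classical_set_scope.
Local Open Scope ring_scope.

(** The complex numbers C = R[i] over a real field R : realType, seen as a
    numClosedFieldType (so that it carries its canonical norm topology, and
    matrices over it carry the product (entrywise) topology). *)
Definition Cx (R : realType) : numClosedFieldType := R[i].

(** Conjugate transpose  A^dagger. *)
Definition adj (R : realType) (m p : nat) (A : 'M[Cx R]_(m, p)) : 'M[Cx R]_(p, m) :=
  (map_mx (fun z : Cx R => z^*) A)^T.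

(** Euclidean norm of a column vector of C^n (a real number). *)
Definition vnorm (R : realType) (n : nat) (v : 'cV[Cx R]_n) : R :=
  Num.sqrt (\sum_(i < n) (complex.Re (v i ord0) ^+ 2 + complex.Im (v i ord0) ^+ 2)).

(** Operator norm  ||A|| = sup_{||v|| = 1} ||A v||. *)
Definition opnorm (R : realType) (n : nat) (A : 'M[Cx R]_n) : R :=
  sup [set r : R | exists v : 'cV[Cx R]_n, vnorm v = 1 /\ r = vnorm (A *m v)].

(** A_n = A / ||A||. *)
Definition normalise (R : realType) (n : nat) (A : 'M[Cx R]_n) : 'M[Cx R]_n :=
  ((Complex (opnorm A)^-1 0 : Cx R)) *: A.

(** Integral of a complex valued function against a (probability) measure. *)
Definition cint (R : realType) (d : measure_display) (T : measurableType d)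
    (P : probability T R) (f : T -> Cx R) : Cx R :=
  Complex (Rintegral P setT (fun t => complex.Re (f t)))
          (Rintegral P setT (fun t => complex.Im (f t))).

(** Entrywise integral of a matrix valued function. *)
Definition mxint (R : realType) (d : measure_display) (T : measurableType d)
    (P : probability T R) (n : nat) (F : T -> 'M[Cx R]_n) : 'M[Cx R]_n :=
  \matrix_(i, j) cint P (fun t => F t i j).

(** Measurability of a matrix valued map (real and imaginary parts of all
    entries are measurable). *)
Definition mx_measurable (R : realType) (d : measure_display) (T : measurableType d)
    (n : nat) (F : T -> 'M[Cx R]_n) : Prop :=
  forall i j, measurable_fun setT (fun t => complex.Re (F t i j)) /\
              measurable_fun setT (fun t => complex.Im (F t i j)).

(** * Algebraic and reductive subgroups of GL(n, C) *)

(** Subgroups of GL(n,C) (as sets of matrices). *)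
Definition GL_subgroup (R : realType) (n : nat) (G : set 'M[Cx R]_n) : Prop :=
  [/\ G 1%:M,
      (forall g, G g -> g \in unitmx),
      (forall g h, G g -> G h -> G (g *m h)) &
      (forall g, G g -> G (invmx g))].

(** Polynomial functions in the matrix entries. *)
Inductive polyfun (R : realType) (n : nat) : ('M[Cx R]_n -> Cx R) -> Prop :=
| polyfun_const (c : Cx R) : polyfun (fun _ => c)
| polyfun_entry (i j : 'I_n) : polyfun (fun g => g i j)
| polyfun_add p q : polyfun p -> polyfun q -> polyfun (fun g => p g + q g)
| polyfun_mul p q : polyfun p -> polyfun q -> polyfun (fun g => p g * q g).

(** Algebraic subgroup of GL(n,C): a subgroup which is the set of invertible
    matrices cut out by a family of polynomial equations. *)
Definition algebraic_subgroup (R : realType) (n : nat) (G : set 'M[Cx R]_n) : Prop :=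
  GL_subgroup G /\
  exists S : set ('M[Cx R]_n -> Cx R),
    (forall p, S p -> polyfun p) /\
    (forall g, G g <-> (g \in unitmx /\ forall p, S p -> p g = 0)).

(** Rational representations of G on C^m: group homomorphisms into GL(m,C)
    whose matrix coefficients are regular functions on G, i.e. of the form
    p(g) / det(g)^k with p polynomial. *)
Definition rational_rep (R : realType) (n m : nat) (G : set 'M[Cx R]_n)
    (rho : 'M[Cx R]_n -> 'M[Cx R]_m) : Prop :=
  [/\ (forall g, G g -> rho g \in unitmx),
      (forall g h, G g -> G h -> rho (g *m h) = rho g *m rho h) &
      (forall i j, exists p k, polyfun p /\
         forall g, G g -> rho g i j = p g / (\det g) ^+ k)].

(** Complete reducibility: every invariant subspace has an invariant
    complement (subspaces are row spaces, G acting on row vectors). *)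
Definition completely_reducible (R : realType) (n m : nat) (G : set 'M[Cx R]_n)
    (rho : 'M[Cx R]_n -> 'M[Cx R]_m) : Prop :=
  forall U : 'M[Cx R]_m, (forall g, G g -> (U *m rho g <= U)%MS) ->
  exists W : 'M[Cx R]_m,
    [/\ (forall g, G g -> (W *m rho g <= W)%MS),
        (U + W == 1%:M)%MS & (U :&: W == (0 : 'M[Cx R]_m))%MS].

(** Reductive group: algebraic subgroup of GL(n,C) all of whose rational
    representations are completely reducible. *)
Definition reductive (R : realType) (n : nat) (G : set 'M[Cx R]_n) : Prop :=
  algebraic_subgroup G /\
  forall (m : nat) (rho : 'M[Cx R]_n -> 'M[Cx R]_m),
    rational_rep G rho -> completely_reducible G rho.

(** * Dual reductive pairs *)

(** The (unital) matrix algebra generated by a set of matrices. *)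
Inductive gen_alg (R : realType) (n : nat) (S : set 'M[Cx R]_n) : 'M[Cx R]_n -> Prop :=
| gen_alg_one : gen_alg S 1%:M
| gen_alg_gen X : S X -> gen_alg S X
| gen_alg_add X Y : gen_alg S X -> gen_alg S Y -> gen_alg S (X + Y)
| gen_alg_scale (c : Cx R) X : gen_alg S X -> gen_alg S (c *: X)
| gen_alg_mul X Y : gen_alg S X -> gen_alg S Y -> gen_alg S (X *m Y).

(** Commutant of a set of matrices in End(C^n). *)
Definition commutant (R : realType) (n : nat) (S : set 'M[Cx R]_n) : set 'M[Cx R]_n :=
  [set X | forall Y, S Y -> X *m Y = Y *m X].

Definition dual_reductive_pair (R : realType) (n : nat) (G1 G2 : set 'M[Cx R]_n) : Prop :=
  [/\ reductive G1, reductive G2,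
      gen_alg G1 = commutant (gen_alg G2) &
      gen_alg G2 = commutant (gen_alg G1)].

(** * Schur basis  |k, m, lambda>, k < r, m < dL k, lambda < dV k *)

Section SchurOps.
Variables (R : realType) (n r : nat) (dL dV : 'I_r -> nat).
Variable e : forall k : 'I_r, 'I_(dL k) -> 'I_(dV k) -> 'cV[Cx R]_n.

(** Pi_k^{lambda1 lambda2} = sum_m |k,m,lambda1><k,m,lambda2| *)
Definition PiL (k : 'I_r) (l1 l2 : 'I_(dV k)) : 'M[Cx R]_n :=
  \sum_(m < dL k) e m l1 *m adj (e m l2).

(** Pi_k^{m1 m2} = sum_lambda |k,m1,lambda><k,m2,lambda| *)
Definition PiV (k : 'I_r) (m1 m2 : 'I_(dL k)) : 'M[Cx R]_n :=
  \sum_(l < dV k) e m1 l *m adj (e m2 l).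

(** Pi_k = sum_{m,lambda} |k,m,lambda><k,m,lambda| *)
Definition Pik (k : 'I_r) : 'M[Cx R]_n :=
  \sum_(m < dL k) \sum_(l < dV k) e m l *m adj (e m l).

(** d^k = d^k_L d^k_V *)
Definition dk (k : 'I_r) : nat := (dL k * dV k)%N.

Definition schur_basis (G1 G2 : set 'M[Cx R]_n) : Prop :=
  [/\ (forall k, 0 < dL k /\ 0 < dV k)%N,
      (* orthonormality *)
      (forall k m l k' m' l',
         adj (e (k := k) m l) *m e (k := k') m' l' =
         (if [&& k == k', (m : nat) == m' & (l : nat) == l'] then 1 else 0)%:M),
      (* completeness: it is a basis of C^n *)
      \sum_(k < r) \sum_(m < dL k) \sum_(l < dV k) e m l *m adj (e m l) = 1%:M,
      (* decomposition of the elements of G1 *)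
      (forall G, G1 G -> G = \sum_(k < r) (dL k)%:R^-1 *:
           \sum_(l1 < dV k) \sum_(l2 < dV k)
              \tr (G *m adj (PiL l1 l2)) *: PiL l1 l2) &
      (* decomposition of the elements of G2 *)
      (forall G, G2 G -> G = \sum_(k < r) (dV k)%:R^-1 *:
           \sum_(m1 < dL k) \sum_(m2 < dL k)
              \tr (G *m adj (PiV m1 m2)) *: PiV m1 m2)].

End SchurOps.

(** * Cartan decomposition G = K A K *)

Definition maximal_compact_subgroup (R : realType) (n : nat) (G K : set 'M[Cx R]_n) : Prop :=
  [/\ GL_subgroup K, K `<=` G, compact K &
      forall K', GL_subgroup K' -> K `<=` K' -> K' `<=` G -> compact K' -> K' = K].

Definition abelian_set (R : realType) (n : nat) (A : set 'M[Cx R]_n) : Prop :=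
  forall a b, A a -> A b -> a *m b = b *m a.

Definition maximal_abelian_subgroup (R : realType) (n : nat) (G A : set 'M[Cx R]_n) : Prop :=
  [/\ GL_subgroup A, A `<=` G, abelian_set A &
      forall A', GL_subgroup A' -> A `<=` A' -> A' `<=` G -> abelian_set A' -> A' = A].

Definition unitary_set (R : realType) (n : nat) (K : set 'M[Cx R]_n) : Prop :=
  forall k, K k -> adj k *m k = 1%:M.

(** Cartan decomposition of G: K maximal compact (represented by unitary
    matrices), A maximal abelian, and every element of G is K A K'. *)
Definition cartan_decomposition (R : realType) (n : nat) (G K A : set 'M[Cx R]_n) : Prop :=
  [/\ maximal_compact_subgroup G K, unitary_set K,
      maximal_abelian_subgroup G A &
      forall g, G g <-> exists k a k', [/\ K k, A a, K k' & g = k *m a *m k']].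

(** kap : TK -> M_n with law P is (a parametrisation of) the normalised,
    left and right invariant Haar measure on the compact group K: the
    pushforward of P along kap is concentrated on K and invariant under left
    and right translations by elements of K (tested against continuous
    functions). *)
Definition haar_on (R : realType) (n : nat) (K : set 'M[Cx R]_n)
    (d : measure_display) (T : measurableType d) (P : probability T R)
    (kap : T -> 'M[Cx R]_n) : Prop :=
  [/\ (forall t, K (kap t)), mx_measurable kap &
      forall g, K g -> forall f : 'M[Cx R]_n -> R, continuous f ->
        Rintegral P setT (fun t => f (g *m kap t)) = Rintegral P setT (fun t => f (kap t)) /\
        Rintegral P setT (fun t => f (kap t *m g)) = Rintegral P setT (fun t => f (kap t))].

(** alp : TA -> M_n with law P is an (arbitrary) normalised measure on A. *)
Definition measure_on (R : realType) (n : nat) (A : set 'M[Cx R]_n)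
    (d : measure_display) (T : measurableType d) (P : probability T R)
    (alp : T -> 'M[Cx R]_n) : Prop :=
  (forall t, A (alp t)) /\ mx_measurable alp.

(** Generalised twirling map
    T_G(rho) = \int (K A_n K') rho (K A_n K')^dagger dmu(K) dmu(A) dmu(K'). *)
Definition twirl (R : realType) (n : nat)
    (dK : measure_display) (TK : measurableType dK) (PK : probability TK R)
    (kap : TK -> 'M[Cx R]_n)
    (dA : measure_display) (TA : measurableType dA) (PA : probability TA R)
    (alp : TA -> 'M[Cx R]_n) (rho : 'M[Cx R]_n) : 'M[Cx R]_n :=
  mxint PK (fun t1 => mxint PA (fun a => mxint PK (fun t2 =>
    let M := kap t1 *m normalise (alp a) *m kap t2 in M *m rho *m adj M))).

(** beta_k = Tr( [\int A_n A_n^dagger dmu(A)] Pi_k^dagger ). *)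
Definition beta (R : realType) (n : nat)
    (dA : measure_display) (TA : measurableType dA) (PA : probability TA R)
    (alp : TA -> 'M[Cx R]_n) (Pk : 'M[Cx R]_n) : Cx R :=
  \tr (mxint PA (fun a => normalise (alp a) *m adj (normalise (alp a))) *m adj Pk).

(** Density operators: positive semidefinite, trace one. *)
Definition density (R : realType) (n : nat) (rho : 'M[Cx R]_n) : Prop :=
  [/\ adj rho = rho,
      (forall v : 'cV[Cx R]_n, 0 <= (adj v *m rho *m v) ord0 ord0) &
      \tr rho = 1].

(* Main.v *)
(* Let K be a maximal compact subgroup of the reductive group G. The Haar average of
   k X k^dagger over K commutes with K, and the point is that it then commutes with G.
   For each d, complete reducibility yields invariants of h under left translation by G
   that are linear in the tensor powers of diag(1, h, h^-T) of degree d. By the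
   Nullstellensatz they separate the cosets G h and a weighted sum of their squares
   attains a minimum; at a minimiser h, the group h^-1 G h is closed under adjoints.
   Minimising |y|^2 + |y^-1|^2 over the coset G h then makes y^-1 K y unitary, so by
   maximality it is the whole unitary part of the selfadjoint group y^-1 G y. With every
   positive p that group contains the unitary matrices p^(is), hence K and G have the
   same commutant.

   By invariance the twirl of rho is X Z, with X the average of rho and Z the average of
   B = int A_n A_n^dagger, both in the commutant of G. On that commutant a matrix is
   determined by its traces against the operators Pi_k^{m1 m2}, which averaging does not
   change. Since B commutes with these operators, Z is the scalar beta_k / d_k on the
   k-th block. *)
Require Import Defs.
From HB Require Import structures.
From mathcomp Require Import all_boot all_order all_algebra.
From mathcomp Require Import all_classical all_reals all_analysis.
From mathcomp Require Import complex measurable_realfun mxtens ring lra.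
Import numFieldTopology.Exports numFieldNormedType.Exports.
Import Order.TTheory GRing.Theory Num.Theory.
Set Implicit Arguments.
Unset Strict Implicit.
Unset Printing Implicit Defensive.
Local Open Scope classical_set_scope.
Local Open Scope ring_scope.

#[global] Arguments Cx : simpl never.

(** Maximality of K is a topological property, whereas reductivity concerns rational
    representations; a selfadjoint conjugate of G is the bridge between the two. The obstacle is
    that a family minimising the weighted sum may leave every compact part of GL(n): the values of
    the invariants converge, the points need not. The limit values generate a proper ideal, and the
    Nullstellensatz turns it back into an invertible matrix. Its proof uses that the field is
    uncountable while regular functions are filtered by countably many finite-dimensional spaces.
    Convexity is used in a discrete form: along x, x q, x q^2 with q hermitian, a squared norm has a
    nonnegative second difference, which vanishes only if the values at x and x q^2 agree. This
    serves twice, for the weighted sum of invariants and for |y|^2 + |y^-1|^2. Limits are taken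
    along ultrafilters, where bounded families converge. *)

Lemma invmx_uniq (S : comUnitRingType) m (A B : 'M[S]_m) : A *m B = 1%:M -> invmx A = B.
Proof.
by move=> AB; have [uA _] := mulmx1_unit AB; rewrite -[LHS]mulmx1 -AB mulmxA mulVmx // mul1mx.
Qed.

Lemma invmxM (S : comUnitRingType) m (A B : 'M[S]_m) : A \in unitmx -> B \in unitmx ->
  invmx (A *m B) = invmx B *m invmx A.
Proof.
by move=> uA uB; apply: invmx_uniq; rewrite mulmxA mulmxK // mulmxV.
Qed.

(** * Complex numbers through their real and imaginary parts *)

Definition CxRe (R : realType) (z : Cx R) : R := complex.Re z.
Definition CxIm (R : realType) (z : Cx R) : R := complex.Im z.
Definition mkCx (R : realType) (x y : R) : Cx R := Complex x y.

Section ComplexNumbers.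
Variable R : realType.
Implicit Types z w : Cx R.

Local Notation Re := (@CxRe R).
Local Notation Im := (@CxIm R).

Lemma CxRe_mk x y : Re (mkCx x y) = x. Proof. by []. Qed.
Lemma CxIm_mk x y : Im (mkCx x y) = y. Proof. by []. Qed.

Lemma CxP z w : Re z = Re w -> Im z = Im w -> z = w.
Proof. by case: z w => [a b] [c d]; rewrite /CxRe /CxIm /= => -> ->. Qed.

Lemma CxReD z w : Re (z + w) = Re z + Re w.
Proof. by case: z w => [a b] [c d]. Qed.
Lemma CxImD z w : Im (z + w) = Im z + Im w.
Proof. by case: z w => [a b] [c d]. Qed.
Lemma CxReN z : Re (- z) = - Re z.
Proof. by case: z => [a b]. Qed.
Lemma CxImN z : Im (- z) = - Im z.
Proof. by case: z => [a b]. Qed.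
Lemma CxReM z w : Re (z * w) = Re z * Re w - Im z * Im w.
Proof. by case: z w => [a b] [c d]. Qed.
Lemma CxImM z w : Im (z * w) = Re z * Im w + Im z * Re w.
Proof. by case: z w => [a b] [c d]. Qed.
Lemma CxRe_conj z : Re z^* = Re z.
Proof. by case: z. Qed.
Lemma CxIm_conj z : Im z^* = - Im z.
Proof. by case: z. Qed.
Lemma CxRe_sum I (r : seq I) (P : pred I) (F : I -> Cx R) :
  Re (\sum_(i <- r | P i) F i) = \sum_(i <- r | P i) Re (F i).
Proof. by elim/big_rec2 : _ => // i a b _ <-; rewrite CxReD. Qed.
Lemma CxIm_sum I (r : seq I) (P : pred I) (F : I -> Cx R) :
  Im (\sum_(i <- r | P i) F i) = \sum_(i <- r | P i) Im (F i).
Proof. by elim/big_rec2 : _ => // i a b _ <-; rewrite CxImD. Qed.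

Definition CxE := (CxReD, CxImD, CxReN, CxImN, CxReM, CxImM, CxRe_conj, CxIm_conj).

Definition cof (x : R) : Cx R := mkCx x 0.

Lemma Re_cof x : Re (cof x) = x. Proof. by []. Qed.
Lemma Im_cof x : Im (cof x) = 0. Proof. by []. Qed.

Lemma cofD x y : cof (x + y) = cof x + cof y.
Proof. by apply: CxP; rewrite !CxE /= ?addr0. Qed.
Lemma cofB x y : cof (x - y) = cof x - cof y.
Proof. by apply: CxP; rewrite !CxE /= ?subr0. Qed.
Lemma cofM x y : cof (x * y) = cof x * cof y.
Proof. by apply: CxP; rewrite !CxE /= ?mulr0 ?mul0r ?subr0 ?addr0. Qed.
Lemma cof_sum I (r : seq I) (P : pred I) (F : I -> R) :
  cof (\sum_(i <- r | P i) F i) = \sum_(i <- r | P i) cof (F i).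
Proof. by elim/big_rec2 : _ => // i a b _ <-; rewrite cofD. Qed.
Lemma cof_exp x k : cof (x ^+ k) = cof x ^+ k.
Proof. by elim: k => [//|k IH]; rewrite !exprS cofM IH. Qed.
Lemma cof_prod I (r : seq I) (P : pred I) (F : I -> R) :
  cof (\prod_(i <- r | P i) F i) = \prod_(i <- r | P i) cof (F i).
Proof. by elim/big_rec2 : _ => // i a b _ <-; rewrite cofM. Qed.
Lemma cof_inj : injective cof.
Proof. by move=> x y []. Qed.
Lemma cof0 : cof 0 = 0. Proof. by []. Qed.
Lemma cof_conj x : (cof x)^* = cof x.
Proof. by apply: CxP; rewrite !CxE /= ?oppr0. Qed.

(** The squared modulus as an element of [R]; the norm of [Cx R] takes its values in [Cx R], where
    suprema of reals cannot be formed directly. *)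
Definition nsq z : R := Re z ^+ 2 + Im z ^+ 2.

Lemma nsqM z w : nsq (z * w) = nsq z * nsq w.
Proof. by rewrite /nsq !CxE; ring. Qed.
Lemma nsq_ge0 z : 0 <= nsq z.
Proof. by rewrite addr_ge0 // sqr_ge0. Qed.
Lemma nsq0 : nsq 0 = 0.
Proof. by rewrite /nsq /= !expr0n addr0. Qed.
Lemma nsq1 : nsq 1 = 1.
Proof. by rewrite /nsq /= expr1n expr0n addr0. Qed.
Lemma nsq_conj z : nsq z^* = nsq z.
Proof. by rewrite /nsq !CxE sqrrN. Qed.
Lemma nsq_cof x : nsq (cof x) = x ^+ 2.
Proof. by rewrite /nsq /= expr0n addr0. Qed.
Lemma cof_nsq z : cof (nsq z) = z * z^*.
Proof. by apply: CxP; rewrite /= !CxE /nsq; ring. Qed.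
Lemma nsq_eq0 z : nsq z = 0 -> z = 0.
Proof.
move=> /eqP; rewrite paddr_eq0 ?sqr_ge0 // !sqrf_eq0 => /andP[/eqP a /eqP b].
exact: CxP.
Qed.
Lemma nsqD_le z w : nsq (z + w) <= 2 * nsq z + 2 * nsq w.
Proof.
rewrite /nsq !CxE -subr_ge0.
have -> : 2 * (Re z ^+ 2 + Im z ^+ 2) + 2 * (Re w ^+ 2 + Im w ^+ 2) -
  ((Re z + Re w) ^+ 2 + (Im z + Im w) ^+ 2) =
  (Re z - Re w) ^+ 2 + (Im z - Im w) ^+ 2 by ring.
by rewrite addr_ge0 // sqr_ge0.
Qed.
(** The factor comes from iterating [nsqD_le]. Cauchy-Schwarz would give m; later arguments ask only
    for a bound depending on the size. *)
Lemma nsq_sum_le m (F : 'I_m -> Cx R) :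
  nsq (\sum_(i < m) F i) <= 2 ^+ m * \sum_(i < m) nsq (F i).
Proof.
elim: m F => [|m IH] F; first by rewrite !big_ord0 nsq0 mulr0.
rewrite !big_ord_recl exprS; apply: (le_trans (nsqD_le _ _)).
rewrite [leRHS]mulrDr lerD //.
  rewrite ler_wpM2r ?nsq_ge0 // ler_peMr // exprn_ege1 // ler1n.
  by [].
by rewrite -mulrA ler_wpM2l // IH.
Qed.
Lemma Re_sq_le z : Re z ^+ 2 <= nsq z.
Proof. by rewrite lerDl sqr_ge0. Qed.
Lemma Im_sq_le z : Im z ^+ 2 <= nsq z.
Proof. by rewrite lerDr sqr_ge0. Qed.

Lemma lt_cof x y : (cof x < cof y) = (x < y).
Proof. by rewrite /cof /mkCx ltcE /= eqxx. Qed.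
Lemma Cx_gt0 z : 0 < z -> exists2 x, 0 < x & z = cof x.
Proof.
by case: z => a b; rewrite ltcE /= => /andP[/eqP -> a0]; exists a.
Qed.
Lemma norm_lt_cof z x : 0 < x -> (`|z| < cof x) = (nsq z < x ^+ 2).
Proof.
move=> x0; have cx0 : 0 < cof x by rewrite -cof0 lt_cof.
rewrite -(@ltr_pXn2r _ 2) ?nnegrE ?normr_ge0 ?(ltW cx0) //.
by rewrite normCK -cof_nsq expr2 -cofM lt_cof expr2.
Qed.

End ComplexNumbers.

Lemma mxtraceB (S : pzRingType) m (A B : 'M[S]_m) : \tr (A - B) = \tr A - \tr B.
Proof. exact: raddfB. Qed.

Lemma mxtrace_sum (S : pzRingType) m I (r : seq I) (P : pred I) (F : I -> 'M[S]_m) :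
  \tr (\sum_(i <- r | P i) F i) = \sum_(i <- r | P i) \tr (F i).
Proof. exact: raddf_sum. Qed.

(** * Adjoints and the Hilbert-Schmidt norm *)

Section Adjoint.
Variable R : realType.

Lemma adjE m p (A : 'M[Cx R]_(m, p)) i j : adj A i j = (A j i)^*.
Proof. by rewrite !mxE. Qed.
Lemma adjM m p q (A : 'M[Cx R]_(m, p)) (B : 'M[Cx R]_(p, q)) :
  adj (A *m B) = adj B *m adj A.
Proof. by rewrite /adj map_mxM trmx_mul. Qed.
Lemma adjK m p (A : 'M[Cx R]_(m, p)) : adj (adj A) = A.
Proof. by apply/matrixP => i j; rewrite !adjE conjCK. Qed.
Lemma adjD m p (A B : 'M[Cx R]_(m, p)) : adj (A + B) = adj A + adj B.
Proof. by rewrite /adj map_mxD linearD. Qed.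
Lemma adjN m p (A : 'M[Cx R]_(m, p)) : adj (- A) = - adj A.
Proof. by rewrite /adj map_mxN linearN. Qed.
Lemma adjB m p (A B : 'M[Cx R]_(m, p)) : adj (A - B) = adj A - adj B.
Proof. by rewrite adjD adjN. Qed.
Lemma adj_sum m p I (r : seq I) (P : pred I) (F : I -> 'M[Cx R]_(m, p)) :
  adj (\sum_(i <- r | P i) F i) = \sum_(i <- r | P i) adj (F i).
Proof.
elim/big_rec2 : _ => [|i a b _ <-]; last by rewrite adjD.
by apply/matrixP => i j; rewrite adjE !mxE conjC0.
Qed.
Lemma adj1mx m : adj (1%:M : 'M[Cx R]_m) = 1%:M.
Proof. by rewrite /adj map_mx1 trmx1. Qed.
Lemma adj_unit m (A : 'M[Cx R]_m) : (adj A \in unitmx) = (A \in unitmx).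
Proof. by rewrite /adj unitmx_tr map_unitmx. Qed.
Lemma adjV m (A : 'M[Cx R]_m) : adj (invmx A) = invmx (adj A).
Proof. by rewrite /adj map_invmx trmx_inv. Qed.

(** The squared Hilbert-Schmidt norm: polynomial in the real and imaginary parts of the entries,
    invariant under unitary factors on either side, and multiplicative on Kronecker products. *)
Definition sqnorm m p (A : 'M[Cx R]_(m, p)) : R := \sum_i \sum_j nsq (A i j).

Lemma sqnormE m p (A : 'M[Cx R]_(m, p)) : cof (sqnorm A) = \tr (A *m adj A).
Proof.
rewrite /sqnorm cof_sum /mxtrace; apply: eq_bigr => i _; rewrite cof_sum mxE.
by apply: eq_bigr => j _; rewrite cof_nsq adjE.
Qed.
Lemma sqnorm_ge0 m p (A : 'M[Cx R]_(m, p)) : 0 <= sqnorm A.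
Proof. by apply: sumr_ge0 => i _; apply: sumr_ge0 => j _; apply: nsq_ge0. Qed.
Lemma nsq_le_sqnorm m p (A : 'M[Cx R]_(m, p)) i j : nsq (A i j) <= sqnorm A.
Proof.
rewrite /sqnorm (bigD1 i) //= (bigD1 j) //= -addrA lerDl addr_ge0 //.
  by apply: sumr_ge0 => *; apply: nsq_ge0.
by apply: sumr_ge0 => *; apply: sumr_ge0 => *; apply: nsq_ge0.
Qed.
Lemma sqnorm_eq0 m p (A : 'M[Cx R]_(m, p)) : sqnorm A <= 0 -> A = 0.
Proof.
move=> A0; apply/matrixP => i j; rewrite mxE; apply: nsq_eq0; apply: le_anti.
by rewrite nsq_ge0 (le_trans (nsq_le_sqnorm _ _ _)).
Qed.
Lemma sqnorm_adj m p (A : 'M[Cx R]_(m, p)) : sqnorm (adj A) = sqnorm A.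
Proof.
rewrite /sqnorm exchange_big; apply: eq_bigr => i _; apply: eq_bigr => j _.
by rewrite adjE nsq_conj.
Qed.
Lemma sqnorm_mulr_unitary m p (A : 'M[Cx R]_(m, p)) (u : 'M[Cx R]_p) :
  u *m adj u = 1%:M -> sqnorm (A *m u) = sqnorm A.
Proof.
move=> uu; apply: (@cof_inj R).
by rewrite !sqnormE adjM mulmxA -[A *m u *m _]mulmxA uu mulmx1.
Qed.
Lemma sqnorm_mull_unitary m p (A : 'M[Cx R]_(m, p)) (u : 'M[Cx R]_m) :
  adj u *m u = 1%:M -> sqnorm (u *m A) = sqnorm A.
Proof.
move=> uu; rewrite -sqnorm_adj adjM sqnorm_mulr_unitary ?sqnorm_adj //.
by rewrite adjK.
Qed.
Lemma sqnorm_mul_le m p q (A : 'M[Cx R]_(m, p)) (B : 'M[Cx R]_(p, q)) :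
  sqnorm (A *m B) <= 2 ^+ p * (sqnorm A * sqnorm B).
Proof.
rewrite {1}/sqnorm.
apply: (@le_trans _ _ (\sum_i \sum_j 2 ^+ p * \sum_k (nsq (A i k) * nsq (B k j)))).
  apply: ler_sum => i _; apply: ler_sum => j _; rewrite mxE.
  rewrite (le_trans (nsq_sum_le _)) // ler_wpM2l ?exprn_ge0 // ler_sum // => k _.
  by rewrite nsqM.
under eq_bigr => i _ do rewrite -mulr_sumr.
rewrite -mulr_sumr ler_wpM2l ?exprn_ge0 //.
under eq_bigr => i _ do rewrite exchange_big /=.
rewrite exchange_big /= {1}/sqnorm exchange_big /= mulr_suml ler_sum // => k _.
rewrite mulr_suml ler_sum // => i _.
rewrite -mulr_sumr ler_wpM2l ?nsq_ge0 //.
rewrite /sqnorm (bigD1 (P := xpredT) i) //= lerDl.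
by apply: sumr_ge0 => *; apply: sumr_ge0 => *; apply: nsq_ge0.
Qed.

(* The parallelogram-type identity behind the convexity of g |-> |X g|^2 along
   one-parameter groups of positive matrices. *)
Lemma sqnorm_convex m p (X : 'M[Cx R]_(m, p)) (Q : 'M[Cx R]_p) : adj Q = Q ->
  sqnorm X + sqnorm (X *m (Q *m Q)) - 2 * sqnorm (X *m Q) =
  sqnorm (X - X *m (Q *m Q)).
Proof.
move=> Qh; apply: (@cof_inj R).
have -> : (2 : R) = 1 + 1 by [].
rewrite !mulrDl !mul1r cofB !cofD !sqnormE adjB !adjM Qh !mulmxBl !mulmxBr.
rewrite !mxtraceB !mulmxA.
have id4 (V : zmodType) (a b c : V) : a + b - (c + c) = a - c - (c - b).
  by rewrite opprD opprB addrACA.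
exact: id4.
Qed.

End Adjoint.

(** * Regular functions on GL(n) *)

Section RegularFunctions.
Variables (R : realType) (n : nat).
Local Notation C := (Cx R).
Implicit Types (h g : 'M[C]_n) (f : 'M[C]_n -> C).

(** The last block is the contragredient; its transpose keeps the map multiplicative on invertible
    matrices. The map also commutes with [adj], so hermitian matrices have hermitian images. *)
Definition affrep h : 'M[C]_(1 + (n + n)) :=
  block_mx 1%:M 0 0 (block_mx h 0 0 (invmx h)^T).

Fixpoint tdim (d : nat) : nat := if d is d'.+1 then ((1 + (n + n)) * tdim d')%N else 1%N.

Fixpoint trep (d : nat) h : 'M[C]_(tdim d) :=
  if d is d'.+1 then affrep h *t trep d' h else 1%:M.

Lemma affrep00 h i j : affrep h (lshift _ i) (lshift _ j) = (1%:M : 'M[C]_1) i j.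
Proof. exact: block_mxEul. Qed.
Lemma affrep01 h i j : affrep h (lshift _ i) (rshift _ j) = 0.
Proof. by rewrite /affrep block_mxEur mxE. Qed.
Lemma affrep10 h i j : affrep h (rshift _ i) (lshift _ j) = 0.
Proof. by rewrite /affrep block_mxEdl mxE. Qed.
Lemma affrep11 h i j : affrep h (rshift _ (lshift _ i)) (rshift _ (lshift _ j)) = h i j.
Proof. by rewrite /affrep block_mxEdr block_mxEul. Qed.
Lemma affrep12 h i j : affrep h (rshift _ (lshift _ i)) (rshift _ (rshift _ j)) = 0.
Proof. by rewrite /affrep block_mxEdr block_mxEur mxE. Qed.
Lemma affrep21 h i j : affrep h (rshift _ (rshift _ i)) (rshift _ (lshift _ j)) = 0.
Proof. by rewrite /affrep block_mxEdr block_mxEdl mxE. Qed.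
Lemma affrep22 h i j : affrep h (rshift _ (rshift _ i)) (rshift _ (rshift _ j)) = invmx h j i.
Proof. by rewrite /affrep block_mxEdr block_mxEdr mxE. Qed.

Lemma affrep_cases i j : [\/ exists c, forall h, affrep h i j = c,
  exists a b, forall h, affrep h i j = h a b |
  exists a b, forall h, affrep h i j = invmx h a b].
Proof.
case: (split_ordP i) => i0 ->; case: (split_ordP j) => j0 ->.
- by apply: Or31; eexists => h; exact: affrep00.
- by apply: Or31; eexists => h; exact: affrep01.
- by apply: Or31; eexists => h; exact: affrep10.
case: (split_ordP i0) => i1 ->; case: (split_ordP j0) => j1 ->.
- by apply: Or32; exists i1, j1 => h; exact: affrep11.
- by apply: Or31; eexists => h; exact: affrep12.
- by apply: Or31; eexists => h; exact: affrep21.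
- by apply: Or33; exists j1, i1 => h; exact: affrep22.
Qed.

Lemma affrepM h g : h \in unitmx -> g \in unitmx ->
  affrep (h *m g) = affrep h *m affrep g.
Proof.
move=> uh ug; rewrite /affrep !mulmx_block !(mulmx0, mul0mx, addr0, add0r, mulmx1).
by rewrite -trmx_mul invmxM.
Qed.

Lemma affrep1 : affrep 1%:M = 1%:M.
Proof. by rewrite /affrep invmx1 trmx1 -!scalar_mx_block. Qed.

Lemma affrep_adj h : adj (affrep h) = affrep (adj h).
Proof.
rewrite /affrep /adj !map_block_mx !tr_block_mx !map_mx0 !trmx0 map_mx1 trmx1.
by rewrite -[map_mx _ (invmx h)^T]map_trmx trmxK map_invmx trmx_inv trmxK.
Qed.

Lemma sqnorm_block m1 m2 p1 p2 (A : 'M[C]_(m1, p1)) (B : 'M[C]_(m1, p2))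
  (D : 'M[C]_(m2, p1)) (E : 'M[C]_(m2, p2)) :
  sqnorm (block_mx A B D E) = sqnorm A + sqnorm B + (sqnorm D + sqnorm E).
Proof.
rewrite /sqnorm big_split_ord /= -!big_split /=; congr (_ + _);
  apply: eq_bigr => i _; rewrite big_split_ord /=; congr (_ + _);
  by apply: eq_bigr => j _; rewrite ?(block_mxEul, block_mxEur, block_mxEdl, block_mxEdr).
Qed.

Lemma sqnorm0 m p : sqnorm (0 : 'M[C]_(m, p)) = 0.
Proof. by rewrite /sqnorm big1 // => i _; rewrite big1 // => j _; rewrite mxE nsq0. Qed.

Lemma sqnorm_tr m p (A : 'M[C]_(m, p)) : sqnorm A^T = sqnorm A.
Proof.
by rewrite /sqnorm exchange_big; apply: eq_bigr => i _; apply: eq_bigr => j _; rewrite mxE.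
Qed.

(** The 1 is the contribution of the constant block, so that the tensor power of degree d has
    squared norm exactly [size_fun h ^+ d]. This growth dictates the weights of the series minimised
    below. *)
Definition size_fun h : R := 1 + (sqnorm h + sqnorm (invmx h)).

Lemma size_fun_ge1 h : 1 <= size_fun h.
Proof. by rewrite lerDl addr_ge0 // sqnorm_ge0. Qed.

Lemma sqnorm_affrep h : sqnorm (affrep h) = size_fun h.
Proof.
rewrite /affrep !sqnorm_block !sqnorm0 !addr0 !add0r sqnorm_tr /size_fun.
by rewrite {1}/sqnorm !big_ord1 mxE eqxx nsq1.
Qed.

Lemma sqnorm_tens m1 m2 p1 p2 (A : 'M[C]_(m1, p1)) (B : 'M[C]_(m2, p2)) :
  sqnorm (A *t B) = sqnorm A * sqnorm B.
Proof.
rewrite {1}/sqnorm.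
under eq_bigr => i _ do under eq_bigr => j _ do rewrite mxE nsqM.
under eq_bigr => i _ do rewrite -(mulr_sum (fun j => nsq (A (mxtens_unindex i).1 j))
   (fun j => nsq (B (mxtens_unindex i).2 j))).
by rewrite -(mulr_sum (fun i => \sum_j nsq (A i j)) (fun i => \sum_j nsq (B i j))).
Qed.

Lemma sqnorm_trep d h : sqnorm (trep d h) = size_fun h ^+ d.
Proof.
elim: d => [|d IH]; first by rewrite /sqnorm !big_ord1 mxE eqxx nsq1.
by rewrite /= sqnorm_tens sqnorm_affrep IH exprS.
Qed.

Lemma trepM d h g : h \in unitmx -> g \in unitmx ->
  trep d (h *m g) = trep d h *m trep d g.
Proof.
move=> uh ug; elim: d => [|d IH] /=; first by rewrite mulmx1.
by rewrite tensmx_mul affrepM // IH.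
Qed.

Lemma trep1 d : trep d 1%:M = 1%:M.
Proof.
elim: d => [//|d IH] /=; rewrite IH affrep1; apply/matrixP => i j.
case: (mxtens_indexP i) => i0 i1; case: (mxtens_indexP j) => j0 j1.
rewrite tensmxE !mxE (can_eq (@mxtens_indexK _ _)) xpair_eqE.
by case: eqP; case: eqP; rewrite ?mulr1 ?mulr0.
Qed.

Lemma trep_adj d h : adj (trep d h) = trep d (adj h).
Proof.
elim: d => [|d IH] /=; first by rewrite adj1mx.
by rewrite -affrep_adj -IH /adj map_mxT trmx_tens.
Qed.

(** Degree at most d in the entries of h and of its inverse: a filtration of the coordinate ring of
    GL(n) by finite-dimensional spaces. The formula is required at singular matrices too, where
    [invmx h] is h by convention. *)
Definition regd d f := exists c : 'M[C]_(tdim d), forall h, f h = \tr (c *m trep d h).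

Definition regular f := exists d, regd d f.

Lemma regdD d f1 f2 : regd d f1 -> regd d f2 -> regd d (fun h => f1 h + f2 h).
Proof. by case=> c1 H1 [c2 H2]; exists (c1 + c2) => h; rewrite H1 H2 mulmxDl mxtraceD. Qed.

Lemma regdZ d a f : regd d f -> regd d (fun h => a * f h).
Proof. by case=> c H; exists (a *: c) => h; rewrite H -scalemxAl mxtraceZ. Qed.

Lemma regd_sum d I (r : seq I) (F : I -> 'M[C]_n -> C) :
  (forall i, regd d (F i)) -> regd d (fun h => \sum_(i <- r) F i h).
Proof.
move=> H; elim: r => [|i r [c IH]].
  by exists 0 => h; rewrite big_nil mul0mx mxtrace0.
have [c' Hc'] := regdD (H i) (ex_intro _ c IH).
by exists c' => h; rewrite big_cons Hc'.
Qed.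

Lemma tr_entries d (c : 'M[C]_(tdim d)) h :
  \tr (c *m trep d h) = \sum_i \sum_j c i j * trep d h j i.
Proof. by apply: eq_bigr => i _; rewrite mxE. Qed.

Lemma regd_entry d i j : regd d (fun h => trep d h i j).
Proof.
exists (delta_mx j i) => h; rewrite tr_entries (bigD1 j) //= (bigD1 i) //=.
rewrite mxE !eqxx mul1r !big1 ?addr0 // => k.
  by move=> /negbTE kj; apply: big1 => l _; rewrite mxE kj mul0r.
by move=> /negbTE ki; rewrite mxE ki andbF mul0r.
Qed.

Lemma regd_ext d f1 f2 : (forall h, f1 h = f2 h) -> regd d f1 -> regd d f2.
Proof. by move=> E [c H]; exists c => h; rewrite -E. Qed.

(* The three blocks of affrep provide the constant 1 and the entries of h and of
   its inverse, so that trep d.+1 multiplies functions of degree d by any of these. *)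
Lemma regd_affrep d i j f : regd d f -> regd d.+1 (fun h => affrep h i j * f h).
Proof.
case=> c H.
apply: (@regd_ext _ (fun h => \sum_k \sum_l c k l *
    trep d.+1 h (mxtens_index (i, l)) (mxtens_index (j, k)))).
  move=> h; rewrite H tr_entries mulr_sumr; apply: eq_bigr => k _.
  rewrite mulr_sumr; apply: eq_bigr => l _.
  by rewrite [trep _ _]/(affrep h *t trep d h) tensmxE mulrCA.
apply: regd_sum => k; apply: regd_sum => l; apply: regdZ; exact: regd_entry.
Qed.

Lemma regdS d f : regd d f -> regd d.+1 f.
Proof.
move=> H; apply: regd_ext (regd_affrep (lshift _ ord0) (lshift _ ord0) H) => h.
by rewrite affrep00 mxE eqxx mul1r.
Qed.

Lemma regd_le d1 d2 f : (d1 <= d2)%N -> regd d1 f -> regd d2 f.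
Proof.
by move/subnK <-; elim: (d2 - d1)%N => [//|k IH] H; apply: regdS; exact: IH.
Qed.

Lemma regdM d1 d2 f1 f2 : regd d1 f1 -> regd d2 f2 ->
  regd (d1 + d2) (fun h => f1 h * f2 h).
Proof.
case=> c H1 H2.
have entry i j : regd (d1 + d2) (fun h => trep d1 h i j * f2 h).
  elim: d1 {c H1} i j => [|d IH] i j.
    apply: regd_ext (regdZ ((1%:M : 'M[C]_1) i j) H2) => h.
    by [].
  case: (mxtens_indexP i) => i0 i1; case: (mxtens_indexP j) => j0 j1.
  apply: regd_ext (regd_affrep i0 j0 (IH i1 j1)) => h.
  by rewrite [trep d.+1 _]/(affrep h *t trep d h) tensmxE mulrA.
apply: (@regd_ext _ (fun h => \sum_i \sum_j c i j * (trep d1 h j i * f2 h))).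
  move=> h; rewrite H1 tr_entries mulr_suml; apply: eq_bigr => i _.
  by rewrite mulr_suml; apply: eq_bigr => j _; rewrite mulrA.
by apply: regd_sum => i; apply: regd_sum => j; apply: regdZ.
Qed.

Lemma regularD f1 f2 : regular f1 -> regular f2 -> regular (fun h => f1 h + f2 h).
Proof.
case=> d1 H1 [d2 H2]; exists (maxn d1 d2).
by apply: regdD; [apply: regd_le H1 | apply: regd_le H2]; rewrite ?leq_maxl ?leq_maxr.
Qed.

Lemma regularM f1 f2 : regular f1 -> regular f2 -> regular (fun h => f1 h * f2 h).
Proof. by case=> d1 H1 [d2 H2]; exists (d1 + d2)%N; apply: regdM. Qed.

Lemma regd_const d a : regd d (fun=> a).
Proof.
apply: (regd_le (leq0n d)); exists a%:M => h.
by rewrite mulmx1 mxtrace_scalar.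
Qed.

Lemma regular_const a : regular (fun=> a).
Proof. by exists 0%N; exact: regd_const. Qed.

Lemma regular_affrep i j : regular (fun h => affrep h i j).
Proof.
exists 1%N; apply: regd_ext (regd_affrep i j (regd_const 0 1)) => h.
by rewrite mulr1.
Qed.

Lemma regular_ext f1 f2 : (forall h, f1 h = f2 h) -> regular f1 -> regular f2.
Proof. by move=> E [d H]; exists d; apply: regd_ext H. Qed.

Lemma regular_entry i j : regular (fun h => h i j).
Proof.
apply: regular_ext (regular_affrep (rshift _ (lshift _ i)) (rshift _ (lshift _ j))) => h.
exact: affrep11.
Qed.

Lemma regular_inv i j : regular (fun h => invmx h i j).
Proof.
apply: regular_ext (regular_affrep (rshift _ (rshift _ j)) (rshift _ (rshift _ i))) => h.
exact: affrep22.
Qed.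

Lemma regular_sum I (r : seq I) (F : I -> 'M[C]_n -> C) :
  (forall i, regular (F i)) -> regular (fun h => \sum_(i <- r) F i h).
Proof.
move=> H; elim: r => [|i r IH].
  by apply: regular_ext (regular_const 0) => h; rewrite big_nil.
by apply: regular_ext (regularD (H i) IH) => h; rewrite big_cons.
Qed.

(** With [a] the inverse of h, an equation of a group G becomes an equation of the coset G h. *)
Lemma regular_polyfun (p : 'M[C]_n -> C) a : polyfun p -> regular (fun h => p (h *m a)).
Proof.
elim=> [c|i j|p1 p2 _ H1 _ H2|p1 p2 _ H1 _ H2].
- exact: regular_const.
- apply: (@regular_ext (fun h => \sum_k h i k * a k j)); first by move=> h; rewrite mxE.
  apply: regular_sum => k; apply: regularM; [exact: regular_entry | exact: regular_const].
- exact: regularD.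
- exact: regularM.
Qed.

End RegularFunctions.

(** * Nullstellensatz and averaging over a reductive group *)

Lemma horner_lagrange (F : fieldType) m (l z : 'I_m -> F) x :
  (\sum_i l i *: \prod_(j | j != i) ('X - (z j)%:P)).[x] =
  \sum_i l i * \prod_(j | j != i) (x - z j).
Proof.
rewrite horner_sum; apply: eq_bigr => i _; rewrite hornerZ horner_prod; congr (_ * _).
by apply: eq_bigr => j _; rewrite hornerXsubC.
Qed.

Lemma horner_roots (F : fieldType) (a : F) (rs : seq F) x :
  (a *: \prod_(r <- rs) ('X - r%:P)).[x] = a * \prod_(r <- rs) (x - r).
Proof.
rewrite hornerZ horner_prod; congr (_ * _).
by apply: eq_bigr => j _; rewrite hornerXsubC.
Qed.

(** Countably many finite fibres would make R countable, but a countable set has Lebesgue measure 0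
    and the unit interval has measure 1. *)
Lemma uncountable_fiber (R : realType) (F : R -> nat) : exists d, infinite_set [set c | F c = d].
Proof.
apply: contrapT => /forallNP H.
have cT : countable [set: R].
  rewrite (_ : setT = \bigcup_(d in [set: nat]) [set c | F c = d]).
    apply: bigcup_countable => // d _; apply: finite_set_countable.
    exact: contrapT (H d).
  by apply/seteqP; split => // c _; exists (F c).
have c01 : countable `[(0 : R), 1]%classic by apply: sub_countable cT; apply: subset_card_le.
have := countable_lebesgue_measure0 c01.
rewrite lebesgue_measure_itv /= lte_fin ltr01 sube0 => /eqP.
by rewrite eqe oner_eq0.
Qed.

Lemma row_dependence (F : fieldType) N p (A : 'M[F]_(N, p)) : (p < N)%N ->
  exists2 l : 'rV[F]_N, l != 0 & l *m A = 0.
Proof.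
move=> pN; have : kermx A != 0.
  by rewrite -mxrank_eq0 mxrank_ker -lt0n subn_gt0 (leq_ltn_trans (rank_leq_col A)).
case/rowV0Pn => l /sub_kermxP lA l0; exists l => //.
Qed.

Section Nullstellensatz.
Variables (R : realType) (n : nat).
Local Notation C := (Cx R).
Local Notation fn := ('M[C]_n -> C).
Implicit Types (I : fn -> Prop) (f a x : fn).

(** Only the multipliers are regular; members may be arbitrary functions. This leaves room for
    ideals whose membership is tested on invertible matrices alone. *)
Definition ideal I := [/\ I (fun=> 0),
  (forall f g, I f -> I g -> I (fun h => f h + g h)) &
  (forall f a, I f -> regular a -> I (fun h => f h * a h))].

Lemma ideal_sum I J (r : seq J) (F : J -> fn) : ideal I -> (forall j, I (F j)) ->
  I (fun h => \sum_(j <- r) F j h).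
Proof.
case=> I0 ID IM H; elim: r => [|j r IH].
  by rewrite (_ : (fun h => _) = fun=> 0) //; apply/funext => h; rewrite big_nil.
rewrite (_ : (fun h => _) = fun h => F j h + \sum_(k <- r) F k h); first exact: ID.
by apply/funext => h; rewrite big_cons.
Qed.

Definition adjoin I x (c : C) : fn -> Prop := fun f => exists g a,
  [/\ I g, regular a & forall h, f h = g h + a h * (x h - c)].

Lemma adjoin_ideal I x c : ideal I -> ideal (adjoin I x c).
Proof.
case=> I0 ID IM; split.
- exists (fun=> 0), (fun=> 0); split => //; first exact: regular_const.
  by move=> h; rewrite mul0r addr0.
- move=> f1 f2 [g1 [a1 [G1 A1 E1]]] [g2 [a2 [G2 A2 E2]]].
  exists (fun h => g1 h + g2 h), (fun h => a1 h + a2 h); split; [exact: ID|exact: regularD|].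
  by move=> h; rewrite E1 E2 mulrDl addrACA.
- move=> f b [g [a [G1 A1 E1]]] B.
  exists (fun h => g h * b h), (fun h => a h * b h); split; [exact: IM|exact: regularM|].
  by move=> h; rewrite E1 mulrDl mulrAC.
Qed.

Lemma regular_prod J (r : seq J) (P : pred J) (F : J -> fn) : (forall j, regular (F j)) ->
  regular (fun h => \prod_(j <- r | P j) F j h).
Proof.
move=> H; elim: r => [|j r IH].
  by apply: regular_ext (regular_const _ 1) => h; rewrite big_nil.
case Pj : (P j).
  by apply: regular_ext (regularM (H j) IH) => h; rewrite big_cons Pj.
by apply: regular_ext IH => h; rewrite big_cons Pj.
Qed.

(* If 1 = g_c + a_c (x - c) with g_c in I for every c, then uncountably many of the a_c
   lie in one finite-dimensional space; a linear relation between them makes x a root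
   of a nonzero polynomial modulo I, whose factors x - c are units modulo I. *)
Lemma proper_adjoin I x : ideal I -> ~ I (fun=> 1) -> regular x ->
  exists c, ~ adjoin I x c (fun=> 1).
Proof.
move=> iI I1 xR; apply: contrapT => /forallNP H.
have {}H c : adjoin I x c (fun=> 1) by exact: contrapT (H c).
case: (iI) => I0 ID IM.
have {}H c : exists ga : fn * fn * nat, [/\ I ga.1.1, regd ga.2 ga.1.2 &
     forall h, 1 = ga.1.1 h + ga.1.2 h * (x h - c)].
  by have [g [a [Ig [d ad] E]]] := H c; exists (g, a, d).
have [w Hw] := choice H.
have [d dinf] := uncountable_fiber (fun c : R => (w (cof c)).2).
(* The coefficient matrices of degree d form a space of dimension m, so m + 1 of the functions a_c
   of that degree are linearly dependent. *)
set m := (tdim n d * tdim n d)%N.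
have [B Bsub sB] := infinite_set_fset m.+1 dinf.
pose z (i : 'I_m.+1) : C := cof (nth 0 (finmap.enum_fset B) i).
have zinj : injective z.
  move=> i j /(@cof_inj R) /eqP; rewrite nth_uniq ?finmap.fset_uniq //.
  - by move=> /eqP; apply: val_inj.
  - exact: leq_trans (ltn_ord i) sB.
  - exact: leq_trans (ltn_ord j) sB.
have wz i : (w (z i)).2 = d.
  apply: (Bsub (nth 0 (finmap.enum_fset B) i)) => /=; apply: mem_nth.
  exact: leq_trans (ltn_ord i) sB.
have /choice [cc Hcc] : forall i, exists c : 'M[C]_(tdim n d),
    forall h, (w (z i)).1.2 h = \tr (c *m trep d h).
  by move=> i; have [_] := Hw (z i); rewrite wz.
have [l l0 lker] := @row_dependence _ m.+1 m (\matrix_i mxvec (cc i)) (ltnSn _).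
have lsum h : \sum_i l 0 i * (w (z i)).1.2 h = 0.
  have : \tr (vec_mx (l *m (\matrix_i mxvec (cc i))) *m trep d h) = 0.
    by rewrite lker linear0 mul0mx mxtrace0.
  rewrite mulmx_sum_row linear_sum mulmx_suml mxtrace_sum => E; apply: etrans E.
  apply: eq_bigr => i _.
  by rewrite rowK linearZ /= mxvecK -scalemxAl mxtraceZ Hcc.
(* Multiply 1 = g_i + a_i (x - z_i) by l_i times the product of the x - z_j over j != i and sum over
   i: since the l_i a_i add up to 0, Q(x) is a combination of the g_i. At z_i only the i-th summand
   of Q survives, so Q is not zero. *)
pose Q : {poly C} := \sum_i l 0 i *: \prod_(j | j != i) ('X - (z j)%:P).
have Qz : Q != 0.
  have [i li] : exists i, l 0 i != 0.
    by apply/existsP; apply: contraNT l0 => /existsPn l0; apply/eqP/rowP => i;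
      rewrite mxE; apply/eqP; move: (l0 i); rewrite negbK.
  have nz : l 0 i * \prod_(j | j != i) (z i - z j) != 0.
    rewrite mulf_neq0 //; apply/prodf_neq0 => j ji; rewrite subr_eq0.
    by apply: contraNneq ji => /zinj ->.
  have Qi : Q.[z i] = l 0 i * \prod_(j | j != i) (z i - z j).
    rewrite horner_lagrange (bigD1 i) //= [X in _ + X]big1 ?addr0 // => j ji.
    by rewrite (bigD1 i) 1?eq_sym //= subrr mul0r mulr0.
  by apply: contraNneq nz => Q0; rewrite -Qi Q0 horner0.
have IQ : I (fun h => Q.[x h]).
  rewrite (_ : (fun h => _) = fun h => \sum_i (w (z i)).1.1 h *
      (l 0 i * \prod_(j | j != i) (x h - z j))).
    apply: ideal_sum => // i; have [Ii _ _] := Hw (z i).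
    apply: (IM _ (fun h => l 0 i * \prod_(j | j != i) (x h - z j))) => //.
    apply: regularM; first exact: regular_const.
    apply: regular_prod => j; apply: regularD => //; exact: regular_const.
  apply/funext => h; rewrite horner_lagrange.
  transitivity (\sum_i ((w (z i)).1.1 h * (l 0 i * \prod_(j | j != i) (x h - z j)) +
        (l 0 i * (w (z i)).1.2 h) * \prod_j (x h - z j))).
    apply: eq_bigr => i _; rewrite [in X in _ = _ + X](bigD1 i) //=.
    have [_ _ E] := Hw (z i).
    rewrite -[LHS]mul1r {1}(E h); ring.
  by rewrite big_split /= -mulr_suml lsum mul0r addr0.
have [rs Qrs] := closed_field_poly_normal Q.
have {}IQ : I (fun h => \prod_(r <- rs) (x h - r)).
  rewrite (_ : (fun h => _) = fun h => Q.[x h] * (lead_coef Q)^-1).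
    by apply: (IM _ (fun=> (lead_coef Q)^-1)) => //; exact: regular_const.
  apply/funext => h; rewrite {1}Qrs horner_roots mulrAC mulfV ?mul1r //.
  by rewrite lead_coef_eq0.
(* One factor is removed at a time: if P is the product of the remaining factors, then P = g_r P +
   a_r (x - r) P and both terms lie in I. The empty product then contradicts properness. *)
elim: rs IQ {Qrs} => [|r rs IH] IQ.
  by apply: I1; move: IQ; rewrite (_ : (fun h => _) = fun=> 1) //; apply/funext => h; rewrite big_nil.
apply: IH; have [Ig [d' ad'] E] := Hw r; move: Ig E ad'.
move: (w r).1.1 (w r).1.2 => g a Ig E ad'.
rewrite (_ : (fun h => _) = fun h => g h * \prod_(r <- rs) (x h - r) +
   \prod_(r <- r :: rs) (x h - r) * a h).
  apply: (ID (fun h => g h * \prod_(r <- rs) (x h - r))); last first.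
    by apply: (IM _ a) => //; exists (w r).2; exists d'.
  apply: (IM g (fun h => \prod_(r <- rs) (x h - r))) => //.
  apply: regular_prod => j; apply: regularD => //; exact: regular_const.
apply/funext => h; rewrite big_cons -[LHS]mul1r {1}(E h); ring.
Qed.

Lemma proper_adjoin_all I (xs : seq fn) : ideal I -> ~ I (fun=> 1) ->
  {in xs, forall x, regular x} -> exists J, [/\ ideal J, ~ J (fun=> 1),
    (forall f, I f -> J f) & forall x, x \in xs -> exists c, J (fun h => x h - c)].
Proof.
elim: xs I => [|x xs IH] I iI I1 H.
  by exists I; split.
have [c Hc] := proper_adjoin iI I1 (H x (mem_head _ _)).
have [|J [iJ J1 IJ HJ]] := IH _ (adjoin_ideal x c iI) Hc.
  by move=> y yx; apply: H; rewrite inE yx orbT.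
case: (iI) => I0 ID IM.
exists J; split => //.
- move=> f If; apply: IJ; exists f, (fun=> 0); split => //; first exact: regular_const.
  by move=> h; rewrite mul0r addr0.
- move=> y; rewrite inE => /orP[/eqP ->|/HJ //]; exists c; apply: IJ.
  exists (fun=> 0), (fun=> 1); split => //; first exact: regular_const.
  by move=> h; rewrite add0r mul1r.
Qed.

(* The hypothesis on functions vanishing on the units makes the point supplied by
   the zeros of the coordinate functions an invertible matrix. *)
Theorem weak_nullstellensatz I : ideal I -> ~ I (fun=> 1) ->
  (forall f, regular f -> (forall h, h \in unitmx -> f h = 0) -> I f) ->
  exists2 h0 : 'M[C]_n, h0 \in unitmx & forall f, regular f -> I f -> f h0 = 0.
Proof.
move=> iI I1 Ivan.
pose xs : seq fn := [seq (fun h : 'M[C]_n => affrep h ij.1 ij.2) | ij <- enum [set: 'I_(1 + (n + n)) * 'I_(1 + (n + n))]%SET].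
have [|J [iJ J1 IJ HJ]] := @proper_adjoin_all I xs iI I1.
  by move=> x /mapP[[i j] _ ->]; exact: regular_affrep.
case: (iJ) => J0 JD JM.
have Jc c : J (fun=> c) -> c = 0.
  move=> Hc; apply: contrapT => /eqP c0; apply: J1.
  have := JM _ (fun=> c^-1) Hc (regular_const _ _).
  by under eq_fun do rewrite mulfV //.
have /choice [x0 Hx] : forall ij, exists c, J (fun h => affrep h ij.1 ij.2 - c).
  by move=> ij; apply: HJ; apply/mapP; exists ij => //; rewrite mem_enum inE.
have [X HX] : exists X : 'M[C]_n, forall i j, J (fun h => h i j - X i j).
  exists (\matrix_(i, j) x0 (rshift 1 (lshift n i), rshift 1 (lshift n j))) => i j.
  have := Hx (rshift 1 (lshift n i), rshift 1 (lshift n j)).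
  by under eq_fun do rewrite /= affrep11; rewrite mxE.
have [Y HY] : exists Y : 'M[C]_n, forall i j, J (fun h => invmx h i j - Y i j).
  exists (\matrix_(i, j) x0 (rshift 1 (rshift n j), rshift 1 (rshift n i))) => i j.
  have := Hx (rshift 1 (rshift n j), rshift 1 (rshift n i)).
  by under eq_fun do rewrite /= affrep22; rewrite mxE.
have JN f : J f -> J (fun h => - f h).
  move=> Jf; have := JM _ (fun=> -1) Jf (regular_const _ _).
  by under eq_fun do rewrite mulrN1.
have Jmul (f g : fn) (a b : C) : J (fun h => f h - a) -> regular g -> J (fun h => g h - b) ->
    J (fun h => f h * g h - a * b).
  move=> Jf rg Jg.
  rewrite (_ : (fun h => _) = fun h => (f h - a) * g h + (g h - b) * a).
    apply: (JD (fun h => (f h - a) * g h)); first exact: (JM (fun h => f h - a)).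
    exact: (JM (fun h => g h - b) (fun=> a) Jg (regular_const _ _)).
  by apply/funext => h; ring.
have XY : X *m Y = 1%:M.
  apply/matrixP => i k; apply/eqP; rewrite -subr_eq0; apply/eqP; apply: Jc.
  (* The relation h h^-1 = 1 holds only on units and enters I by [Ivan]. Modulo J it is a constant,
     and J contains no constant except 0. *)
  pose rel : fn := fun h => \sum_j h i j * invmx h j k - (1%:M : 'M[C]_n) i k.
  have Jrel : J rel.
    apply: IJ; apply: Ivan => [|h uh].
      apply: regularD; last exact: regular_const.
      by apply: regular_sum => j; apply: regularM; [exact: regular_entry|exact: regular_inv].
    by rewrite /rel -(mulmxV uh) mxE subrr.
  rewrite (_ : (fun=> _) = fun h => rel h + - \sum_j (h i j * invmx h j k - X i j * Y j k)).
    apply: JD => //; apply: JN; apply: ideal_sum => // j; apply: Jmul => //; exact: regular_inv.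
  apply/funext => h; rewrite /rel sumrB mxE; ring.
have [uX _] := mulmx1_unit XY; exists X => //.
have iX : invmx X = Y := invmx_uniq XY.
have Jcst (f : fn) (a : C) : (forall h, f h = a) -> J (fun h => f h - a).
  by move=> E; rewrite (_ : (fun h => _) = fun=> 0) //; apply/funext => h; rewrite E subrr.
have Haff i j : J (fun h => affrep h i j - affrep X i j).
  have [[c E]|[a [b E]]|[a [b E]]] := affrep_cases R i j.
  - by apply: (Jcst (fun h => affrep h i j)) => h; apply: etrans (E h) (esym (E X)).
  - rewrite (_ : (fun h : 'M[C]_n => _) = fun h : 'M[C]_n => h a b - X a b) //.
    by apply/funext => h; congr (_ - _); apply: E.
  - rewrite (_ : (fun h : 'M[C]_n => _) = fun h : 'M[C]_n => invmx h a b - Y a b) //.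
    by apply/funext => h; rewrite -iX; congr (_ - _); apply: E.
have Htrep d i j : J (fun h => trep d h i j - trep d X i j).
  elim: d i j => [|d IH] i j.
    exact: Jcst.
  case: (mxtens_indexP i) => i0 i1; case: (mxtens_indexP j) => j0 j1.
  have E h : trep d.+1 h (mxtens_index (i0, i1)) (mxtens_index (j0, j1)) =
      affrep h i0 j0 * trep d h i1 j1 by rewrite [trep d.+1 _]/(affrep h *t trep d h) tensmxE.
  under eq_fun do rewrite !E.
  by apply: Jmul => //; exists d; exact: regd_entry.
move=> f [d [c Hf]] If; apply/eqP; rewrite -oppr_eq0; apply/eqP; apply: Jc.
rewrite (_ : (fun=> _) = fun h => (f h - f X) + - f h); last first.
  by apply/funext => h; ring.
apply: (JD (fun h => f h - f X)); last by apply: JN; exact: IJ.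
rewrite (_ : (fun h => _) = fun h => \sum_i \sum_j (trep d h j i - trep d X j i) * c i j).
  apply: ideal_sum => // i; apply: ideal_sum => // j.
  exact: (JM (fun h => trep d h j i - trep d X j i) (fun=> c i j) _ (regular_const _ _)).
apply/funext => h; rewrite !Hf !tr_entries -sumrB; apply: eq_bigr => i _.
by rewrite -sumrB; apply: eq_bigr => j _; ring.
Qed.

End Nullstellensatz.

(** Among the matrices with all rows in S one has maximal rank; a vector of S outside its row space
    would raise the rank. This puts a subspace given by a predicate into the form required by
    [completely_reducible]. *)
Lemma span_matrix (F : fieldType) N (S : 'rV[F]_N -> Prop) : S 0 ->
  (forall a u v, S u -> S v -> S (a *: u + v)) ->
  exists U : 'M[F]_N, forall v, (v <= U)%MS <-> S v.
Proof.
move=> S0 SL.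
have Scomb (J : finType) (c : J -> F) (u : J -> 'rV[F]_N) : (forall j, S (u j)) -> S (\sum_j c j *: u j).
  move=> Su; elim/big_ind : _ => // [x y Sx Sy|j _].
    by rewrite -[x]scale1r; exact: SL.
  by rewrite -[_ *: _]addr0; exact: SL.
have Ssub m (U : 'M[F]_(m, N)) v : (forall i, S (row i U)) -> (v <= U)%MS -> S v.
  by move=> SU /submxP[D ->]; rewrite mulmx_sum_row; apply: Scomb.
pose P r := `[< (exists2 U : 'M[F]_N, (forall i, S (row i U)) & \rank U = r) >].
have exP : exists r, P r.
  exists 0%N; apply/asboolP; exists 0; last exact: mxrank0.
  by move=> i; rewrite row0.
have ubP r : P r -> (r <= N)%N by move=> /asboolP[U _ <-]; exact: rank_leq_row.
have [r /asboolP[U SU rU] maxr] := ex_maxnP exP ubP.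
exists U => v; split; first exact: Ssub.
move=> Sv; have UUv : (U <= U + v)%MS by exact: addsmxSl.
have /maxr : P (\rank (U + v)%MS).
  apply/asboolP; exists (U + v)%MS => // i.
  have : (row i (U + v)%MS <= col_mx U v)%MS by rewrite (submx_trans (row_sub _ _)) // addsmxE.
  apply: Ssub => k; rewrite -(splitK k); case: (fintype.split k) => {}k /=.
    by rewrite rowKu.
  by rewrite rowKd [row _ v](_ : _ = v) //; apply/rowP => j; rewrite mxE ord1.
rewrite -rU => rk; rewrite (submx_trans (addsmxSr U v)) //.
by rewrite -(mxrank_leqif_sup UUv) eqn_leq rk mxrankS.
Qed.

(** * Right multiplication, rational coefficients and averaging operators *)

Section RightMultiplication.
Variables (F : fieldType) (m : nat).

Definition rmul_mx (A : 'M[F]_m) : 'M[F]_(m * m) := lin_mulmxr A.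

Lemma mx_row_eq p q (A B : 'M[F]_(p, q)) : (forall u : 'rV_p, u *m A = u *m B) -> A = B.
Proof. by move=> H; apply/row_matrixP => i; rewrite !rowE. Qed.

Lemma rmul_mxE A X : mxvec X *m rmul_mx A = mxvec (X *m A).
Proof. by rewrite /rmul_mx mul_vec_lin. Qed.

Lemma rmul_mxM A B : rmul_mx (A *m B) = rmul_mx A *m rmul_mx B.
Proof.
by apply: mx_row_eq => u; rewrite -(vec_mxK u) mulmxA !rmul_mxE mulmxA.
Qed.

Lemma rmul_mx1 : rmul_mx 1%:M = 1%:M.
Proof. by apply: mx_row_eq => u; rewrite -(vec_mxK u) rmul_mxE !mulmx1. Qed.

Lemma rmul_mx_unit A B : A *m B = 1%:M -> rmul_mx A \in unitmx.
Proof.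
by move=> AB; have : rmul_mx A *m rmul_mx B = 1%:M;
  [rewrite -rmul_mxM AB rmul_mx1|case/mulmx1_unit].
Qed.

Lemma rmul_mx_entry A i a b : rmul_mx A i (mxvec_index a b) =
  \sum_k (vec_mx (delta_mx 0 i) : 'M[F]_m) a k * A k b.
Proof.
transitivity (((delta_mx 0 i : 'rV[F]_(m * m)) *m rmul_mx A) 0 (mxvec_index a b)); first by rewrite -rowE [RHS]mxE.
by rewrite -[in LHS](vec_mxK (delta_mx 0 i : 'rV[F]_(m * m))) rmul_mxE mxvecE mxE.
Qed.

End RightMultiplication.

Section Averaging.
Variables (R : realType) (n : nat).
Local Notation C := (Cx R).
Implicit Types (G : set 'M[C]_n).

Lemma polyfun_sum J (r : seq J) (P : pred J) (F : J -> 'M[C]_n -> C) :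
  (forall j, polyfun (F j)) -> polyfun (fun g => \sum_(j <- r | P j) F j g).
Proof.
move=> H; elim: r => [|j r IH].
  by rewrite (_ : (fun g => _) = fun=> 0); [exact: polyfun_const|apply/funext => g; rewrite big_nil].
case Pj : (P j).
  rewrite (_ : (fun g => _) = fun g => F j g + \sum_(j <- r | P j) F j g); first exact: polyfun_add.
  by apply/funext => g; rewrite big_cons Pj.
by rewrite (_ : (fun g => _) = fun g => \sum_(j <- r | P j) F j g) //; apply/funext => g; rewrite big_cons Pj.
Qed.

Lemma polyfun_prod J (r : seq J) (P : pred J) (F : J -> 'M[C]_n -> C) :
  (forall j, polyfun (F j)) -> polyfun (fun g => \prod_(j <- r | P j) F j g).
Proof.
move=> H; elim: r => [|j r IH].
  by rewrite (_ : (fun g => _) = fun=> 1); [exact: polyfun_const|apply/funext => g; rewrite big_nil].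
case Pj : (P j).
  rewrite (_ : (fun g => _) = fun g => F j g * \prod_(j <- r | P j) F j g); first exact: polyfun_mul.
  by apply/funext => g; rewrite big_cons Pj.
by rewrite (_ : (fun g => _) = fun g => \prod_(j <- r | P j) F j g) //; apply/funext => g; rewrite big_cons Pj.
Qed.

Lemma polyfun_exp f k : polyfun f -> polyfun (fun g : 'M[C]_n => f g ^+ k).
Proof.
move=> Hf; rewrite (_ : (fun g => _) = fun g => \prod_(i < k) f g).
  exact: polyfun_prod.
by apply/funext => g; rewrite prodr_const card_ord.
Qed.

Lemma polyfun_det m (M : 'M[C]_n -> 'M[C]_m) : (forall i j, polyfun (fun g => M g i j)) ->
  polyfun (fun g => \det (M g)).
Proof.
move=> H; apply: polyfun_sum => s; apply: polyfun_mul; first exact: polyfun_const.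
exact: polyfun_prod.
Qed.

(** The formula of [rational_rep], but required on all of GL(n), so that closure under sums and
    products can be proved before a group is fixed. *)
Definition rational (f : 'M[C]_n -> C) := exists p k, polyfun p /\
  forall g, g \in unitmx -> f g = p g / (\det g) ^+ k.

Lemma rational_poly p : polyfun p -> rational p.
Proof. by move=> H; exists p, 0%N; split => // g _; rewrite expr0 divr1. Qed.

Lemma rationalD f1 f2 : rational f1 -> rational f2 -> rational (fun g => f1 g + f2 g).
Proof.
case=> p1 [k1 [H1 E1]] [p2 [k2 [H2 E2]]].
have pdet : polyfun (fun g : 'M[C]_n => \det g).
  by apply: polyfun_det => i j; exact: polyfun_entry.
exists (fun g => p1 g * \det g ^+ k2 + p2 g * \det g ^+ k1), (k1 + k2)%N; split.
  by apply: polyfun_add; apply: polyfun_mul => //; exact: polyfun_exp.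
move=> g ug; rewrite E1 // E2 //.
have d0 k : \det g ^+ k != 0 by rewrite expf_neq0 // -unitfE -unitmxE.
by rewrite exprD addf_div.
Qed.

Lemma rationalM f1 f2 : rational f1 -> rational f2 -> rational (fun g => f1 g * f2 g).
Proof.
case=> p1 [k1 [H1 E1]] [p2 [k2 [H2 E2]]].
exists (fun g => p1 g * p2 g), (k1 + k2)%N; split; first exact: polyfun_mul.
by move=> g ug; rewrite E1 // E2 // exprD invfM mulrACA.
Qed.

Lemma rational_ext f1 f2 : (forall g, f1 g = f2 g) -> rational f1 -> rational f2.
Proof. by move=> E; rewrite (_ : f1 = f2) //; apply/funext. Qed.

Lemma rational_sum J (r : seq J) (F : J -> 'M[C]_n -> C) :
  (forall j, rational (F j)) -> rational (fun g => \sum_(j <- r) F j g).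
Proof.
move=> H; elim: r => [|j r IH].
  by apply: rational_ext (rational_poly (polyfun_const _ 0)) => g; rewrite big_nil.
by apply: rational_ext (rationalD (H j) IH) => g; rewrite big_cons.
Qed.

Lemma rational_inv i j : rational (fun g => invmx g i j).
Proof.
exists (fun g => cofactor g j i), 1%N; split.
  apply: polyfun_mul; first exact: polyfun_const.
  apply: polyfun_det => k l; rewrite (_ : (fun g => _) = fun g : 'M[C]_n => g (lift j k) (lift i l)).
    exact: polyfun_entry.
  by apply/funext => g; rewrite !mxE.
by move=> g ug; rewrite /invmx ug !mxE expr1 mulrC.
Qed.

Lemma rational_trep d i j : rational (fun g => trep d g i j).
Proof.
elim: d i j => [|d IH] i j; first exact: rational_poly (polyfun_const _ _).
case: (mxtens_indexP i) => i0 i1; case: (mxtens_indexP j) => j0 j1.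
apply: (@rational_ext (fun g => affrep g i0 j0 * trep d g i1 j1)).
  by move=> g; rewrite [trep d.+1 _]/(affrep g *t trep d g) tensmxE.
apply: rationalM; last exact: IH.
have [[c E]|[a [b E]]|[a [b E]]] := affrep_cases R i0 j0.
- rewrite (_ : (fun g => _) = fun=> c); last exact/funext.
  exact: rational_poly (polyfun_const _ _).
- rewrite (_ : (fun g : 'M[C]_n => _) = fun g => g a b); last exact/funext.
  by apply: rational_poly; constructor.
- rewrite (_ : (fun g : 'M[C]_n => _) = fun g => invmx g a b); last exact/funext.
  exact: rational_inv.
Qed.

Section Group.
Variable G : set 'M[C]_n.
Hypothesis Gred : reductive G.

Let Gsub : GL_subgroup G.
Proof. by case: Gred => -[]. Qed.

(** Total weight 0 describes the span of differences of group elements, total weight 1 describes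
    averages. Keeping the list of group elements, and not just the matrix [avg_mx d s], allows an
    average to be applied to functions. *)
Definition affine_comb (s : seq (C * 'M[C]_n)) (c : C) :=
  (forall p, p \in s -> G p.2) /\ \sum_(p <- s) p.1 = c.

Definition avg_mx d (s : seq (C * 'M[C]_n)) := \sum_(p <- s) p.1 *: trep d p.2.

Lemma right_rep_rational d : rational_rep G (fun g => rmul_mx (trep d g)).
Proof.
case: Gsub => G1 Gu GM GV; split.
- move=> g Gg; apply: (@rmul_mx_unit _ _ _ (trep d (invmx g))).
  by rewrite -trepM ?unitmx_inv ?Gu // mulmxV ?Gu // trep1.
- by move=> g h Gg Gh; rewrite -rmul_mxM -trepM ?Gu.
- move=> i j; case/mxvec_indexP: j => a b.
  have : rational (fun g => rmul_mx (trep d g) i (mxvec_index a b)).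
    apply: (@rational_ext (fun g => \sum_k (vec_mx (delta_mx 0 i) : 'M[C]_(tdim n d)) a k * trep d g k b)).
      by move=> g; rewrite rmul_mx_entry.
    apply: rational_sum => k; apply: rationalM; last exact: rational_trep.
    exact: rational_poly (polyfun_const _ _).
  by case=> p [k [Hp E]]; exists p, k; split => // g Gg; apply: E; exact: Gu.
Qed.

Lemma affine_comb_cat s1 s2 c1 c2 : affine_comb s1 c1 -> affine_comb s2 c2 ->
  affine_comb (s1 ++ s2) (c1 + c2).
Proof.
case=> H1 <- [H2 <-]; split; last by rewrite big_cat.
by move=> p; rewrite mem_cat => /orP[]; [exact: H1|exact: H2].
Qed.

Lemma affine_comb_scale a s c : affine_comb s c ->
  affine_comb [seq (a * p.1, p.2) | p <- s] (a * c).
Proof.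
case=> H <-; split; last by rewrite big_map mulr_sumr.
by move=> p /mapP[q /H ? ->].
Qed.

Lemma affine_comb_mulr g s c : G g -> affine_comb s c ->
  affine_comb [seq (p.1, p.2 *m g) | p <- s] c.
Proof.
case: Gsub => G1 Gu GM GV Gg [H <-]; split; last by rewrite big_map.
by move=> p /mapP[q /H ? ->]; exact: GM.
Qed.

Lemma avg_mx_mulr d g s c : G g -> affine_comb s c ->
  avg_mx d [seq (p.1, p.2 *m g) | p <- s] = avg_mx d s *m trep d g.
Proof.
case: Gsub => G1 Gu GM GV Gg [H _].
rewrite /avg_mx big_map mulmx_suml; apply: eq_big_seq => p /H Gp /=.
by rewrite trepM ?Gu // scalemxAl.
Qed.

(* Complete reducibility of right multiplication by [trep d g]: split off the span
   of the differences [trep d g - trep d h] and decompose the identity matrix. *)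
Lemma averaging d : exists s, affine_comb s 1 /\
  forall g, G g -> avg_mx d s *m trep d g = avg_mx d s.
Proof.
case: (Gsub) => G1 Gu GM GV.
pose S (u : 'rV[C]_(tdim n d * tdim n d)) :=
  exists s, affine_comb s 0 /\ avg_mx d s = vec_mx u.
have [|a u v [s [Hs Es]] [t [Ht Et]]|U HU] := @span_matrix _ _ S.
- exists [::]; split; first by split => //; rewrite big_nil.
  by rewrite /avg_mx big_nil linear0.
- exists ([seq (a * p.1, p.2) | p <- s] ++ t); split.
    have := affine_comb_cat (affine_comb_scale a Hs) Ht.
    by rewrite mulr0 addr0.
  rewrite /avg_mx big_cat big_map linearD linearZ /= -Es -Et /avg_mx scaler_sumr; congr (_ + _).
  by apply: eq_bigr => p _; rewrite scalerA.
have Smul u g : G g -> S u -> S (u *m rmul_mx (trep d g)).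
  move=> Gg [s [Hs Es]]; exists [seq (p.1, p.2 *m g) | p <- s]; split.
    exact: affine_comb_mulr.
  rewrite (avg_mx_mulr _ _ Hs) // Es -{2}(vec_mxK u) rmul_mxE mxvecK //.
have Uinv g : G g -> (U *m rmul_mx (trep d g) <= U)%MS.
  move=> Gg; apply/row_subP => i; rewrite row_mul; apply/HU/Smul => //.
  by apply/HU; exact: row_sub.
have [W [Winv UW UW0]] := (proj2 Gred) _ _ (right_rep_rational d) _ Uinv.
have : (mxvec 1%:M <= U + W)%MS by rewrite (eqmxP UW) submx1.
case/sub_addsmxP => -[a1 b1] /=; set a := a1 *m U; set b := b1 *m W => Eab.
have Sa : S a by apply/HU; exact: submxMl.
have bW : (b <= W)%MS by exact: submxMl.
(* With T the matrix of g, b T - b lies in W by invariance. It also equals (T - 1) - (a T - a),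
   where both terms have total weight 0, so it lies in U; and U meets W in 0. *)
have fix_b g : G g -> b *m rmul_mx (trep d g) = b.
  move=> Gg; apply/eqP; rewrite -subr_eq0; apply/eqP.
  have bW' : (b *m rmul_mx (trep d g) - b <= W)%MS.
    rewrite addmx_sub // ?eqmx_opp // (submx_trans _ (Winv g Gg)) // submxMr //.
  have bU : (b *m rmul_mx (trep d g) - b <= U)%MS.
    have -> : b = mxvec 1%:M - a by rewrite Eab addrC addKr.
    rewrite mulmxBl opprB [a - _]addrC addrACA addmx_sub //; last first.
      by rewrite addmx_sub ?eqmx_opp //; apply/HU => //; apply: Smul.
    apply/HU; exists [:: (1, g); (-1, 1%:M)]; split.
      split; last by rewrite !big_cons big_nil /= addr0 subrr.
      by move=> p; rewrite !inE => /orP[] /eqP ->.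
    rewrite /avg_mx !big_cons big_nil /= addr0 scale1r scaleN1r trep1.
    by rewrite rmul_mxE mul1mx linearB /= !mxvecK.
  have : (b *m rmul_mx (trep d g) - b <= U :&: W)%MS by rewrite sub_capmx bU.
  by rewrite (eqmxP UW0) submx0 => /eqP.
have [s [Hs Es]] := Sa.
exists ((1, 1%:M) :: [seq (-1 * p.1, p.2) | p <- s]).
have comb : affine_comb ((1, 1%:M) :: [seq (-1 * p.1, p.2) | p <- s]) 1.
  have A1 : affine_comb [:: (1, 1%:M)] 1.
    by split; [move=> p; rewrite inE => /eqP -> | rewrite big_cons big_nil addr0].
  by have := affine_comb_cat A1 (affine_comb_scale (-1) Hs); rewrite mulr0 addr0.
have E : avg_mx d ((1, 1%:M) :: [seq (-1 * p.1, p.2) | p <- s]) = vec_mx b.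
  have -> : b = mxvec 1%:M - a by rewrite Eab addrC addKr.
  rewrite linearB /= mxvecK -Es /avg_mx big_cons big_map scale1r trep1 -sumrN.
  by congr (_ + _); apply: eq_bigr => p _; rewrite mulN1r scaleNr.
split => // g Gg; rewrite E -[in RHS](fix_b g Gg) -{2}(vec_mxK b) rmul_mxE mxvecK //.
Qed.

End Group.
End Averaging.

(** * Selfadjoint conjugates of reductive groups *)

Section UltraLimits.
Variables (R : realType) (T : Type) (U : set_system T).
Context {UU : UltraFilter U}.
Local Notation C := (Cx R).
Local Notation Re := (@CxRe R).
Local Notation Im := (@CxIm R).
Implicit Types (f g : T -> C).

(** Compactness of the segment gives a cluster point, and an ultrafilter converges to its cluster
    points. This takes the place of extracting subsequences, and one ultrafilter serves infinitely
    many families at once. *)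
Lemma ultra_bounded_cvg (x : T -> R) (B : R) :
  U [set t | `|x t| <= B] -> exists l : R, x @ U --> l.
Proof.
move=> UB; have : (x @ U) `[- B, B]%classic.
  suff : U (x @^-1` `[- B, B]%classic) by [].
  by apply: filterS UB => t /= xB; rewrite in_itv /= -ler_norml.
move=> /(@segment_compact R (- B) B (x @ U) _)[l [_ cl]]; exists l.
move=> A nA; have [//|UA] := in_ultra_setVsetC (x @^-1` A) UU.
by have [y [nAy /nAy]] := cl (~` A) A UA nA.
Qed.

Definition clim f (l : C) :=
  (fun t => Re (f t)) @ U --> Re l /\ (fun t => Im (f t)) @ U --> Im l.

Lemma clim_bounded f (B : R) : U [set t | nsq (f t) <= B] -> exists l, clim f l.
Proof.
have sq (x b : R) : x ^+ 2 <= b -> `|x| <= b + 1.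
  move=> xb; have : `|x| ^+ 2 <= b by rewrite real_normK ?num_real.
  move=> {}xb; nra.
move=> UB; have [|a Ha] := @ultra_bounded_cvg (fun t => Re (f t)) (B + 1).
  by apply: filterS UB => t /= tB; apply/sq/(le_trans _ tB)/Re_sq_le.
have [|b Hb] := @ultra_bounded_cvg (fun t => Im (f t)) (B + 1).
  by apply: filterS UB => t /= tB; apply/sq/(le_trans _ tB)/Im_sq_le.
by exists (mkCx a b).
Qed.

Lemma clim_cst (a : C) : clim (fun=> a) a.
Proof. by split; exact: cvg_cst. Qed.

Lemma climD f g a b : clim f a -> clim g b -> clim (fun t => f t + g t) (a + b).
Proof.
case=> f1 f2 [g1 g2]; split; rewrite CxE.
  by under eq_fun do rewrite CxE; exact: cvgD.
by under eq_fun do rewrite CxE; exact: cvgD.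
Qed.

Lemma climM f g a b : clim f a -> clim g b -> clim (fun t => f t * g t) (a * b).
Proof.
case=> f1 f2 [g1 g2]; split; rewrite CxE.
  by under eq_fun do rewrite CxE; apply: cvgB; exact: cvgM.
by under eq_fun do rewrite CxE; apply: cvgD; exact: cvgM.
Qed.

Lemma clim_sum I (r : seq I) (F : I -> T -> C) (l : I -> C) :
  (forall i, clim (F i) (l i)) -> clim (fun t => \sum_(i <- r) F i t) (\sum_(i <- r) l i).
Proof.
move=> H; elim: r => [|i r IH].
  by rewrite big_nil; under eq_fun do rewrite big_nil; exact: clim_cst.
by rewrite big_cons; under eq_fun do rewrite big_cons; exact: climD.
Qed.

Lemma clim_near f g a : U [set t | f t = g t] -> clim f a -> clim g a.
Proof.
move=> E [f1 f2]; split; [apply: cvg_trans f1|apply: cvg_trans f2]; apply: near_eq_cvg;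
  by apply: filterS E => t /= ->.
Qed.

Lemma clim_unique f a b : clim f a -> clim f b -> a = b.
Proof.
by case=> f1 f2 [g1 g2]; apply: CxP; [exact: cvg_unique f1 g1|exact: cvg_unique f2 g2].
Qed.

Lemma clim_nsq f a : clim f a -> (fun t => nsq (f t)) @ U --> nsq a.
Proof.
case=> f1 f2; rewrite /nsq !expr2; under eq_fun do rewrite !expr2.
by apply: cvgD; exact: cvgM.
Qed.

Lemma cvgr_sum I (r : seq I) (F : I -> T -> R) (l : I -> R) :
  (forall i, F i @ U --> l i) -> (fun t => \sum_(i <- r) F i t) @ U --> \sum_(i <- r) l i.
Proof.
move=> H; elim: r => [|i r IH].
  by rewrite big_nil; under eq_fun do rewrite big_nil; exact: cvg_cst.
by rewrite big_cons; under eq_fun do rewrite big_cons; exact: cvgD.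
Qed.

Lemma cvg_sqnorm m p (F : T -> 'M[C]_(m, p)) (L : 'M[C]_(m, p)) :
  (forall i j, clim (fun t => F t i j) (L i j)) ->
  (fun t => sqnorm (F t)) @ U --> sqnorm L.
Proof.
move=> H; rewrite /sqnorm; apply: cvgr_sum => i; apply: cvgr_sum => j.
exact: clim_nsq.
Qed.

Lemma ultra_le (x : T -> R) (l B : R) : x @ U --> l -> U [set t | x t <= B] -> l <= B.
Proof. by move=> xl UB; exact: cvgr_to_le xl UB. Qed.

End UltraLimits.

(** The sets of near-minimisers of N generate a proper filter, which is refined to an ultrafilter.
    No continuity of N is involved, so N may be a supremum. *)
Lemma inf_ultrafilter (R : realType) (T : Type) (P : set T) (N : T -> R) :
  P !=set0 -> (forall t, P t -> 0 <= N t) -> exists (U : set_system T) m, [/\ UltraFilter U,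
    (forall e, 0 < e -> U [set t | P t /\ N t < m + e]) & forall t, P t -> m <= N t].
Proof.
move=> [t0 Pt0] N0; set m := inf (N @` P).
have hi : has_inf (N @` P).
  split; first by exists (N t0), t0.
  by exists 0 => _ [t Pt <-]; exact: N0.
pose F : set_system T := fun A => exists2 e, 0 < e & [set t | P t /\ N t < m + e] `<=` A.
have FF : ProperFilter F.
  split.
    move=> [e e0 sub]; have [_ [t Pt <-] Nt] := inf_adherent e0 hi.
    by have := sub t; apply.
  split.
  - by exists 1.
  - move=> A B [e1 e10 s1] [e2 e20 s2]; exists (Num.min e1 e2).
      by rewrite lt_min e10.
    move=> t [Pt Nt]; split; [apply: s1|apply: s2]; split => //; apply: (lt_le_trans Nt);
      by rewrite lerD2l ge_min lexx ?orbT.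
  - by move=> A B AB [e e0 s]; exists e => //; exact: subset_trans s AB.
have [U [UU FU]] := ultraFilterLemma FF.
exists U, m; split => //.
  by move=> e e0; apply: FU; exists e.
by move=> t Pt; apply: ge_inf; [case: hi|exists t].
Qed.

(** * Separation of cosets by invariants *)

Section Separation.
Variables (R : realType) (n : nat).
Local Notation C := (Cx R).
Variable G : set 'M[C]_n.
Hypothesis Gred : reductive G.

Let Gsub : GL_subgroup G.
Proof. by case: Gred => -[]. Qed.

Variable sigma : nat -> seq (C * 'M[C]_n).
Hypothesis Hsigma : forall d, affine_comb G (sigma d) 1 /\
  forall g, G g -> avg_mx d (sigma d) *m trep d g = avg_mx d (sigma d).

Local Notation e d := (avg_mx d (sigma d)).

(** The Reynolds operator in degree d: by [averageE], if f has degree at most d, the result at an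
    invertible t depends only on [e d *m trep d t]. Constants are fixed, and a function vanishing on
    the coset G t has average 0 at t. *)
Definition average d (f : 'M[C]_n -> C) t := \sum_(p <- sigma d) p.1 * f (p.2 *m t).

Lemma averageE d f (c : 'M[C]_(tdim n d)) t : (forall h, f h = \tr (c *m trep d h)) ->
  t \in unitmx -> average d f t = \tr (c *m (e d *m trep d t)).
Proof.
case: Gsub => G1 Gu GM GV Hf ut; have [[Gs _] _] := Hsigma d.
rewrite /average /avg_mx mulmx_suml mulmx_sumr mxtrace_sum.
apply: eq_big_seq => p /Gs Gp; rewrite Hf trepM //; last exact: Gu.
by rewrite -scalemxAl -scalemxAr mxtraceZ.
Qed.

Lemma algebraic_regular (S : set ('M[C]_n -> C)) h t :
  (forall p, S p -> polyfun p) -> (forall g, G g <-> g \in unitmx /\ forall p, S p -> p g = 0) ->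
  h \in unitmx -> t \in unitmx ->
  (forall f, regular f -> (forall g, G g -> f (g *m h) = 0) -> f t = 0) ->
  G (t *m invmx h).
Proof.
move=> Sp SG uh ut Hf; apply/SG; rewrite unitmx_mul ut unitmx_inv uh; split=> // p Sp'.
apply: (Hf (fun t => p (t *m invmx h))); first by apply: regular_polyfun; exact: Sp.
by move=> g Gg; rewrite mulmxK //; have /SG[_] := Gg; apply.
Qed.

(** If the vanishing ideals of G h and G x had sum 1 = a + b, the average of a would be 0 at h and 1
    at x, although equal invariants give it equal values. So the sum is proper, and a common zero
    lies in both cosets. *)
Lemma separation h x : h \in unitmx -> x \in unitmx ->
  (forall d, e d *m trep d h = e d *m trep d x) -> G (x *m invmx h).
Proof.
move=> uh ux E; case: (Gsub) => G1 Gu GM GV.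
(* The sum of the two vanishing ideals. The decomposition is asked for on units only, so functions
   vanishing on the units belong to I. *)
pose I (f : 'M[C]_n -> C) := exists a b, [/\ regular a, regular b,
  (forall g, G g -> a (g *m h) = 0), (forall g, G g -> b (g *m x) = 0) &
  forall t, t \in unitmx -> f t = a t + b t].
have I_ideal : ideal I.
  split.
  - exists (fun=> 0), (fun=> 0); split => //; try exact: regular_const.
    by move=> t _; rewrite addr0.
  - move=> f1 f2 [a1 [b1 [ra1 rb1 Ha1 Hb1 E1]]] [a2 [b2 [ra2 rb2 Ha2 Hb2 E2]]].
    exists (fun t => a1 t + a2 t), (fun t => b1 t + b2 t); split.
    + exact: regularD.
    + exact: regularD.
    + by move=> g Gg; rewrite Ha1 // Ha2 // addr0.
    + by move=> g Gg; rewrite Hb1 // Hb2 // addr0.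
    + by move=> t ut; rewrite E1 // E2 // addrACA.
  - move=> f c [a [b [ra rb Ha Hb E1]]] rc.
    exists (fun t => a t * c t), (fun t => b t * c t); split.
    + exact: regularM.
    + exact: regularM.
    + by move=> g Gg; rewrite Ha // mul0r.
    + by move=> g Gg; rewrite Hb // mul0r.
    + by move=> t ut; rewrite E1 // mulrDl.
have [[a [b [[d [c Ha]] rb Ha0 Hb0 E1]]]|I1] := pselect (I (fun=> 1)).
  exfalso; have [[Gs Hs1] _] := Hsigma d.
  have Ah : average d a h = 0.
    by rewrite /average big_seq big1 // => p /Gs Gp; rewrite Ha0 // mulr0.
  have Ax : average d a x = 1.
    rewrite -Hs1 /average; apply: eq_big_seq => p /Gs Gp.
    by rewrite -[a _]addr0 -(Hb0 _ Gp) -E1 ?mulr1 // unitmx_mul ux Gu.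
  move: Ah Ax; rewrite !(averageE Ha) // E => -> /esym /eqP.
  by rewrite oner_eq0.
have Ivan f : regular f -> (forall t, t \in unitmx -> f t = 0) -> I f.
  move=> _ f0; exists (fun=> 0), (fun=> 0); split => //; try exact: regular_const.
  by move=> t ut; rewrite f0 // addr0.
have [t0 ut0 Ht0] := weak_nullstellensatz I_ideal I1 Ivan.
have [[_ [S [Sp SG]]] _] := Gred.
have Gh : G (t0 *m invmx h).
  apply: (algebraic_regular Sp SG) => // f rf Hf; apply: Ht0 => //.
  exists f, (fun=> 0); split => //; first exact: regular_const.
  by move=> t _; rewrite addr0.
have Gx : G (t0 *m invmx x).
  apply: (algebraic_regular Sp SG) => // f rf Hf; apply: Ht0 => //.
  exists (fun=> 0), f; split => //; first exact: regular_const.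
  by move=> t _; rewrite add0r.
have := GM _ _ (GV _ Gx) Gh.
by rewrite invmxM ?unitmx_inv // invmxK !mulmxA mulmxKV.
Qed.

End Separation.

(** * Polar decomposition *)

Section PolarDecomposition.
Variables (R : realType) (n : nat).
Local Notation C := (Cx R).
Implicit Types (V g u : 'M[C]_n) (a b : 'I_n -> C).

(** Functional calculus: for a unitary V, the matrices diagonal in one fixed orthonormal basis, with
    eigenvalues [a]. *)
Definition conj_diag V a : 'M[C]_n := adj V *m diag_mx (\row_i a i) *m V.

Lemma conj_diagM V a b : V *m adj V = 1%:M ->
  conj_diag V a *m conj_diag V b = conj_diag V (fun i => a i * b i).
Proof.
move=> VV; rewrite /conj_diag !mulmxA -[_ *m V *m adj V]mulmxA VV mulmx1.
rewrite -[_ *m diag_mx _ *m diag_mx _]mulmxA mulmx_diag; congr (_ *m diag_mx _ *m _).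
by apply/rowP => i; rewrite !mxE.
Qed.

Lemma conj_diag1 V : V *m adj V = 1%:M -> conj_diag V (fun=> 1) = 1%:M.
Proof.
move=> VV; rewrite /conj_diag (_ : \row_i 1 = const_mx 1); last by apply/rowP => i; rewrite !mxE.
by rewrite diag_const_mx mulmx1; exact: mulmx1C.
Qed.

Lemma adj_conj_diag V a : adj (conj_diag V a) = conj_diag V (fun i => (a i)^*).
Proof.
rewrite /conj_diag !adjM adjK mulmxA; congr (_ *m _ *m _).
by apply/matrixP => i j; rewrite adjE !mxE rmorphMn eq_sym; case: eqP => // ->.
Qed.

Lemma conj_diag_ext V a b : (forall i, a i = b i) -> conj_diag V a = conj_diag V b.
Proof. by move=> E; rewrite /conj_diag (_ : \row_i a i = \row_i b i) //; apply/rowP => i; rewrite !mxE E. Qed.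

Lemma conj_diag_unit V a : V *m adj V = 1%:M -> (forall i, a i != 0) ->
  conj_diag V a \in unitmx.
Proof.
move=> VV a0; apply: (proj1 (mulmx1_unit (B := conj_diag V (fun i => (a i)^-1)) _)).
rewrite (conj_diagM _ _ VV) -(conj_diag1 VV); apply: conj_diag_ext => i.
by rewrite mulfV.
Qed.

(** The positive factor is the square root of g g^dagger, obtained from the spectral theorem. It is
    returned through V and its eigenvalues, so that other functions of the same spectrum can be
    formed. *)
Lemma polar g : g \in unitmx -> exists V (l : 'I_n -> R) u,
  [/\ V *m adj V = 1%:M, (forall i, 0 < l i), u *m adj u = 1%:M &
      g = conj_diag V (fun i => cof (l i)) *m u].
Proof.
move=> ug; set A := g *m adj g.
have adjtr (B : 'M[C]_n) : map_mx Num.conj B^T = adj B by rewrite /adj map_trmx.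
have Aherm : adj A = A by rewrite /A adjM adjK.
have /orthomx_spectralP : A \is normalmx by apply/normalmxP; rewrite adjtr Aherm.
set V := spectralmx A; set s := spectral_diag A => EA.
have VV : V *m adj V = 1%:M.
  by have /unitarymxP := spectral_unitarymx A; rewrite adjtr.
have iV : invmx V = adj V := invmx_uniq VV.
have uV : V \in unitmx by exact: spectral_unit.
(* The eigenvalues of g g^dagger are the squared lengths of the rows of V g, positive because V g is
   invertible. *)
pose l i : R := \sum_j nsq ((V *m g) i j).
have El i : s 0 i = cof (l i).
  have ED : diag_mx s = (V *m g) *m adj (V *m g).
    rewrite adjM !mulmxA -[V *m g *m adj g]mulmxA -/A EA iV !mulmxA VV mul1mx.
    by rewrite -mulmxA VV mulmx1.
  have := congr1 (fun M : 'M[C]_n => M i i) ED; rewrite !mxE eqxx mulr1n => ->.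
  by rewrite cof_sum; apply: eq_bigr => j _; rewrite cof_nsq adjE.
have l0 i : 0 < l i.
  rewrite lt0r sumr_ge0 ?andbT; last by move=> *; exact: nsq_ge0.
  apply/negP; rewrite psumr_eq0; last by move=> *; exact: nsq_ge0.
  move=> /allP H; have Vgi : row i (V *m g) = 0.
    apply/rowP => j; rewrite [LHS]mxE [RHS]mxE; apply: nsq_eq0; apply/eqP.
    by apply: (H j); rewrite mem_index_enum.
  have : row i (V *m g) *m invmx (V *m g) = 0 by rewrite Vgi mul0mx.
  rewrite -row_mul mulmxV ?unitmx_mul ?uV // => /rowP /(_ i).
  by rewrite !mxE eqxx => /eqP; rewrite oner_eq0.
pose P (f : R -> R) := conj_diag V (fun i => cof (f (l i))).
have EP : A = P id.
  by rewrite {1}EA iV /P /conj_diag; congr (_ *m diag_mx _ *m _); apply/rowP => i; rewrite mxE El.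
have PM f1 f2 : P f1 *m P f2 = P (fun x => f1 x * f2 x).
  by rewrite /P (conj_diagM _ _ VV); apply: conj_diag_ext => i; rewrite cofM.
have P1 f : (forall x, 0 < x -> f x = 1) -> P f = 1%:M.
  by move=> E; rewrite -(conj_diag1 VV); apply: conj_diag_ext => i; rewrite E.
have sq_neq0 x : 0 < x -> Num.sqrt x != 0 :> R by move=> x0; rewrite gt_eqF ?sqrtr_gt0.
have PH f : adj (P f) = P f.
  by rewrite /P adj_conj_diag; apply: conj_diag_ext => i; rewrite cof_conj.
exists V, (fun i => Num.sqrt (l i)), (P (fun x => (Num.sqrt x)^-1) *m g); split => //.
- by move=> i; rewrite sqrtr_gt0.
- rewrite adjM PH; set X := P _; have -> : X *m g *m (adj g *m X) = X *m A *m X.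
    by rewrite /A; move: X => X; rewrite !mulmxA.
  rewrite /X EP !PM; apply: P1 => x x0.
  by rewrite -{2}(sqr_sqrtr (ltW x0)) expr2; field; exact: sq_neq0.
- rewrite mulmxA -/(P Num.sqrt) PM P1 ?mul1mx // => x x0.
  by rewrite mulfV // sq_neq0.
Qed.

End PolarDecomposition.

Lemma conj_mxM (F : fieldType) m (h A B : 'M[F]_m) : h \in unitmx ->
  h *m (A *m B) *m invmx h = (h *m A *m invmx h) *m (h *m B *m invmx h).
Proof. by move=> uh; rewrite !mulmxA (mulmxKV uh). Qed.

Lemma conj_mxV (F : fieldType) m (h A : 'M[F]_m) : h \in unitmx -> A \in unitmx ->
  h *m invmx A *m invmx h = invmx (h *m A *m invmx h).
Proof.
move=> uh uA; have uhA : h *m A \in unitmx by rewrite unitmx_mul uh.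
by rewrite (invmxM uhA) ?unitmx_inv // (invmxM uh uA) invmxK mulmxA.
Qed.

Lemma ler_term_sum (S : numDomainType) (F : nat -> S) d D : (forall k, 0 <= F k) ->
  (d < D)%N -> F d <= \sum_(k < D) F k.
Proof.
move=> F0 dD; rewrite (bigD1 (Ordinal dD)) //= lerDl.
by apply: sumr_ge0 => k _; exact: F0.
Qed.

(** * A minimiser of the weighted sum of squared invariants *)

Section Minimiser.
Variables (R : realType) (n : nat).
Local Notation C := (Cx R).
Variable G : set 'M[C]_n.
Hypothesis Gred : reductive G.

Let Gsub : GL_subgroup G.
Proof. by case: Gred => -[]. Qed.

Variable sigma : nat -> seq (C * 'M[C]_n).
Hypothesis Hsigma : forall d, affine_comb G (sigma d) 1 /\
  forall g, G g -> avg_mx d (sigma d) *m trep d g = avg_mx d (sigma d).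

Local Notation e d := (avg_mx d (sigma d)).

(** The power of 2 and the norm of [e d] cancel the constants of [sqnorm_mul_le], and d! turns the
    bound [size_fun h ^+ d] into a term of the exponential series. The added 1 avoids a division by
    zero. *)
Let weight d : R := (2 ^+ tdim n d * (1 + sqnorm (e d)) * d`!%:R)^-1.

Let weight_gt0 d : 0 < weight d.
Proof.
by rewrite invr_gt0 !mulr_gt0 ?exprn_gt0 ?ltr0n ?fact_gt0 // ltr_pwDl ?sqnorm_ge0.
Qed.

Let term d h : R := weight d * sqnorm (e d *m trep d h).
Let partial D h : R := \sum_(d < D) term d h.

Let term_ge0 d h : 0 <= term d h.
Proof. by rewrite mulr_ge0 ?sqnorm_ge0 // ltW. Qed.

Let term_le d h : term d h <= exp_coeff (size_fun h) d.
Proof.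
rewrite /term /weight /exp_coeff /=.
have c0 : 0 < 2 ^+ tdim n d * (1 + sqnorm (e d)).
  by rewrite mulr_gt0 ?exprn_gt0 // ltr_pwDl ?sqnorm_ge0.
rewrite invfM [_ * (_`!%:R)^-1]mulrC -mulrA mulrC ler_wpM2r ?invr_ge0 ?ler0n //.
rewrite ler_pdivrMl // (le_trans (sqnorm_mul_le _ _)) // sqnorm_trep mulrA.
by rewrite ler_wpM2r ?exprn_ge0 ?(le_trans ler01 (size_fun_ge1 h)) // ler_wpM2l ?exprn_ge0 // lerDr.
Qed.

Let partial_le D h : partial D h <= expR (size_fun h).
Proof.
apply: (@le_trans _ _ (series (exp_coeff (size_fun h)) D)).
  by rewrite /partial /series /= big_mkord ler_sum // => d _; exact: term_le.
apply: (nondecreasing_cvgn_le _ (is_cvg_series_exp_coeff _)).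
apply: nondecreasing_series => d _ _.
by rewrite /exp_coeff /= divr_ge0 // exprn_ge0 // (le_trans ler01 (size_fun_ge1 h)).
Qed.

Let total h : R := sup (range (fun D => partial D h)).

Let has_sup_partial h : has_sup (range (fun D => partial D h)).
Proof.
split; first by exists (partial 0 h), 0%N.
by exists (expR (size_fun h)) => _ [D _ <-]; exact: partial_le.
Qed.

Let partial_le_total D h : partial D h <= total h.
Proof. by apply: sup_upper_bound => //; exists D. Qed.

Let total_ge0 h : 0 <= total h.
Proof. by apply: le_trans (partial_le_total 0 h); rewrite /partial big_ord0. Qed.

Let term_le_total d h : term d h <= total h.
Proof.
apply: le_trans (partial_le_total d.+1 h).
by rewrite /partial big_ord_recr /= lerDr sumr_ge0.
Qed.

(** Along an ultrafilter of near-minimisers each invariant is bounded, by (m + 1) / [weight d], and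
    so converges. A point h0 at which all invariants take their limit values is a common zero of a
    proper ideal, and each partial sum at h0 is then a limit of values not exceeding m + eps. *)
Let minimum : exists2 h0, h0 \in unitmx & forall h, h \in unitmx -> total h0 <= total h.
Proof.
case: (Gsub) => G1 Gu GM GV.
have [||U [m [UU Um minf]]] := @inf_ultrafilter R _ [set h : 'M[C]_n | h \in unitmx] total.
- by exists 1%:M; exact: unitmx1.
- by move=> h _; exact: total_ge0.
have Uunit : U [set t | t \in unitmx] by apply: filterS (Um _ ltr01) => t [].
have entry_lim d i j : exists l, clim U (fun t => (e d *m trep d t) i j) l.
  apply: (@clim_bounded _ _ _ _ _ ((m + 1) / weight d)).
  apply: filterS (Um _ ltr01) => t [ut Nt] /=.
  rewrite ler_pdivlMr // mulrC (le_trans _ (ltW Nt)) //.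
  rewrite (le_trans _ (term_le_total d t)) //.
  by apply: ler_wpM2l; [exact: ltW (weight_gt0 d)|exact: nsq_le_sqnorm].
have tr_lim d (c : 'M[C]_(tdim n d)) : exists l, clim U (fun t => \tr (c *m (e d *m trep d t))) l.
  have /choice[L HL] : forall ij : 'I_(tdim n d) * 'I_(tdim n d),
      exists l, clim U (fun t => (e d *m trep d t) ij.1 ij.2) l by move=> ij; exact: entry_lim.
  exists (\sum_i \sum_j c i j * L (j, i)).
  rewrite (_ : (fun t => _) = fun t => \sum_i \sum_j c i j * (e d *m trep d t) j i).
    apply: clim_sum => i; apply: clim_sum => j; apply: climM; [exact: clim_cst|exact: (HL (j, i))].
  by apply/funext => t; apply: eq_bigr => i _; rewrite mxE.
(* Functions whose multiples all have averages tending to 0. Quantifying over a gives closure under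
   multiplication; D must be large because an average is controlled only for functions of degree at
   most D. The ideal is proper since the average of 1 is 1. *)
pose I (f : 'M[C]_n -> C) := regular f /\ forall a, regular a ->
  exists D0, forall D, (D0 <= D)%N -> clim U (average sigma D (fun h => f h * a h)) 0.
have I_vanish f : regular f -> (forall t, t \in unitmx -> f t = 0) -> I f.
  move=> rf f0; split=> // a ra; exists 0%N => D _.
  apply: (clim_near _ (clim_cst 0)); apply: filterS Uunit => t /= ut.
  rewrite /average big_seq big1 // => p ps; have [[Gs _] _] := Hsigma D.
  by rewrite f0 ?mul0r ?mulr0 // unitmx_mul ut (Gu _ (Gs _ ps)).
have I_ideal : ideal I.
  split.
  - by apply: I_vanish => //; exact: regular_const.
  - move=> f g [rf If] [rg Ig]; split; first exact: regularD.
    move=> a ra; have [D1 H1] := If a ra; have [D2 H2] := Ig a ra.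
    exists (maxn D1 D2) => D; rewrite geq_max => /andP[/H1 C1 /H2 C2].
    have -> : average sigma D (fun h => (f h + g h) * a h) = fun t =>
        average sigma D (fun h => f h * a h) t + average sigma D (fun h => g h * a h) t.
      apply/funext => t; rewrite /average -big_split; apply: eq_bigr => p _ /=.
      by rewrite mulrDl mulrDr.
    by have := @climD _ _ _ UU _ _ _ _ C1 C2; rewrite addr0.
  - move=> f b [rf If] rb; split; first exact: regularM.
    move=> a ra; have [D0 H0] := If _ (regularM rb ra); exists D0 => D /H0.
    rewrite (_ : (fun h => f h * b h * a h) = fun h => f h * (b h * a h)) //.
    by apply/funext => h; rewrite mulrA.
have I1 : ~ I (fun=> 1).
  case=> _ /(_ _ (regular_const _ 1))[D0 /(_ _ (leqnn _))].
  have -> : average sigma D0 (fun=> 1 * 1) = fun=> 1.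
    apply/funext => t; have [[_ E] _] := Hsigma D0; rewrite /average -[RHS]E.
    by apply: eq_bigr => p _; rewrite !mulr1.
  by move=> /(@clim_unique _ _ _ UU _ _ _ (@clim_cst _ _ U UU 1)) /eqP; rewrite oner_eq0.
(* An invariant factor can be taken out of the average: it tends to 0 after subtraction of l, while
   the average of a converges. *)
have I_inv d i j l : clim U (fun t => (e d *m trep d t) i j) l ->
    I (fun t => (e d *m trep d t) i j - l).
  move=> Hl; have rs : regular (fun t => (e d *m trep d t) i j - l).
    apply: regularD; last exact: regular_const.
    apply: (@regular_ext _ _ (fun t => \sum_k e d i k * trep d t k j)).
      by move=> t; rewrite mxE.
    apply: regular_sum => k; apply: regularM; first exact: regular_const.
    by exists d; exact: regd_entry.
  split => // a [D0 ra]; exists D0 => D D0D.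
  have [c Hc] := regd_le D0D ra.
  have [l' Hl'] := tr_lim D c.
  have := @climM _ _ _ UU _ _ _ _ (@climD _ _ _ UU _ _ _ _ Hl (@clim_cst _ _ U UU (- l))) Hl'.
  rewrite subrr mul0r => H;
  apply: (@clim_near _ _ U UU _ _ _ _ H); apply: filterS Uunit => t /= ut.
  rewrite -(averageE Gred Hsigma Hc ut) /average mulr_sumr.
  have [[Gs _] _] := Hsigma D; apply: eq_big_seq => p /Gs Gp.
  have [_ inv] := Hsigma d.
  have -> : e d *m trep d (p.2 *m t) = e d *m trep d t.
    by rewrite (trepM _ (Gu _ Gp) ut) mulmxA (inv _ Gp).
  by rewrite mulrCA.
have [h0 uh0 Hh0] := weak_nullstellensatz I_ideal I1 I_vanish.
exists h0; first exact: uh0.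
move=> h uh; apply: (@le_trans _ _ m); last exact: minf.
have partial_lim D : (fun t => partial D t) @ U --> partial D h0.
  apply: cvgr_sum => d; apply: cvgMr; apply: cvg_sqnorm => i j.
  have [l Hl] := entry_lim d i j; have [rs Is] := I_inv d i j l Hl.
  suff -> : (e d *m trep d h0) i j = l by [].
  by apply/eqP; rewrite -subr_eq0; apply/eqP; exact: (Hh0 _ rs (I_inv d i j l Hl)).
apply: ge_sup; first by exists (partial 0 h0), 0%N.
move=> _ [D _ <-]; apply/ler_addgt0Pr => eps eps0.
apply: (ultra_le (partial_lim D)); apply: filterS (Um _ eps0) => t [_ Nt] /=.
exact: le_trans (partial_le_total D t) (ltW Nt).
Qed.

Let term_convex d x q : x \in unitmx -> q \in unitmx -> adj q = q ->
  term d x + term d (x *m (q *m q)) - 2 * term d (x *m q) =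
  weight d * sqnorm (e d *m trep d x - e d *m trep d (x *m (q *m q))).
Proof.
move=> ux uq qH; have uqq : q *m q \in unitmx by rewrite unitmx_mul uq.
have Hq : adj (trep d q) = trep d q by rewrite trep_adj qH.
rewrite /term (trepM d ux uqq) (trepM d uq uq) (trepM d ux uq).
rewrite [e d *m (_ *m (_ *m _))]mulmxA [e d *m (_ *m trep d q)]mulmxA.
rewrite -(sqnorm_convex _ Hq).
by move: (sqnorm _) (sqnorm _) (sqnorm _) (weight d) => x1 x2 x3 w; ring.
Qed.

(** Each degree contributes a nonnegative second difference along x, x q, x q^2. The hypotheses make
    the total at most 0, so every contribution vanishes. *)
Let convex_equality x q : x \in unitmx -> q \in unitmx -> adj q = q ->
  total (x *m (q *m q)) = total x -> total x <= total (x *m q) ->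
  forall d, e d *m trep d x = e d *m trep d (x *m (q *m q)).
Proof.
move=> ux uq qH Etot le_tot d.
apply/eqP; rewrite -subr_eq0; apply/eqP; apply: sqnorm_eq0.
rewrite -(pmulr_rle0 _ (weight_gt0 d)) -(term_convex d ux uq qH).
apply/ler_addgt0Pl => eps eps0; rewrite addr0.
have [_ [D0 _ <-] HD0] := sup_adherent (divr_gt0 eps0 (ltr0n R 2)) (has_sup_partial (x *m q)).
(* Past d, so that the term of degree d is counted, and past D0, so that the partial sum at x q is
   within eps / 2 of [total]; that error is then doubled. *)
pose D := (d.+1 + D0)%N.
have partial_mono : partial D0 (x *m q) <= partial D (x *m q).
  rewrite /partial /D addnC big_split_ord /= lerDl.
  by apply: sumr_ge0 => i _; exact: term_ge0.
have conv_le : term d x + term d (x *m (q *m q)) - 2 * term d (x *m q) <=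
    partial D x + partial D (x *m (q *m q)) - 2 * partial D (x *m q).
  have dD : (d < D)%N by rewrite /D addSn ltnS leq_addr.
  pose F k := term k x + term k (x *m (q *m q)) - 2 * term k (x *m q).
  have F0 k : 0 <= F k.
    by rewrite /F (term_convex _ ux uq qH); apply: mulr_ge0; [exact: ltW|exact: sqnorm_ge0].
  apply: (le_trans (ler_term_sum F0 dD)).
  by rewrite /F sumrB big_split -mulr_sumr.
apply: (le_trans conv_le).
have A1 := partial_le_total D x.
have A2 := partial_le_total D (x *m (q *m q)).
rewrite Etot in A2; rewrite -/(total (x *m q)) in HD0.
move: HD0 partial_mono A1 A2 le_tot; clear.
move: (partial D0 _) (partial D x) (partial D (x *m (q *m q))) (partial D (x *m q))
  (total x) (total (x *m q)) => x1 x2 x3 x4 x5 x6 H1 H2 H3 H4 H5; lra.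
Qed.

(* At a minimiser h of [total], write g' = p u (polar form) for g' in h^-1 G h.
   Invariance gives total (h p) = total h, so convexity along p forces all
   invariants of h p and h to agree. *)
Lemma conjugate_selfadjoint : exists2 h, h \in unitmx &
  forall g, g \in unitmx -> G (h *m g *m invmx h) -> G (h *m adj g *m invmx h).
Proof.
case: (Gsub) => G1 Gu GM GV.
have [h uh hmin] := minimum; exists h => // g ug Gg.
have [V [l [u [VV l0 uu Eg]]]] := polar ug.
set p := conj_diag V _ in Eg.
pose q := conj_diag V (fun i => cof (Num.sqrt (l i))).
have qq : q *m q = p.
  rewrite /q (conj_diagM _ _ VV); apply: conj_diag_ext => i.
  by rewrite -cofM -expr2 sqr_sqrtr // ltW.
have qH : adj q = q by rewrite adj_conj_diag; apply: conj_diag_ext => i; rewrite cof_conj.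
have [uu1 uu2] := mulmx1_unit uu.
have uq : q \in unitmx.
  apply: conj_diag_unit => // i; rewrite -cof0 (inj_eq (@cof_inj R)) gt_eqF //.
  by rewrite sqrtr_gt0.
have up : p \in unitmx by rewrite -qq unitmx_mul uq.
(* With k = h g h^-1 and g = p u, the point h p differs from h by k in G on the left and a unitary
   on the right; neither changes the norm of an invariant. *)
have [k Gk Ep] : exists2 k, G k & h *m p = k *m h *m adj u.
  exists (h *m g *m invmx h) => //; rewrite (mulmxKV uh) Eg.
  by rewrite -[RHS]mulmxA -[p *m u *m _]mulmxA uu mulmx1.
have uk : k \in unitmx by exact: Gu.
have uau : adj u \in unitmx by rewrite adj_unit.
have term_p d : term d (h *m p) = term d h.
  have ukh : k *m h \in unitmx by rewrite unitmx_mul uk uh.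
  have E : e d *m trep d (h *m p) = e d *m trep d h *m trep d (adj u).
    by rewrite Ep (trepM d ukh uau) (trepM d uk uh) !mulmxA (proj2 (Hsigma d) _ Gk).
  rewrite /term E sqnorm_mulr_unitary //.
  by rewrite trep_adj adjK -trepM // (mulmx1C uu) trep1.
have total_p : total (h *m p) = total h.
  have E : (fun D => partial D (h *m p)) = (fun D => partial D h).
    by apply/funext => D; apply: eq_bigr => d _; apply: term_p.
  exact: (congr1 (fun F => sup (range F)) E).
have inv_p d : e d *m trep d h = e d *m trep d (h *m p).
  have hq : total h <= total (h *m q) by apply: hmin; rewrite unitmx_mul uh uq.
  move: total_p; rewrite -qq => total_qq.
  exact: (convex_equality uh uq qH total_qq hq).
have uhp : h *m p \in unitmx by rewrite unitmx_mul uh.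
have Gp := separation Gred Hsigma uh uhp inv_p.
have pH : adj p = p by rewrite -qq adjM qH.
have gg : g *m adj g = p *m p.
  by rewrite Eg adjM pH -mulmxA (mulmxA u) uu mul1mx.
have -> : adj g = invmx g *m (p *m p) by rewrite -gg (mulKmx ug).
rewrite (conj_mxM _ _ uh) (conj_mxM _ _ uh) (conj_mxV uh ug).
exact: GM _ _ (GV _ Gg) (GM _ _ Gp Gp).
Qed.

End Minimiser.

(** * Limits of matrices and the topology of matrix spaces *)

Section ComplexTopology.
Variable R : realType.
Local Notation C := (Cx R).

Lemma clim_cvg (T : Type) (U : set_system T) {UU : UltraFilter U} (f : T -> C) (l : C) :
  clim U f l -> f @ U --> l.
Proof.
move=> Hf A /nbhs_ballP[eps /= /Cx_gt0[x x0 ->] sub].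
have H : (fun t => nsq (l - f t)) @ U --> (0 : R).
  rewrite -(nsq0 R) -(subrr l); apply: clim_nsq; apply: climD; first exact: clim_cst.
  rewrite -mulN1r; under eq_fun do rewrite -mulN1r.
  by apply: climM => //; exact: clim_cst.
have Ux : U [set t | nsq (l - f t) < x ^+ 2].
  by apply: (cvgr_lt _ H); rewrite exprn_gt0.
suff : U (f @^-1` A) by [].
apply: filterS Ux => t /= lt; apply: sub; rewrite -ball_normE /=.
by rewrite norm_lt_cof.
Qed.

Lemma continuous_CxRe : continuous (@CxRe R : C -> R).
Proof.
move=> z; apply/(@cvgrPdist_lt _ _ _ (nbhs z) (nbhs_filter z)) => eps eps0.
apply/nbhs_ballP; exists (cof eps); first by rewrite /= -cof0 lt_cof.
move=> w; rewrite -ball_normE /= norm_lt_cof // => H.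
have := le_lt_trans (Re_sq_le (z - w)) H.
by rewrite CxReD CxReN -real_normK ?num_real // ltr_pXn2r ?nnegrE ?normr_ge0 ?ltW.
Qed.

Lemma continuous_CxIm : continuous (@CxIm R : C -> R).
Proof.
move=> z; apply/(@cvgrPdist_lt _ _ _ (nbhs z) (nbhs_filter z)) => eps eps0.
apply/nbhs_ballP; exists (cof eps); first by rewrite /= -cof0 lt_cof.
move=> w; rewrite -ball_normE /= norm_lt_cof // => H.
have := le_lt_trans (Im_sq_le (z - w)) H.
by rewrite CxImD CxImN -real_normK ?num_real // ltr_pXn2r ?nnegrE ?normr_ge0 ?ltW.
Qed.

Lemma clim_matrix_cvg m p (U : set_system 'M[C]_(m, p)) {UU : UltraFilter U} (L : 'M[C]_(m, p)) :
  (forall i j, clim U (fun t : 'M[C]_(m, p) => t i j) (L i j)) -> U --> L.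
Proof.
move=> H A [P nP sub].
have UP : U [set t : 'M[C]_(m, p) | forall ij : 'I_m * 'I_p, P ij.1 ij.2 (t ij.1 ij.2)].
  apply: filter_forall => -[i j] /=; exact: (clim_cvg (H i j) (nP i j)).
suff : U A by [].
by apply: filterS UP => t Ht; apply: sub => i j; exact: (Ht (i, j)).
Qed.

End ComplexTopology.

Section MatrixLimits.
Variables (R : realType) (T : Type) (U : set_system T).
Context {UU : UltraFilter U}.
Local Notation C := (Cx R).

Definition mlim m p (F : T -> 'M[C]_(m, p)) (L : 'M[C]_(m, p)) :=
  forall i j, clim U (fun t => F t i j) (L i j).

Lemma mlim_bounded m p (F : T -> 'M[C]_(m, p)) (B : R) :
  U [set t | sqnorm (F t) <= B] -> exists L, mlim F L.
Proof.
move=> UB; have /choice[l Hl] : forall ij : 'I_m * 'I_p, exists l, clim U (fun t => F t ij.1 ij.2) l.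
  move=> [i j]; apply: (@clim_bounded _ _ _ _ _ B); apply: filterS UB => t /=.
  exact: le_trans (nsq_le_sqnorm _ _ _).
exists (\matrix_(i, j) l (i, j)) => i j; rewrite mxE; exact: (Hl (i, j)).
Qed.

Lemma mlim_cst m p (A : 'M[C]_(m, p)) : mlim (fun=> A) A.
Proof. by move=> i j; exact: clim_cst. Qed.

Lemma mlimM m p q (F : T -> 'M[C]_(m, p)) (H : T -> 'M[C]_(p, q)) A B :
  mlim F A -> mlim H B -> mlim (fun t => F t *m H t) (A *m B).
Proof.
move=> FA HB i j; rewrite mxE.
rewrite (_ : (fun t => _) = fun t => \sum_k F t i k * H t k j).
  by apply: clim_sum => k; apply: climM.
by apply/funext => t; rewrite mxE.
Qed.

Lemma mlim_adj m p (F : T -> 'M[C]_(m, p)) A : mlim F A -> mlim (fun t => adj (F t)) (adj A).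
Proof.
move=> FA i j; rewrite adjE; have [H1 H2] := FA j i; split.
  rewrite CxRe_conj (_ : (fun t => _) = fun t => CxRe (F t j i)) //.
  by apply/funext => t; rewrite adjE CxRe_conj.
rewrite CxIm_conj (_ : (fun t => _) = fun t => - CxIm (F t j i)); first exact: cvgN.
by apply/funext => t; rewrite adjE CxIm_conj.
Qed.

Lemma mlim_unique m p (F H : T -> 'M[C]_(m, p)) A B : U [set t | F t = H t] ->
  mlim F A -> mlim H B -> A = B.
Proof.
move=> E FA HB; apply/matrixP => i j; apply: (clim_unique _ (HB i j)).
by apply: (clim_near _ (FA i j)); apply: filterS E => t /= ->.
Qed.

Lemma mlim_polyfun n (F : T -> 'M[C]_n) A (p : 'M[C]_n -> C) : polyfun p ->
  mlim F A -> clim U (fun t => p (F t)) (p A).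
Proof.
move=> Pp FA; elim: Pp => [c|i j|p1 p2 _ H1 _ H2|p1 p2 _ H1 _ H2].
- exact: clim_cst.
- exact: FA.
- exact: climD.
- exact: climM.
Qed.

(** Polynomial equations pass to the limit, but invertibility does not; it has to be supplied for
    [A]. *)
Lemma mlim_algebraic n (G : set 'M[C]_n) (F : T -> 'M[C]_n) A : algebraic_subgroup G ->
  mlim F A -> A \in unitmx -> U [set t | G (F t)] -> G A.
Proof.
move=> [_ [S [Sp SG]]] FA uA UG; apply/SG; split=> // p Hp.
apply: (clim_unique (mlim_polyfun (Sp p Hp) FA)).
apply: (clim_near _ (clim_cst 0)); apply: filterS UG => t /SG[_ /(_ _ Hp) E] /=.
by rewrite E.
Qed.

End MatrixLimits.

(** * Functions of positive elements of an algebraic group *)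

Section PositivePowers.
Variables (R : realType) (n : nat).
Local Notation C := (Cx R).

Lemma interpolation (F : fieldType) (xs : seq F) (f : F -> F) :
  exists Q : {poly F}, forall x, x \in xs -> Q.[x] = f x.
Proof.
elim: xs => [|x xs [Q HQ]]; first by exists 0.
have [xxs|xxs] := boolP (x \in xs).
  by exists Q => y; rewrite inE => /orP[/eqP ->|]; exact: HQ.
pose W := \prod_(z <- xs) ('X - z%:P).
have Wx : W.[x] != 0 by rewrite -/(root W x) root_prod_XsubC.
exists (Q + ((f x - Q.[x]) / W.[x]) *: W) => y.
rewrite inE hornerD hornerZ => /orP[/eqP ->|yxs]; first by rewrite mulfVK // addrC subrK.
have /eqP -> : root W y by rewrite root_prod_XsubC.
by rewrite mulr0 addr0 HQ.
Qed.

Definition monomial_sum (s : seq (C * ('I_n -> nat))) (a : 'I_n -> C) : C :=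
  \sum_(p <- s) p.1 * \prod_i a i ^+ p.2 i.

(** Restricted to a family of simultaneously diagonalised matrices, an equation of the group becomes
    a finite sum of monomials in the eigenvalues; the explicit list makes interpolation at the
    monomial values possible. *)
Lemma polyfun_monomials (p : 'M[C]_n -> C) (X Y : 'M[C]_n) : polyfun p ->
  exists s, forall a, p (X *m diag_mx (\row_i a i) *m Y) = monomial_sum s a.
Proof.
elim=> [c|i j|p1 p2 _ [s1 H1] _ [s2 H2]|p1 p2 _ [s1 H1] _ [s2 H2]].
- exists [:: (c, fun=> 0%N)] => a; rewrite /monomial_sum big_seq1 /= big1 ?mulr1 //.
- exists [seq (X i k * Y k j, fun l => (l == k : nat)) | k <- enum 'I_n] => a.
  rewrite /monomial_sum big_map big_enum /= mxE; apply: eq_bigr => k _.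
  rewrite mul_mx_diag !mxE mulrAC; congr (_ * _); rewrite (bigD1 k) //= eqxx expr1.
  by rewrite big1 ?mulr1 // => l /negbTE ->.
- exists (s1 ++ s2) => a; rewrite H1 H2 /monomial_sum big_cat //.
- exists [seq (q1.1 * q2.1, fun i => (q1.2 i + q2.2 i)%N) | q1 <- s1, q2 <- s2] => a.
  rewrite H1 H2 /monomial_sum big_allpairs_dep /= mulr_suml; apply: eq_bigr => q1 _.
  rewrite mulr_sumr; apply: eq_bigr => q2 _ /=.
  rewrite mulrACA -big_split /=; congr (_ * _); apply: eq_bigr => i _.
  by rewrite exprD.
Qed.

(* A function of the spectrum of p agrees with a polynomial on the finitely many
   monomials involved, and each equation of G holds at all powers of p. *)
Lemma algebraic_function (G : set 'M[C]_n) (h V : 'M[C]_n) (l : 'I_n -> R) (theta : R -> C) :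
  algebraic_subgroup G -> h \in unitmx -> V *m adj V = 1%:M -> (forall i, 0 < l i) ->
  G (h *m conj_diag V (fun i => cof (l i)) *m invmx h) ->
  theta 1 = 1 -> (forall x y, 0 < x -> 0 < y -> theta (x * y) = theta x * theta y) ->
  G (h *m conj_diag V (fun i => theta (l i)) *m invmx h).
Proof.
move=> [[G1 Gu GM GV] [S [Sp SG]]] uh VV l0 Gp th1 thM.
have th0 x : 0 < x -> theta x != 0.
  move=> x0; have x'0 : 0 < x^-1 by rewrite invr_gt0.
  have E : theta x * theta x^-1 = 1 by rewrite -(thM _ _ x0 x'0) mulfV // gt_eqF.
  by apply/eqP => t0; move: E; rewrite t0 mul0r => /esym /eqP; rewrite oner_eq0.
have Gmul A B : G (h *m A *m invmx h) -> G (h *m B *m invmx h) -> G (h *m (A *m B) *m invmx h).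
  by move=> GA GB; have := GM _ _ GA GB; rewrite -(conj_mxM A B uh).
have Gpow k : G (h *m conj_diag V (fun i => cof (l i) ^+ k) *m invmx h).
  elim: k => [|k IH].
    have -> : conj_diag V (fun i => cof (l i) ^+ 0) = 1%:M.
      by rewrite -(conj_diag1 VV); apply: conj_diag_ext => i; rewrite expr0.
    by rewrite mulmx1 (mulmxV uh); exact: G1.
  have -> : conj_diag V (fun i => cof (l i) ^+ k.+1) =
      conj_diag V (fun i => cof (l i)) *m conj_diag V (fun i => cof (l i) ^+ k).
    by rewrite (conj_diagM _ _ VV); apply: conj_diag_ext => i; rewrite exprS.
  exact: (Gmul _ _ Gp IH).
have assoc a : h *m conj_diag V a *m invmx h =
    (h *m adj V) *m diag_mx (\row_i a i) *m (V *m invmx h).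
  by rewrite /conj_diag !mulmxA.
apply/SG; split.
  have := conj_diag_unit VV (fun i => th0 _ (l0 i)).
  by move: (conj_diag V _) => A uA; rewrite !unitmx_mul uh uA unitmx_inv uh.
move=> p Hp; have [s Hs] := polyfun_monomials (h *m adj V) (V *m invmx h) (Sp p Hp).
rewrite assoc Hs.
pose nu (q : C * ('I_n -> nat)) : R := \prod_i l i ^+ q.2 i.
have nu0 q : 0 < nu q by apply: prodr_gt0 => i _; rewrite exprn_gt0.
have powers k : \sum_(q <- s) q.1 * cof (nu q) ^+ k = 0.
  have /SG[_ /(_ _ Hp)] := Gpow k; rewrite assoc Hs => E; rewrite -[RHS]E.
  rewrite /monomial_sum; apply: eq_bigr => q _; congr (_ * _).
  rewrite /nu cof_prod -prodrXl; apply: eq_bigr => i _.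
  by rewrite cof_exp -!exprM mulnC.
have polys (Q : {poly C}) : \sum_(q <- s) q.1 * Q.[cof (nu q)] = 0.
  under eq_bigr => q _ do rewrite horner_coef mulr_sumr.
  rewrite exchange_big big1 // => k _.
  under eq_bigr => q _ do rewrite mulrCA.
  by rewrite -mulr_sumr powers mulr0.
have [Q HQ] := interpolation [seq cof (nu q) | q <- s] (fun z => theta (CxRe z)).
rewrite -[RHS](polys Q); apply: eq_big_seq => q qs; congr (_ * _).
have -> : Q.[cof (nu q)] = theta (nu q) by exact: (HQ _ (map_f _ qs)).
(* Multiplicativity turns theta of a monomial in the l i into the same monomial in the theta (l
   i). *)
rewrite /nu.
have thX x k : 0 < x -> theta (x ^+ k) = theta x ^+ k.
  by move=> x0; elim: k => [|k IH]; rewrite ?expr0 ?th1 // !exprS thM ?exprn_gt0 // IH.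
have [] : 0 < \prod_i l i ^+ q.2 i /\ \prod_i theta (l i) ^+ q.2 i = theta (\prod_i l i ^+ q.2 i).
  apply: (big_ind2 (fun (x : C) (y : R) => 0 < y /\ x = theta y)).
  - by [].
  - by move=> x1 y1 x2 y2 [p1 ->] [p2 ->]; rewrite mulr_gt0 // thM.
  - by move=> i _; rewrite exprn_gt0 ?thX.
by [].
Qed.

End PositivePowers.

Lemma unitary_mul (R : realType) m (a b : 'M[Cx R]_m) :
  adj a *m a = 1%:M -> adj b *m b = 1%:M -> adj (a *m b) *m (a *m b) = 1%:M.
Proof. by move=> Ha Hb; rewrite adjM -mulmxA (mulmxA (adj a)) Ha mul1mx Hb. Qed.

Lemma conj_mx_inj (F : fieldType) m (h A B : 'M[F]_m) : h \in unitmx ->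
  h *m A *m invmx h = h *m B *m invmx h -> A = B.
Proof.
by move=> uh E; rewrite -(mulKmx uh A) -(mulmxKV uh (h *m A)) E (mulmxKV uh) (mulKmx uh).
Qed.

Lemma conj_diag_comm (R : realType) n (V A : 'M[Cx R]_n) (a : 'I_n -> Cx R) :
  V *m adj V = 1%:M ->
  A *m diag_mx (\row_i a i) = diag_mx (\row_i a i) *m A <->
  (adj V *m A *m V) *m conj_diag V a = conj_diag V a *m (adj V *m A *m V).
Proof.
move=> VV; rewrite /conj_diag; move: (diag_mx _) => D.
have E1 A' D' : adj V *m A' *m V *m (adj V *m D' *m V) = adj V *m (A' *m D') *m V.
  by rewrite !mulmxA -(mulmxA _ V (adj V)) VV mulmx1.
rewrite !E1; split=> [->//|E].
have simp B : V *m (adj V *m B *m V) *m adj V = B.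
  by rewrite !mulmxA VV mul1mx -mulmxA VV mulmx1.
by rewrite -(simp (A *m D)) E simp.
Qed.

(** * The maximal compact subgroup and its commutant *)

Section MaximalCompact.
Variables (R : realType) (n : nat).
Local Notation C := (Cx R).
Variables G K : set 'M[C]_n.
Hypothesis Gred : reductive G.
Hypothesis Kmax : maximal_compact_subgroup G K.
Hypothesis Kuni : unitary_set K.

Let Galg : algebraic_subgroup G. Proof. by case: Gred. Qed.
Let Gsub : GL_subgroup G. Proof. by case: Galg. Qed.

Lemma selfadjoint_conjugate : exists2 h, h \in unitmx &
  forall g, g \in unitmx -> G (h *m g *m invmx h) -> G (h *m adj g *m invmx h).
Proof.
have /choice[sigma Hsigma] := averaging Gred.
exact: (conjugate_selfadjoint Gred Hsigma).
Qed.

Let cost (y : 'M[C]_n) : R := sqnorm y + sqnorm (invmx y).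

(** Bounding y and y^-1 together keeps a minimising family away from singular matrices: the two
    limits are inverse to each other, and the coset is closed in GL(n). *)
Lemma cost_minimum h : h \in unitmx -> exists y, [/\ y \in unitmx, G (y *m invmx h) &
  forall z, z \in unitmx -> G (z *m invmx h) -> cost y <= cost z].
Proof.
move=> uh; case: (Gsub) => G1 Gu GM GV.
have [||U [m [UU Um minf]]] :=
    @inf_ultrafilter R _ [set y : 'M[C]_n | y \in unitmx /\ G (y *m invmx h)] cost.
- by exists h; split => //; rewrite mulmxV.
- by move=> y _; apply: addr_ge0; exact: sqnorm_ge0.
have [|Y HY] := @mlim_bounded R _ U UU n n (fun y => y) (m + 1).
  apply: filterS (Um _ ltr01) => y [_ Hy]; apply: le_trans (ltW Hy).
  by rewrite lerDl sqnorm_ge0.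
have [|Z HZ] := @mlim_bounded R _ U UU n n (fun y => invmx y) (m + 1).
  apply: filterS (Um _ ltr01) => y [_ Hy]; apply: le_trans (ltW Hy).
  by rewrite lerDr sqnorm_ge0.
have YZ : Y *m Z = 1%:M.
  apply: (mlim_unique _ (mlimM HY HZ) (mlim_cst _)).
  by apply: filterS (Um _ ltr01) => y [[uy _] _] /=; rewrite mulmxV.
have [uY _] := mulmx1_unit YZ.
have iY := invmx_uniq YZ.
exists Y; split; first exact: uY.
  apply: (mlim_algebraic Galg (mlimM HY (mlim_cst (invmx h)))).
    by rewrite unitmx_mul uY unitmx_inv uh.
  by apply: filterS (Um _ ltr01) => y [[_ Gy] _].
move=> z uz Gz; apply: (@le_trans _ _ m); last by apply: minf.
apply/ler_addgt0Pr => eps eps0.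
have lim : (fun y => sqnorm y + sqnorm (invmx y)) @ U --> sqnorm Y + sqnorm Z.
  by apply: cvgD; exact: cvg_sqnorm.
rewrite /cost iY; apply: (ultra_le lim).
by apply: filterS (Um _ eps0) => y [_ Hy]; exact: ltW Hy.
Qed.

(** The positive factor p is not known in advance to lie in the conjugated group, but g g^dagger =
    p^2 does, and a function of p is a function of p^2 after composition with the square root. The
    identity function gives p itself, hence u = p^-1 g. *)
Lemma polar_conjugate y g : y \in unitmx ->
  (forall x, x \in unitmx -> G (y *m x *m invmx y) -> G (y *m adj x *m invmx y)) ->
  g \in unitmx -> G (y *m g *m invmx y) ->
  exists V (l : 'I_n -> R) u, [/\ V *m adj V = 1%:M, (forall i, 0 < l i),
    u *m adj u = 1%:M, g = conj_diag V (fun i => cof (l i)) *m u &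
    (forall theta : R -> C, theta 1 = 1 ->
       (forall s t, 0 < s -> 0 < t -> theta (s * t) = theta s * theta t) ->
       G (y *m conj_diag V (fun i => theta (l i)) *m invmx y)) /\
    G (y *m u *m invmx y)].
Proof.
move=> uy Gadj ug Gg; case: (Gsub) => G1 Gu GM GV.
have [V [l [u [VV l0 uu Eg]]]] := polar ug.
have l2 i : 0 < l i ^+ 2 by rewrite exprn_gt0.
have gg : g *m adj g = conj_diag V (fun i => cof (l i ^+ 2)).
  have pH : adj (conj_diag V (fun i => cof (l i))) = conj_diag V (fun i => cof (l i)).
    by rewrite adj_conj_diag; apply: conj_diag_ext => i; rewrite cof_conj.
  have -> : conj_diag V (fun i => cof (l i ^+ 2)) =
      conj_diag V (fun i => cof (l i)) *m conj_diag V (fun i => cof (l i)).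
    by rewrite (conj_diagM _ _ VV); apply: conj_diag_ext => i; rewrite expr2 cofM.
  rewrite Eg adjM pH; move: (conj_diag V _) => p.
  by rewrite -mulmxA (mulmxA u) uu mul1mx.
have Ggg : G (y *m conj_diag V (fun i => cof (l i ^+ 2)) *m invmx y).
  by rewrite -gg (conj_mxM _ _ uy); exact: (GM _ _ Gg (Gadj _ ug Gg)).
have fun_l (theta : R -> C) : theta 1 = 1 ->
    (forall s t, 0 < s -> 0 < t -> theta (s * t) = theta s * theta t) ->
    G (y *m conj_diag V (fun i => theta (l i)) *m invmx y).
  move=> t1 tM.
  have -> : conj_diag V (fun i => theta (l i)) =
      conj_diag V (fun i => (fun x => theta (Num.sqrt x)) (l i ^+ 2)).
    by apply: conj_diag_ext => i; rewrite /= sqrtr_sqr gtr0_norm.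
  apply: (algebraic_function (theta := fun x => theta (Num.sqrt x)) Galg uy VV l2 Ggg).
    by rewrite sqrtr1.
  by move=> s t s0 t0; rewrite sqrtrM ?ltW // tM ?sqrtr_gt0.
exists V, l, u; split; [exact: VV|exact: l0|exact: uu|exact: Eg|split; first exact: fun_l].
have Gp : G (y *m conj_diag V (fun i => cof (l i)) *m invmx y).
  by apply: fun_l => // s t _ _; rewrite cofM.
have up : conj_diag V (fun i => cof (l i)) \in unitmx.
  by apply: (conj_diag_unit VV) => i; rewrite -cof0 (inj_eq (@cof_inj R)) gt_eqF.
have -> : u = invmx (conj_diag V (fun i => cof (l i))) *m g by rewrite Eg (mulKmx up).
rewrite (conj_mxM _ _ uy) (conj_mxV uy up).
exact: (GM _ _ (GV _ Gp) Gg).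
Qed.

(** The conjugate h^-1 G h does not change along the coset G h, so minimising over the coset
    preserves its selfadjointness. *)
Lemma conjugate_shift h y : h \in unitmx -> y \in unitmx -> G (y *m invmx h) ->
  forall x, G (y *m x *m invmx y) <-> G (h *m x *m invmx h).
Proof.
move=> uh uy Gg x; case: (Gsub) => G1 Gu GM GV.
set g := y *m invmx h in Gg.
have ug : g \in unitmx := Gu _ Gg.
have Ey : y = g *m h by rewrite /g (mulmxKV uh).
have E : y *m x *m invmx y = g *m (h *m x *m invmx h) *m invmx g.
  by rewrite Ey (invmxM ug uh) !mulmxA.
split; last by move=> Gx; rewrite E; exact: (GM _ _ (GM _ _ Gg Gx) (GV _ Gg)).
have -> : h *m x *m invmx h = invmx g *m (y *m x *m invmx y) *m g.
  by rewrite E (mulmxA (invmx g)) (mulKmx ug) ?(mulmxKV ug) // mulmxA (mulKmx ug).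
by move=> Gx; exact: (GM _ _ (GM _ _ (GV _ Gg) Gx) Gg).
Qed.

(* The minimality of |y|^2 + |y^-1|^2 along q = sqrt p, where y^-1 k y = p u. *)
Lemma conjugate_unitary h y k : h \in unitmx -> y \in unitmx -> G (y *m invmx h) ->
  (forall x, x \in unitmx -> G (h *m x *m invmx h) -> G (h *m adj x *m invmx h)) ->
  (forall z, z \in unitmx -> G (z *m invmx h) -> cost y <= cost z) ->
  K k -> adj (invmx y *m k *m y) *m (invmx y *m k *m y) = 1%:M.
Proof.
move=> uh uy Gy Gadj ymin Kk; case: (Gsub) => G1 Gu GM GV.
have shift := conjugate_shift uh uy Gy.
have Gk : G k by case: Kmax => _ KG _ _; exact: KG.
have uk := Gu _ Gk.
have adjkk : adj k *m k = 1%:M by exact: Kuni.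
set g := invmx y *m k *m y.
have ug : g \in unitmx by rewrite /g !unitmx_mul unitmx_inv uy uk.
have Eyg : y *m g = k *m y by rewrite /g !mulmxA (mulmxV uy) mul1mx.
have Gg : G (y *m g *m invmx y) by rewrite Eyg (mulmxK uy).
have Gadjy x : x \in unitmx -> G (y *m x *m invmx y) -> G (y *m adj x *m invmx y).
  by move=> ux /shift Gx; apply/shift; exact: Gadj.
have [V [l [u [VV l0 uu Eg [fun_l _]]]]] := polar_conjugate uy Gadjy ug Gg.
set p := conj_diag V _ in Eg.
set q := conj_diag V (fun i => cof (Num.sqrt (l i))).
have qq : q *m q = p.
  rewrite /q (conj_diagM _ _ VV); apply: conj_diag_ext => i.
  by rewrite -cofM -expr2 sqr_sqrtr // ltW.
have qH : adj q = q by rewrite adj_conj_diag; apply: conj_diag_ext => i; rewrite cof_conj.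
have uq : q \in unitmx.
  by apply: (conj_diag_unit VV) => i; rewrite -cof0 (inj_eq (@cof_inj R)) gt_eqF // sqrtr_gt0.
have Gq : G (y *m q *m invmx y).
  apply: (fun_l (fun x => cof (Num.sqrt x))); first by rewrite sqrtr1.
  by move=> s t s0 t0; rewrite sqrtrM ?cofM // ltW.
have Gyq : G (y *m q *m invmx h).
  have -> : y *m q *m invmx h = (y *m q *m invmx y) *m (y *m invmx h).
    by rewrite (mulmxA _ y) (mulmxKV uy).
  exact: (GM _ _ Gq Gy).
have uyq : y *m q \in unitmx by rewrite unitmx_mul uy uq.
have le_q := ymin _ uyq Gyq.
clearbody q; move: p Eg qq {fun_l Gq} => p Eg qq.
have adju : adj u *m u = 1%:M := mulmx1C uu.
have Eyp : y *m p = k *m y *m adj u.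
  by rewrite -Eyg Eg -!mulmxA uu mulmx1.
have up : p \in unitmx by rewrite -qq unitmx_mul uq.
have Eiyp : invmx (y *m p) = u *m (invmx y *m adj k).
  apply: invmx_uniq; rewrite Eyp -!mulmxA (mulmxA (adj u)) adju mul1mx.
  by rewrite (mulKVmx uy); exact: mulmx1C.
(* Here y p = k y u^dagger with k and u unitary, so neither norm changes. *)
have cost_p : cost (y *m p) = cost y.
  rewrite /cost Eiyp Eyp; congr (_ + _).
    rewrite sqnorm_mulr_unitary ?adjK //; exact: sqnorm_mull_unitary.
  rewrite sqnorm_mull_unitary // sqnorm_mulr_unitary ?adjK //.
have Qh : adj (invmx q) = invmx q by rewrite adjV qH.
(* The second differences of y along q and of the adjoint of y^-1 along q^-1 are nonnegative. Their
   sum is 2 cost(y) - 2 cost(y q), at most 0 by minimality; hence y = y p and p = 1. *)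
have c1 := sqnorm_convex y qH; rewrite qq in c1.
have c2 := sqnorm_convex (adj (invmx y)) Qh.
have e1 : sqnorm (adj (invmx y) *m invmx q) = sqnorm (invmx (y *m q)).
  by rewrite -sqnorm_adj adjM adjK Qh (invmxM uy uq).
have e2 : sqnorm (adj (invmx y) *m (invmx q *m invmx q)) = sqnorm (invmx (y *m p)).
  by rewrite -sqnorm_adj !adjM adjK Qh (invmxM uy up) -qq (invmxM uq uq).
rewrite e1 e2 sqnorm_adj in c2.
have n1 := sqnorm_ge0 (adj (invmx y) - adj (invmx y) *m (invmx q *m invmx q)).
have yp : y = y *m p.
  apply/eqP; rewrite -subr_eq0; apply/eqP/sqnorm_eq0.
  move: cost_p le_q n1 c1 c2; rewrite /cost; clear.
  move: (sqnorm (y - y *m p)) (sqnorm (adj _ - _)) (sqnorm y) (sqnorm (invmx y))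
    (sqnorm (y *m p)) (sqnorm (invmx (y *m p))) (sqnorm (y *m q)) (sqnorm (invmx (y *m q))).
  move=> x1 x2 x3 x4 x5 x6 x7 x8 H1 H2 H3 H4 H5; lra.
have p1 : p = 1%:M by rewrite -(mulKmx uy p) -yp (mulVmx uy).
by rewrite Eg p1 mul1mx.
Qed.

(** For w unitary, y w y^-1 is bounded in terms of y and y^-1. Unitarity passes to limits and makes
    the limit invertible, as [mlim_algebraic] requires. *)
Lemma unitary_part_compact y : y \in unitmx ->
  compact [set g : 'M[C]_n | G g /\ adj (invmx y *m g *m y) *m (invmx y *m g *m y) = 1%:M].
Proof.
move=> uy; case: (Gsub) => G1 Gu GM GV; rewrite compact_ultra => U UU UM.
have bound g : adj (invmx y *m g *m y) *m (invmx y *m g *m y) = 1%:M ->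
    sqnorm g <= 2 ^+ n * (sqnorm (y *m (invmx y *m g *m y)) * sqnorm (invmx y)).
  move=> _; apply: le_trans (sqnorm_mul_le _ _).
  by rewrite !mulmxA (mulmxV uy) mul1mx (mulmxK uy).
pose B : R := 2 ^+ n * (sqnorm y * sqnorm (invmx y)).
have [|L HL] := @mlim_bounded R _ U UU n n (fun g => g) B.
  apply: filterS UM => g [_ Hg] /=; apply: le_trans (bound _ Hg) _.
  by rewrite sqnorm_mulr_unitary //; exact: mulmx1C.
exists L; split; last exact: clim_matrix_cvg.
have HyL : @mlim R _ U n n (fun g => invmx y *m g *m y) (invmx y *m L *m y).
  exact: mlimM (mlimM (mlim_cst (invmx y)) HL) (mlim_cst y).
have EL : adj (invmx y *m L *m y) *m (invmx y *m L *m y) = 1%:M.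
  apply: (mlim_unique _ (mlimM (mlim_adj HyL) HyL) (mlim_cst _)).
  by apply: filterS UM => g [].
split=> //; apply: (mlim_algebraic Galg HL); last by apply: filterS UM => g [].
have [_ uL] := mulmx1_unit EL.
by move: uL; rewrite !unitmx_mul unitmx_inv uy andbT.
Qed.

Lemma unitary_part_subgroup y : y \in unitmx ->
  GL_subgroup [set g : 'M[C]_n | G g /\ adj (invmx y *m g *m y) *m (invmx y *m g *m y) = 1%:M].
Proof.
move=> uy; case: (Gsub) => G1 Gu GM GV; split.
- by split; [exact: G1|rewrite mulmx1 (mulVmx uy) adj1mx mulmx1].
- by move=> g [/Gu].
- move=> a b [Ga Ha] [Gb Hb]; split; first exact: (GM _ _ Ga Gb).
  have -> : invmx y *m (a *m b) *m y = (invmx y *m a *m y) *m (invmx y *m b *m y).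
    by rewrite !mulmxA (mulmxK uy).
  exact: unitary_mul Ha Hb.
- move=> a [Ga Ha]; split; first exact: (GV _ Ga).
  have ua := Gu _ Ga.
  have -> : invmx y *m invmx a *m y = adj (invmx y *m a *m y).
    rewrite -(invmx_uniq (mulmx1C Ha)).
    rewrite (invmxM _ uy) ?unitmx_mul ?unitmx_inv ?uy // (invmxM _ ua) ?unitmx_inv //.
    by rewrite invmxK mulmxA.
  by rewrite adjK; exact: mulmx1C.
Qed.

(* Conjugating by a minimiser turns K into the full unitary part of a selfadjoint
   algebraic group; the latter contains the unitary matrices p^(is) for every
   positive p in the group, and these generate the same algebra as p. *)
Theorem commutant_maximal_compact X :
  (forall k, K k -> X *m k = k *m X) -> forall g, G g -> X *m g = g *m X.
Proof.
move=> XK; case: (Gsub) => G1 Gu GM GV.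
have [h uh Gadj] := selfadjoint_conjugate.
have [y [uy Gy ymin]] := cost_minimum uh.
have shift := conjugate_shift uh uy Gy.
have Gadjy x : x \in unitmx -> G (y *m x *m invmx y) -> G (y *m adj x *m invmx y).
  by move=> ux /shift Gx; apply/shift; exact: Gadj.
pose M := [set g : 'M[C]_n | G g /\ adj (invmx y *m g *m y) *m (invmx y *m g *m y) = 1%:M].
have MK : M = K.
  case: Kmax => Ksub KG _; apply.
  - exact: unitary_part_subgroup.
  - by move=> k Kk; split; [exact: KG|exact: (conjugate_unitary uh uy Gy Gadj ymin)].
  - by move=> k [].
  - exact: unitary_part_compact.
have [X' EX] : exists X', X = y *m X' *m invmx y.
  by exists (invmx y *m X *m y); rewrite !mulmxA (mulmxV uy) mul1mx (mulmxK uy).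
have XW w : adj w *m w = 1%:M -> G (y *m w *m invmx y) -> X' *m w = w *m X'.
  move=> ww Gw; have Mw : M (y *m w *m invmx y).
    split; first exact: Gw.
    have -> : invmx y *m (y *m w *m invmx y) *m y = w; last exact: ww.
    by rewrite !mulmxA (mulVmx uy) mul1mx (mulmxKV uy).
  rewrite MK in Mw; have := XK _ Mw.
  rewrite EX -(conj_mxM X' w uy) -(conj_mxM w X' uy); exact: (conj_mx_inj uy).
move=> g Gg; have [x [ux Ex]] : exists x, x \in unitmx /\ g = y *m x *m invmx y.
  exists (invmx y *m g *m y); rewrite !unitmx_mul unitmx_inv uy (Gu _ Gg).
  by rewrite !mulmxA (mulmxV uy) mul1mx (mulmxK uy).
have Gx : G (y *m x *m invmx y) by rewrite -Ex.
have [V [l [u [VV l0 uu Eg [fun_l Gu']]]]] := polar_conjugate uy Gadjy ux Gx.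
have Xu : X' *m u = u *m X' := XW _ (mulmx1C uu) Gu'.
set p := conj_diag V _ in Eg.
suff Xp : X' *m p = p *m X'.
  have X'x : X' *m x = x *m X'.
    by rewrite Eg; clear Eg; clearbody p; rewrite mulmxA Xp -mulmxA Xu mulmxA.
  by rewrite EX Ex -(conj_mxM X' x uy) X'x (conj_mxM x X' uy).
have VV' := mulmx1C VV.
have [X2 EX'] : exists X2, X' = adj V *m X2 *m V.
  by exists (V *m X' *m adj V); rewrite !mulmxA VV' mul1mx -mulmxA VV' mulmx1.
have comm_diag a : X2 *m diag_mx (\row_i a i) = diag_mx (\row_i a i) *m X2 <->
    X' *m conj_diag V a = conj_diag V a *m X'.
  by rewrite EX'; exact: conj_diag_comm.
apply/comm_diag/matrixP => i j; rewrite mul_mx_diag mul_diag_mx !mxE.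
(* In the eigenbasis, commuting with p means having no entry between distinct eigenvalues. *)
have [->|lij] := eqVneq (l i) (l j); first by rewrite mulrC.
suff -> : X2 i j = 0 by rewrite mul0r mulr0.
(* theta(t) = t^(is), with s chosen so that theta(l i) = exp(i pi) theta(l j) = - theta(l j).
   Commutation with the unitary element p^(is) then reads 2 theta(l j) X2_ij = 0. *)
pose s := pi / (ln (l i) - ln (l j)).
pose theta (t : R) : C := mkCx (cos (s * ln t)) (sin (s * ln t)).
have thetaD a b : mkCx (cos (a + b)) (sin (a + b)) = mkCx (cos a) (sin a) * mkCx (cos b) (sin b) :> C.
  by apply: CxP; rewrite !CxE !(CxRe_mk, CxIm_mk) ?cosD ?sinD // addrC mulrC [X in _ + X]mulrC.
have th1 : theta 1 = 1.
  by rewrite /theta ln1 mulr0 cos0 sin0; exact: CxP.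
have thM a b : 0 < a -> 0 < b -> theta (a * b) = theta a * theta b.
  by move=> a0 b0; rewrite /theta lnM ?posrE // mulrDr thetaD.
have thU a : (theta a)^* * theta a = 1.
  rewrite mulrC -cof_nsq /nsq CxRe_mk CxIm_mk.
  by rewrite cos2Dsin2.
have Xth : X' *m conj_diag V (fun k => theta (l k)) = conj_diag V (fun k => theta (l k)) *m X'.
  apply: XW; last exact: fun_l.
  rewrite adj_conj_diag (conj_diagM _ _ VV) -(conj_diag1 VV).
  by apply: conj_diag_ext => k; exact: thU.
have := (comm_diag (fun k => theta (l k))).2 Xth.
move=> /matrixP /(_ i j); rewrite mul_mx_diag mul_diag_mx !mxE => E.
have Eth : theta (l i) = - theta (l j).
  have -> : theta (l i) = mkCx (cos (pi + s * ln (l j))) (sin (pi + s * ln (l j))).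
    rewrite /theta; have -> : s * ln (l i) = pi + s * ln (l j); last by [].
    rewrite /s; field; rewrite subr_eq0; apply: contra_neq lij.
    by apply: ln_inj; rewrite posrE.
  rewrite thetaD cospi sinpi; apply: CxP; rewrite !CxE !(CxRe_mk, CxIm_mk);
   by rewrite !mul0r ?subr0 ?addr0 mulN1r.
have th0 : theta (l j) != 0.
  by apply/eqP => t0; have := thU (l j); rewrite t0 mulr0 => /esym /eqP; rewrite oner_eq0.
move: E; rewrite Eth mulNr [X2 i j * _]mulrC => /eqP; rewrite -subr_eq0 opprK -mulr2n.
by rewrite -mulr_natr !mulf_eq0 pnatr_eq0 (negbTE th0) /= orbF => /eqP.
Qed.

End MaximalCompact.

(** * Integration of matrices and Haar averaging *)

Section BoundedMeasurable.
Variables (R : realType) (d : measure_display) (T : measurableType d).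
Local Notation C := (Cx R).
Implicit Types f g : T -> C.

(** [cint] is additive on integrable functions; under a probability measure boundedness secures
    integrability, and it is stable under the products that occur in matrix entries. *)
Definition bounded_measurable f :=
  [/\ measurable_fun setT (fun t => CxRe (f t)), measurable_fun setT (fun t => CxIm (f t)) &
      exists B : R, forall t, nsq (f t) <= B].

Lemma bounded_measurable_cst (a : C) : bounded_measurable (fun=> a).
Proof. by split; [exact: measurable_cst|exact: measurable_cst|exists (nsq a)]. Qed.

Lemma bounded_measurableD f g : bounded_measurable f -> bounded_measurable g ->
  bounded_measurable (fun t => f t + g t).
Proof.
case=> f1 f2 [B1 H1] [g1 g2 [B2 H2]]; split.
- by under eq_fun do rewrite CxReD; exact: measurable_funD.
- by under eq_fun do rewrite CxImD; exact: measurable_funD.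
- exists (2 * B1 + 2 * B2) => t; apply: le_trans (nsqD_le _ _) _.
  by rewrite lerD // ler_wpM2l.
Qed.

Lemma bounded_measurableM f g : bounded_measurable f -> bounded_measurable g ->
  bounded_measurable (fun t => f t * g t).
Proof.
case=> f1 f2 [B1 H1] [g1 g2 [B2 H2]]; split.
- by under eq_fun do rewrite CxReM; apply: measurable_funB; exact: measurable_funM.
- by under eq_fun do rewrite CxImM; apply: measurable_funD; exact: measurable_funM.
- by exists (B1 * B2) => t; rewrite nsqM ler_pM ?nsq_ge0.
Qed.

Lemma bounded_measurable_conj f : bounded_measurable f -> bounded_measurable (fun t => (f t)^*).
Proof.
case=> f1 f2 [B H]; split.
- by under eq_fun do rewrite CxRe_conj.
- by under eq_fun do rewrite CxIm_conj; exact: (measurable_funN f2).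
- by exists B => t; rewrite nsq_conj.
Qed.

Lemma bounded_measurable_sum I (r : seq I) (F : I -> T -> C) :
  (forall i, bounded_measurable (F i)) -> bounded_measurable (fun t => \sum_(i <- r) F i t).
Proof.
move=> H; elim: r => [|i r IH].
  by under eq_fun do rewrite big_nil; exact: bounded_measurable_cst.
by under eq_fun do rewrite big_cons; exact: bounded_measurableD.
Qed.

Variable P : probability T R.

Lemma bounded_measurable_integrable f : bounded_measurable f ->
  P.-integrable setT (EFin \o (fun t => CxRe (f t))) /\
  P.-integrable setT (EFin \o (fun t => CxIm (f t))).
Proof.
case=> f1 f2 [B H].
have bnd (x : T -> R) : (forall t, x t ^+ 2 <= B) -> [bounded x t | t in setT].
  move=> Hx; exists (B + 1); split; first exact: num_real.
  move=> M BM t _ /=; apply: le_trans (ltW BM).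
  have : `|x t| ^+ 2 <= B by rewrite real_normK ?num_real.
  by move=> ?; nra.
have fin : (P setT < +oo)%E by rewrite probability_setT ltry.
split; apply: measurable_bounded_integrable => //; apply: bnd => t.
  exact: le_trans (Re_sq_le _) (H t).
exact: le_trans (Im_sq_le _) (H t).
Qed.

Lemma cintD f g : bounded_measurable f -> bounded_measurable g ->
  cint P (fun t => f t + g t) = cint P f + cint P g.
Proof.
move=> /bounded_measurable_integrable[f1 f2] /bounded_measurable_integrable[g1 g2].
apply: CxP; rewrite ?CxReD ?CxImD; rewrite /cint /CxRe /CxIm /=.
  rewrite -RintegralD //; apply: eq_Rintegral => t _; exact: CxReD.
rewrite -RintegralD //; apply: eq_Rintegral => t _; exact: CxImD.
Qed.

Lemma cintZ (a : C) f : bounded_measurable f -> cint P (fun t => a * f t) = a * cint P f.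
Proof.
move=> /bounded_measurable_integrable[f1 f2].
have scale (x : R) (h : T -> R) : P.-integrable setT (EFin \o h) ->
    P.-integrable setT (EFin \o (fun t => x * h t)).
  move=> hi; rewrite (_ : EFin \o _ = fun t => (x%:E * (h t)%:E)%E) //.
  exact: integrableZl.
apply: CxP; rewrite ?CxReM ?CxImM; rewrite /cint /CxRe /CxIm /=.
  rewrite -!RintegralZl // -RintegralB //; try exact: scale.
  by apply: eq_Rintegral => t _; exact: CxReM.
rewrite -!RintegralZl // -RintegralD //; try exact: scale.
by apply: eq_Rintegral => t _; exact: CxImM.
Qed.

Lemma cint_cst (a : C) : cint P (fun=> a) = a.
Proof.
have E (x : R) : Rintegral P setT (fun=> x) = x.
  by rewrite Rintegral_cst // -[RHS]mulr1; congr (x * _); exact: (congr1 fine (probability_setT P)).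
by apply: CxP; exact: E.
Qed.

Lemma cint_sum I (r : seq I) (F : I -> T -> C) : (forall i, bounded_measurable (F i)) ->
  cint P (fun t => \sum_(i <- r) F i t) = \sum_(i <- r) cint P (F i).
Proof.
move=> H; elim: r => [|i r IH].
  by under eq_fun do rewrite big_nil; rewrite big_nil cint_cst.
under eq_fun do rewrite big_cons; rewrite big_cons -IH cintD //.
exact: bounded_measurable_sum.
Qed.

Variable n : nat.
Implicit Types F : T -> 'M[C]_n.

Definition bounded_measurable_mx F := forall i j, bounded_measurable (fun t => F t i j).

Lemma bounded_measurable_mulmx F H : bounded_measurable_mx F -> bounded_measurable_mx H ->
  bounded_measurable_mx (fun t => F t *m H t).
Proof.
move=> HF HH i j; under eq_fun do rewrite mxE.
by apply: bounded_measurable_sum => k; exact: bounded_measurableM.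
Qed.

Lemma bounded_measurable_adj F : bounded_measurable_mx F ->
  bounded_measurable_mx (fun t => adj (F t)).
Proof.
by move=> HF i j; under eq_fun do rewrite adjE; exact: bounded_measurable_conj.
Qed.

Lemma bounded_measurable_cst_mx (A : 'M[C]_n) : bounded_measurable_mx (fun=> A).
Proof. by move=> i j; exact: bounded_measurable_cst. Qed.

Lemma mxint_mul (A B : 'M[C]_n) F : bounded_measurable_mx F ->
  mxint P (fun t => A *m F t *m B) = A *m mxint P F *m B.
Proof.
move=> HF; apply/matrixP => i j; rewrite [LHS]mxE [RHS]mxE.
have bAF k : bounded_measurable (fun t => \sum_l A i l * F t l k).
  by apply: bounded_measurable_sum => l; apply: bounded_measurableM => //; exact: bounded_measurable_cst.
transitivity (cint P (fun t => \sum_k B k j * \sum_l A i l * F t l k)).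
  congr (cint P _); apply/funext => t; rewrite mxE; apply: eq_bigr => k _.
  by rewrite mxE mulrC.
rewrite cint_sum; last by move=> k; apply: bounded_measurableM => //; exact: bounded_measurable_cst.
apply: eq_bigr => k _; rewrite cintZ // mulrC; congr (_ * _).
rewrite mxE cint_sum; last by move=> l; apply: bounded_measurableM => //; exact: bounded_measurable_cst.
by apply: eq_bigr => l _; rewrite cintZ // mxE.
Qed.

Lemma mxint_mull (A : 'M[C]_n) F : bounded_measurable_mx F ->
  mxint P (fun t => A *m F t) = A *m mxint P F.
Proof.
move=> HF; rewrite -[RHS]mulmx1 -(mxint_mul _ _ HF); congr (mxint P _).
by apply/funext => t; rewrite mulmx1.
Qed.

Lemma mxint_mulr (B : 'M[C]_n) F : bounded_measurable_mx F ->
  mxint P (fun t => F t *m B) = mxint P F *m B.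
Proof.
move=> HF; rewrite -[mxint P F]mul1mx -(mxint_mul _ _ HF); congr (mxint P _).
by apply/funext => t; rewrite mul1mx.
Qed.

Lemma mxint_tr F : bounded_measurable_mx F -> \tr (mxint P F) = cint P (fun t => \tr (F t)).
Proof.
move=> HF; rewrite /mxtrace cint_sum; last by move=> i; exact: HF.
by apply: eq_bigr => i _; rewrite mxE.
Qed.

Lemma mxint_cst (A : 'M[C]_n) : mxint P (fun=> A) = A.
Proof. by apply/matrixP => i j; rewrite mxE cint_cst. Qed.

End BoundedMeasurable.

(** * The operator norm and its measurability *)

Section OperatorNorm.
Variables (R : realType) (n : nat).
Local Notation C := (Cx R).
Implicit Types (A : 'M[C]_n) (v : 'cV[C]_n).

Lemma vnormE v : vnorm v = Num.sqrt (sqnorm v).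
Proof.
rewrite /vnorm; congr Num.sqrt; apply: eq_bigr => i _.
by rewrite big_ord1.
Qed.

Lemma vnorm1 v : vnorm v = 1 -> sqnorm v = 1.
Proof. by rewrite vnormE => v1; rewrite -(sqr_sqrtr (sqnorm_ge0 v)) v1 expr1n. Qed.

Lemma sqnormZ (a : C) v : sqnorm (a *: v) = nsq a * sqnorm v.
Proof.
rewrite /sqnorm mulr_sumr; apply: eq_bigr => i _; rewrite mulr_sumr.
by apply: eq_bigr => j _; rewrite mxE nsqM.
Qed.

Local Notation img A := [set r : R | exists v : 'cV[C]_n, vnorm v = 1 /\ r = vnorm (A *m v)].

Lemma opnorm_has_ub A : has_ubound (img A).
Proof.
exists (Num.sqrt (2 ^+ n * sqnorm A)) => _ [v [/vnorm1 v1 ->]].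
by rewrite vnormE ler_wsqrtr // (le_trans (sqnorm_mul_le _ _)) // v1 mulr1.
Qed.

Lemma opnorm_ub A v : vnorm v = 1 -> vnorm (A *m v) <= opnorm A.
Proof. by move=> v1; apply: ub_le_sup; [exact: opnorm_has_ub|exists v]. Qed.

Lemma opnorm_ge0 A : 0 <= opnorm A.
Proof.
(* For n = 0 there is no unit vector, and the supremum of the empty set is 0 by convention. *)
have [E|/set0P[_ [v [v1 _]]]] := eqVneq (img A) set0; first by rewrite /opnorm E sup0.
by apply: le_trans (opnorm_ub A v1); rewrite vnormE sqrtr_ge0.
Qed.

Lemma nsq_entry_le A i j : nsq (A i j) <= opnorm A ^+ 2.
Proof.
pose v : 'cV[C]_n := delta_mx j 0.
have sv : sqnorm v = 1.
  rewrite /sqnorm (bigD1 j) //= big_ord1 mxE !eqxx nsq1 big1 ?addr0 // => k kj.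
  by rewrite big_ord1 mxE (negbTE kj) nsq0.
have v1 : vnorm v = 1 by rewrite vnormE sv sqrtr1.
have Av : nsq (A i j) <= sqnorm (A *m v).
  by apply: le_trans (nsq_le_sqnorm _ i 0); rewrite -colE mxE.
apply: (le_trans Av); rewrite -(sqr_sqrtr (sqnorm_ge0 _)) -vnormE.
by rewrite ler_pXn2r ?nnegrE ?opnorm_ge0 ?opnorm_ub // vnormE sqrtr_ge0.
Qed.

Lemma nsq_normalise_le A i j : nsq (normalise A i j) <= 1.
Proof.
rewrite mxE nsqM -/(cof _) nsq_cof exprVn.
(* When the norm is 0, its inverse is 0 by convention and the normalised matrix vanishes. *)
have [->|o0] := eqVneq (opnorm A) 0; first by rewrite expr0n invr0 mul0r.
have o20 : 0 < opnorm A ^+ 2 by rewrite exprn_gt0 // lt0r o0 opnorm_ge0.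
by rewrite mulrC ler_pdivrMr // mul1r nsq_entry_le.
Qed.

Lemma opnorm_unitary A : (0 < n)%N -> adj A *m A = 1%:M -> opnorm A = 1.
Proof.
move=> n0 AA; have vA v : vnorm (A *m v) = vnorm v by rewrite !vnormE sqnorm_mull_unitary.
pose v : 'cV[C]_n := delta_mx (Ordinal n0) 0.
have v1 : vnorm v = 1.
  rewrite vnormE /sqnorm (bigD1 (Ordinal n0)) //= big_ord1 mxE !eqxx nsq1.
  by rewrite big1 ?addr0 ?sqrtr1 // => k kj; rewrite big_ord1 mxE (negbTE kj) nsq0.
apply/le_anti/andP; split.
  by apply: ge_sup; [exists (vnorm (A *m v)), v|move=> _ [w [w1 ->]]; rewrite vA w1].
by rewrite -[leLHS]v1 -(vA v) opnorm_ub.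
Qed.

Definition rational_vector (w : 'cV[(rat * rat)%type]_n) : 'cV[C]_n :=
  map_mx (fun q : rat * rat => mkCx (ratr q.1) (ratr q.2)) w.

Lemma rational_vector_approx v : exists w : nat -> 'cV[(rat * rat)%type]_n, forall k i j,
  `|CxRe (v i j) - CxRe (rational_vector (w k) i j)| <= k.+1%:R^-1 /\
  `|CxIm (v i j) - CxIm (rational_vector (w k) i j)| <= k.+1%:R^-1.
Proof.
have approx (x : R) k : exists q : rat, `|x - ratr q| <= k.+1%:R^-1.
  have k0 : 0 < (k.+1%:R^-1 : R) by rewrite invr_gt0.
  have xk : x < x + k.+1%:R^-1 by rewrite ltrDl.
  have [q] := rat_in_itvoo xk.
  rewrite in_itv /= => /andP[q1 q2]; exists q.
  by rewrite distrC ger0_norm ?subr_ge0 ?(ltW q1) // lerBlDl ltW.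
have /choice[q Hq] : forall p : R * nat, exists q : rat, `|p.1 - ratr q| <= p.2.+1%:R^-1.
  by move=> [x k]; exact: approx.
exists (fun k => \matrix_(i, j) (q (CxRe (v i j), k), q (CxIm (v i j), k))) => k i j.
rewrite !mxE CxRe_mk CxIm_mk /=; split; [exact: (Hq (_, k))|exact: (Hq (_, k))].
Qed.

(** Rational vectors are dense and countable, so a superlevel set of the norm becomes a countable
    union of sets defined by entries. The homogeneous inequality avoids normalising the vectors,
    which would leave the rationals. *)
Lemma opnorm_gt A (r : R) : 0 <= r ->
  r < opnorm A <-> exists w, r ^+ 2 * sqnorm (rational_vector w) < sqnorm (A *m rational_vector w).
Proof.
move=> r0; split=> [|[w]]; last first.
  set v := rational_vector w => lt.
  have v0 : 0 < sqnorm v.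
    rewrite lt0r sqnorm_ge0 andbT; apply/eqP => v0.
    have z : v = 0 by apply: sqnorm_eq0; rewrite v0.
    by move: lt; rewrite z mulmx0 sqnorm0 mulr0 ltxx.
  pose a := (Num.sqrt (sqnorm v))^-1.
  have a2 : a ^+ 2 = (sqnorm v)^-1 by rewrite exprVn sqr_sqrtr // ltW.
  have u1 : vnorm (cof a *: v) = 1.
    by rewrite vnormE sqnormZ nsq_cof a2 mulVf ?sqrtr1 // gt_eqF.
  apply: lt_le_trans (opnorm_ub A u1).
  rewrite -scalemxAr vnormE sqnormZ nsq_cof a2 -{1}(ger0_norm r0) -sqrtr_sqr.
  have Av0 : 0 < sqnorm (A *m v) by apply: le_lt_trans lt; rewrite mulr_ge0 ?sqr_ge0 // ltW.
  rewrite ltr_sqrt; last by rewrite mulr_gt0 // invr_gt0.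
  by rewrite mulrC ltr_pdivlMr.
move=> ro; have [E|ne] := eqVneq (img A) set0.
  by move: ro; rewrite /opnorm E sup0 ltNge r0.
have [x [v [v1 ->]] rx] : exists2 x, img A x & r < x.
  have hs : has_sup (img A) by split; [exact/set0P|exact: opnorm_has_ub].
  have pr : 0 < opnorm A - r by rewrite subr_gt0.
  have [x ix] := sup_adherent pr hs.
  by rewrite subKr => lt; exists x.
have {rx} rx : 0 < sqnorm (A *m v) - r ^+ 2 * sqnorm v.
  rewrite (vnorm1 v1) mulr1 subr_gt0 -(sqr_sqrtr (sqnorm_ge0 _)) -vnormE.
  by rewrite ltr_pXn2r ?nnegrE // vnormE sqrtr_ge0.
have [w Hw] := rational_vector_approx v.
(* An ultrafilter refining convergence at infinity, so that the limit lemmas above apply to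
   sequences. *)
have [U [UU sub]] := ultraFilterLemma eventually_filter.
have lim : mlim U (fun k => rational_vector (w k)) v.
  have sq (y : nat -> R) l : (forall k, `|l - y k| <= k.+1%:R^-1) -> y @ U --> l.
    move=> Hy; apply/cvgrPdist_le => eps eps0; apply: sub.
    apply: filterS (near_infty_natSinv_lt (PosNum eps0)) => k lt.
    exact: le_trans (Hy k) (ltW lt).
  by move=> i j; split; apply: sq => k; case: (Hw k i j).
have l1 := cvg_sqnorm (mlimM (mlim_cst A) lim).
have l2 := cvg_sqnorm lim.
have l3 : (fun k => sqnorm (A *m rational_vector (w k)) - r ^+ 2 * sqnorm (rational_vector (w k)))
    @ U --> sqnorm (A *m v) - r ^+ 2 * sqnorm v.
  apply: cvgB; first exact: l1. apply: cvgM. exact: cvg_cst. exact: l2.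
have [k Hk] := filter_ex (@cvgr_gt _ _ U _ _ _ l3 _ rx).
by exists (w k); rewrite -subr_gt0.
Qed.

End OperatorNorm.

Section NormaliseMeasurable.
Variables (R : realType) (n : nat) (d : measure_display) (T : measurableType d).
Local Notation C := (Cx R).
Variable F : T -> 'M[C]_n.
Hypothesis Fm : mx_measurable F.

Lemma measurable_sqnorm_mul (v : 'cV[C]_n) : measurable_fun setT (fun t => sqnorm (F t *m v)).
Proof.
have sumR I (r : seq I) (h : I -> T -> R) : (forall i, measurable_fun setT (h i)) ->
    measurable_fun setT (fun t => \sum_(i <- r) h i t).
  move=> H; elim: r => [|i r IH].
    by under eq_fun do rewrite big_nil; exact: measurable_cst.
  by under eq_fun do rewrite big_cons; exact: measurable_funD.
apply: (sumR) => i; apply: (sumR) => j; rewrite /nsq.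
under eq_fun do rewrite mxE CxRe_sum CxIm_sum.
apply: measurable_funD; apply: measurable_funX; apply: (sumR) => k.
- under eq_fun do rewrite CxReM; have [f1 f2] := Fm i k.
  by apply: measurable_funB; apply: measurable_funM => //; exact: measurable_cst.
- under eq_fun do rewrite CxImM; have [f1 f2] := Fm i k.
  by apply: measurable_funD; apply: measurable_funM => //; exact: measurable_cst.
Qed.

Lemma measurable_opnorm : measurable_fun setT (fun t => opnorm (F t)).
Proof.
apply: (measurability _ (RGenOInfty.measurableE R)) => _ [_ [a ->] <-].
rewrite setTI; have [a0|a0] := ltP a 0.
  rewrite (_ : _ @^-1` _ = setT) //; apply/seteqP; split=> // t _ /=.
  by rewrite in_itv /= andbT (lt_le_trans a0) // opnorm_ge0.
rewrite (_ : _ @^-1` _ = \bigcup_(w in [set: 'cV[(rat * rat)%type]_n])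
    [set t | a ^+ 2 * sqnorm (rational_vector R w) < sqnorm (F t *m rational_vector R w)]).
  apply: countable_bigcupT_measurable => [|w]; first exact: countableP.
  have := measurable_fun_ltr (measurable_cst (a ^+ 2 * sqnorm (rational_vector R w)))
    (measurable_sqnorm_mul (rational_vector R w)).
  by move=> /(_ measurableT [set true] I); rewrite setTI.
apply/seteqP; split=> t /=; rewrite in_itv /= andbT.
  by move=> /(opnorm_gt _ a0)[w Hw]; exists w.
by move=> [w _ Hw]; apply/(opnorm_gt _ a0); exists w.
Qed.

Lemma bounded_measurable_normalise : bounded_measurable_mx (fun t => normalise (F t)).
Proof.
have inv : measurable_fun setT (fun t => (opnorm (F t))^-1).
  (* Real powers are measurable in the base, and the power -1 agrees with the inverse on nonnegative
     reals, including 0. *)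
  have E t : (opnorm (F t))^-1 = powR (opnorm (F t)) (-1) by rewrite powR_inv1 ?opnorm_ge0.
  by under eq_fun do rewrite E; apply: (measurableT_comp (measurable_powR _)); exact: measurable_opnorm.
move=> i j; have [f1 f2] := Fm i j; split.
- under eq_fun do rewrite mxE -/(cof _) CxReM Re_cof Im_cof mul0r subr0.
  exact: measurable_funM.
- under eq_fun do rewrite mxE -/(cof _) CxImM Re_cof Im_cof mul0r addr0.
  exact: measurable_funM.
- by exists 1 => t; exact: nsq_normalise_le.
Qed.

Lemma bounded_measurable_unitary : (forall t, adj (F t) *m F t = 1%:M) -> bounded_measurable_mx F.
Proof.
move=> FF i j; have [f1 f2] := Fm i j; split=> //; exists (sqnorm (1%:M : 'M[C]_n)) => t.
by rewrite -(sqnorm_mull_unitary _ (FF t)) mulmx1 nsq_le_sqnorm.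
Qed.

End NormaliseMeasurable.

(** * Continuous test functions and the Haar average *)

Section ContinuousComplex.
Variables (R : realType) (T : topologicalType).
Local Notation C := (Cx R).
Implicit Types f g : T -> C.

Definition ccontinuous f :=
  continuous (fun t => CxRe (f t)) /\ continuous (fun t => CxIm (f t)).

Lemma ccontinuous_cst (a : C) : ccontinuous (fun=> a).
Proof. by split=> t; exact: cvg_cst. Qed.

Lemma ccontinuousD f g : ccontinuous f -> ccontinuous g -> ccontinuous (fun t => f t + g t).
Proof.
case=> f1 f2 [g1 g2]; split=> t.
  by under eq_fun do rewrite CxReD; exact: cvgD (f1 t) (g1 t).
by under eq_fun do rewrite CxImD; exact: cvgD (f2 t) (g2 t).
Qed.

Lemma ccontinuousM f g : ccontinuous f -> ccontinuous g -> ccontinuous (fun t => f t * g t).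
Proof.
case=> f1 f2 [g1 g2]; split=> t.
  under eq_fun do rewrite CxReM.
  exact: cvgB (cvgM (f1 t) (g1 t)) (cvgM (f2 t) (g2 t)).
under eq_fun do rewrite CxImM.
exact: cvgD (cvgM (f1 t) (g2 t)) (cvgM (f2 t) (g1 t)).
Qed.

Lemma ccontinuous_conj f : ccontinuous f -> ccontinuous (fun t => (f t)^*).
Proof.
case=> f1 f2; split=> t.
  by under eq_fun do rewrite CxRe_conj; exact: f1.
by under eq_fun do rewrite CxIm_conj; exact: cvgN (f2 t).
Qed.

Lemma ccontinuous_sum I (r : seq I) (F : I -> T -> C) : (forall i, ccontinuous (F i)) ->
  ccontinuous (fun t => \sum_(i <- r) F i t).
Proof.
move=> H; elim: r => [|i r IH].
  by under eq_fun do rewrite big_nil; exact: ccontinuous_cst.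
by under eq_fun do rewrite big_cons; exact: ccontinuousD.
Qed.

End ContinuousComplex.

Lemma ccontinuous_conjugation (R : realType) n (X : 'M[Cx R]_n) i j :
  ccontinuous (fun A : 'M[Cx R]_n => (A *m X *m adj A) i j).
Proof.
have entry k l : ccontinuous (fun A : 'M[Cx R]_n => A k l).
  split=> A.
    apply: (@continuous_comp _ _ _ (fun A : 'M[Cx R]_n => A k l) (@CxRe R)).
      exact: coord_continuous.
    exact: continuous_CxRe.
  apply: (@continuous_comp _ _ _ (fun A : 'M[Cx R]_n => A k l) (@CxIm R)).
    exact: coord_continuous.
  exact: continuous_CxIm.
under eq_fun do rewrite mxE; apply: ccontinuous_sum => k; apply: ccontinuousM.
  under eq_fun do rewrite mxE; apply: ccontinuous_sum => l; apply: ccontinuousM; first exact: entry.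
  exact: ccontinuous_cst.
by under eq_fun do rewrite adjE; apply: ccontinuous_conj; exact: entry.
Qed.

Section Haar.
Variables (R : realType) (n : nat) (K : set 'M[Cx R]_n).
Variables (d : measure_display) (T : measurableType d) (P : probability T R).
Variable kap : T -> 'M[Cx R]_n.
Hypotheses (Kuni : unitary_set K) (Khaar : haar_on K P kap).
Implicit Types X Y : 'M[Cx R]_n.

Lemma bounded_measurable_haar : bounded_measurable_mx kap.
Proof.
by case: Khaar => Kk mk _; apply: bounded_measurable_unitary => // t; exact: Kuni.
Qed.

Definition haar_avg X := mxint P (fun t => kap t *m X *m adj (kap t)).

Lemma bounded_measurable_conjugation X :
  bounded_measurable_mx (fun t => kap t *m X *m adj (kap t)).
Proof.
apply: bounded_measurable_mulmx; last exact: bounded_measurable_adj bounded_measurable_haar.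
exact: bounded_measurable_mulmx bounded_measurable_haar (bounded_measurable_cst_mx T X).
Qed.

(** Translating the integrand by g conjugates the average by g. The test functions are the real and
    imaginary parts of the entries of A X A^dagger. *)
Lemma haar_avg_comm X g : K g -> haar_avg X *m g = g *m haar_avg X.
Proof.
move=> Kg; have [Kk mk inv] := Khaar.
have E : g *m haar_avg X *m adj g = haar_avg X.
  rewrite -(mxint_mul _ _ _ (bounded_measurable_conjugation X)).
  apply/matrixP => i j; rewrite [LHS]mxE [RHS]mxE.
  have [c1 c2] := ccontinuous_conjugation X i j.
  have [[r1 _] [r2 _]] := (inv g Kg _ c1, inv g Kg _ c2).
  transitivity (cint P (fun t => ((g *m kap t) *m X *m adj (g *m kap t)) i j)).
    by congr (cint P _); apply/funext => t; rewrite adjM !mulmxA.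
  by apply: CxP; [exact: r1|exact: r2].
by rewrite -[in LHS]E -mulmxA (Kuni Kg) mulmx1.
Qed.

(** The integrand is constant: by cyclicity of the trace, a unitary k commuting with Y cancels
    against its adjoint. *)
Lemma tr_haar_avg X Y : (forall k, K k -> Y *m k = k *m Y) ->
  \tr (haar_avg X *m Y) = \tr (X *m Y).
Proof.
move=> YK; have [Kk _ _] := Khaar; have bm := bounded_measurable_conjugation X.
rewrite -(mxint_mulr _ _ bm) mxint_tr; last first.
  exact: bounded_measurable_mulmx bm (bounded_measurable_cst_mx T Y).
rewrite -[RHS](cint_cst P); congr (cint P _); apply/funext => t.
rewrite -!mulmxA mxtrace_mulC -!mulmxA YK // [adj _ *m _]mulmxA Kuni // mul1mx.
by [].
Qed.

End Haar.

(** * Factorisation of the twirl *)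

Section TwirlFactor.
Variables (R : realType) (n : nat) (G K A : set 'M[Cx R]_n).
Variables (dK : measure_display) (TK : measurableType dK) (PK : probability TK R).
Variable kap : TK -> 'M[Cx R]_n.
Variables (dA : measure_display) (TA : measurableType dA) (PA : probability TA R).
Variable alp : TA -> 'M[Cx R]_n.
Hypotheses (Gred : reductive G) (car : cartan_decomposition G K A).
Hypotheses (Khaar : haar_on K PK kap) (Ameas : measure_on A PA alp).
Implicit Types X Y rho : 'M[Cx R]_n.
Local Notation avg := (haar_avg PK kap).

Definition second_moment := mxint PA (fun a => normalise (alp a) *m adj (normalise (alp a))).

Lemma haar_avg_commutant X g : G g -> avg X *m g = g *m avg X.
Proof.
case: car => Kmax Kuni _ _; apply: (commutant_maximal_compact Gred Kmax Kuni).
by move=> k Kk; exact: (haar_avg_comm Kuni Khaar X Kk).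
Qed.

Lemma alp_mem a : G (alp a).
Proof. by case: car => _ _ [_ AG _ _] _; case: Ameas => Aa _; exact: AG. Qed.

Lemma normalise_comm X a : (forall g, G g -> X *m g = g *m X) ->
  X *m normalise (alp a) = normalise (alp a) *m X.
Proof. by move=> XG; rewrite -scalemxAr -scalemxAl XG //; exact: alp_mem. Qed.

Lemma bounded_measurable_moment :
  bounded_measurable_mx (fun a => normalise (alp a) *m adj (normalise (alp a))).
Proof.
have bm := bounded_measurable_normalise (proj2 Ameas).
exact: bounded_measurable_mulmx bm (bounded_measurable_adj bm).
Qed.

(** The inner integral over K' is the average of rho. It commutes with G, hence with K and A_n, and
    can be moved out to the left; what remains is the Haar average of A_n A_n^dagger. *)
Lemma twirl_factor rho : twirl PK kap PA alp rho = avg rho *m avg second_moment.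
Proof.
have [Kmax Kuni _ _] := car; have [Kk mk _] := Khaar; have [_ KG _ _] := Kmax.
have comm := haar_avg_commutant rho.
rewrite -(mxint_mull _ _ (bounded_measurable_conjugation Kuni Khaar _)); congr (mxint PK _).
apply/funext => t1.
transitivity (mxint PA (fun a => (avg rho *m kap t1) *m
    (normalise (alp a) *m adj (normalise (alp a))) *m adj (kap t1))); last first.
  by rewrite (mxint_mul _ _ _ bounded_measurable_moment) !mulmxA.
congr (mxint PA _); apply/funext => a.
transitivity (mxint PK (fun t2 => (kap t1 *m normalise (alp a)) *m
    (kap t2 *m rho *m adj (kap t2)) *m adj (kap t1 *m normalise (alp a)))).
  by congr (mxint PK _); apply/funext => t2; cbv zeta; rewrite !adjM !mulmxA.
rewrite (mxint_mul _ _ _ (bounded_measurable_conjugation Kuni Khaar _)) -/(haar_avg _ _ _).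
move: (avg rho) comm (normalise_comm a comm) => X comm commN.
by rewrite adjM -[_ *m X]mulmxA -commN !mulmxA -(comm _ (KG _ (Kk t1))).
Qed.

(** The adjoint of A_n need not be a multiple of an element of G, so X passes it only because the
    adjoint of X commutes with A_n. *)
Lemma second_moment_comm X : (forall g, G g -> X *m g = g *m X) ->
  (forall g, G g -> adj X *m g = g *m adj X) -> X *m second_moment = second_moment *m X.
Proof.
move=> XG aXG; have bm := bounded_measurable_moment.
rewrite -(mxint_mull _ _ bm) -(mxint_mulr _ _ bm); congr (mxint PA _); apply/funext => a.
have E : X *m adj (normalise (alp a)) = adj (normalise (alp a)) *m X.
  by rewrite -[X in X *m adj _]adjK -adjM -(normalise_comm a aXG) adjM adjK.
by rewrite mulmxA (normalise_comm a XG) -!mulmxA E.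
Qed.

(** Maximality forces K = G, so every A is unitary and of norm 1. In dimension 0 the norm would be
    0, hence the positivity hypothesis. *)
Lemma second_moment_compact : (0 < n)%N -> compact G -> second_moment = 1%:M.
Proof.
move=> n0 Gc; have [[_ KG _ max] Kuni _ _] := car; have [[Gsub _] _] := Gred.
have GK : G = K by apply: max.
rewrite -[RHS](mxint_cst PA); congr (mxint PA _); apply/funext => a.
have uni : adj (alp a) *m alp a = 1%:M by apply: Kuni; rewrite -GK; exact: alp_mem.
have -> : normalise (alp a) = alp a.
  rewrite /normalise -/(cof _) opnorm_unitary // invr1.
  exact: scale1r.
exact: mulmx1C.
Qed.

End TwirlFactor.

(** * The commutant in a Schur basis *)

Section SchurAlgebra.
Variables (R : realType) (n r : nat) (dL dV : 'I_r -> nat).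
Local Notation C := (Cx R).
Variable e : forall k : 'I_r, 'I_(dL k) -> 'I_(dV k) -> 'cV[C]_n.
Variables G1 G2 : set 'M[C]_n.
Hypothesis schur : schur_basis e G1 G2.
Implicit Types X Y : 'M[C]_n.

Lemma schur_orth k (m m' : 'I_(dL k)) (l l' : 'I_(dV k)) :
  adj (e m l) *m e m' l' = ((m == m') && (l == l'))%:R%:M.
Proof.
by case: schur => _ H _ _ _; rewrite H eqxx /=; case: ((m == m') && (l == l')).
Qed.

Lemma schur_orth_neq k k' (m : 'I_(dL k)) (m' : 'I_(dL k')) (l : 'I_(dV k)) (l' : 'I_(dV k')) :
  k != k' -> adj (e m l) *m e m' l' = 0.
Proof. by case: schur => _ H _ _ _ /negbTE kk; rewrite H kk /= raddf0. Qed.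

Lemma PiV_mul_e k (a b c : 'I_(dL k)) (l : 'I_(dV k)) :
  PiV e a b *m e c l = (b == c)%:R *: e a l.
Proof.
rewrite mulmx_suml (bigD1 l) //= -mulmxA schur_orth eqxx andbT mul_mx_scalar.
rewrite big1 ?addr0 // => s sl; rewrite -mulmxA schur_orth (negbTE sl) andbF.
by rewrite mul_mx_scalar scale0r.
Qed.

Lemma PiL_mul_e k (s t l : 'I_(dV k)) (m : 'I_(dL k)) :
  PiL e s t *m e m l = (t == l)%:R *: e m s.
Proof.
rewrite mulmx_suml (bigD1 m) //= -mulmxA schur_orth eqxx mul_mx_scalar.
rewrite big1 ?addr0 // => c cm; rewrite -mulmxA schur_orth (negbTE cm).
by rewrite mul_mx_scalar scale0r.
Qed.

Lemma PiV_mul_e_neq k k' (a b : 'I_(dL k)) (c : 'I_(dL k')) (l : 'I_(dV k')) :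
  k != k' -> PiV e a b *m e c l = 0.
Proof.
move=> kk; rewrite mulmx_suml big1 // => s _.
by rewrite -mulmxA (schur_orth_neq _ _ _ _ kk) mulmx0.
Qed.

Lemma PiL_mul_e_neq k k' (s t : 'I_(dV k)) (m : 'I_(dL k')) (l : 'I_(dV k')) :
  k != k' -> PiL e s t *m e m l = 0.
Proof.
move=> kk; rewrite mulmx_suml big1 // => c _.
by rewrite -mulmxA (schur_orth_neq _ _ _ _ kk) mulmx0.
Qed.

Lemma PiV_mul k (a b c d : 'I_(dL k)) :
  PiV e a b *m PiV e c d = (b == c)%:R *: PiV e a d.
Proof.
rewrite [X in _ *m X]/PiV mulmx_sumr /PiV scaler_sumr; apply: eq_bigr => l _.
by rewrite -/(PiV e a b) mulmxA PiV_mul_e -scalemxAl.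
Qed.

Lemma PiV_mul_neq k k' (a b : 'I_(dL k)) (c d : 'I_(dL k')) :
  k != k' -> PiV e a b *m PiV e c d = 0.
Proof.
move=> kk; rewrite [X in _ *m X]/PiV mulmx_sumr big1 // => l _.
by rewrite mulmxA (PiV_mul_e_neq _ _ _ _ kk) mul0mx.
Qed.

(** On the block k, seen as a tensor product, the two operators are E_ab (x) 1 and 1 (x) E_st; both
    products equal |k,a,s><k,b,t|. *)
Lemma PiL_PiV_comm k k' (s t : 'I_(dV k)) (a b : 'I_(dL k')) :
  PiV e a b *m PiL e s t = PiL e s t *m PiV e a b.
Proof.
rewrite [X in _ *m X = _]/PiL [X in _ = _ *m X]/PiV !mulmx_sumr.
have [kk|kk] := eqVneq k k'; last first.
  rewrite !big1 // => i _; rewrite mulmxA.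
    by rewrite (PiL_mul_e_neq _ _ _ _ kk) mul0mx.
  by rewrite eq_sym in kk; rewrite (PiV_mul_e_neq _ _ _ _ kk) mul0mx.
subst k'; rewrite (bigD1 b) //= [RHS](bigD1 t) //=.
rewrite !mulmxA PiV_mul_e PiL_mul_e !eqxx !scale1r !big1 ?addr0 // => i ne.
  by rewrite mulmxA PiL_mul_e eq_sym (negbTE ne) scale0r mul0mx.
by rewrite mulmxA PiV_mul_e eq_sym (negbTE ne) scale0r mul0mx.
Qed.

Lemma adj_PiV k (a b : 'I_(dL k)) : adj (PiV e a b) = PiV e b a.
Proof. by rewrite /PiV adj_sum; apply: eq_bigr => l _; rewrite adjM adjK. Qed.

Lemma PikE k : Pik e k = \sum_(m < dL k) PiV e m m.
Proof. by []. Qed.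

Lemma adj_Pik k : adj (Pik e k) = Pik e k.
Proof. by rewrite PikE adj_sum; apply: eq_bigr => m _; rewrite adj_PiV. Qed.

Lemma tr_PiV k (a b : 'I_(dL k)) : \tr (PiV e a b) = (a == b)%:R * (dV k)%:R.
Proof.
rewrite /PiV mxtrace_sum.
under eq_bigr do rewrite mxtrace_mulC schur_orth eqxx andbT mxtrace_scalar mulr1n.
by rewrite sumr_const card_ord mulr_natr eq_sym.
Qed.

Lemma sum_PiV : \sum_(k < r) \sum_(m < dL k) PiV e m m = 1%:M.
Proof. by case: schur. Qed.

(** A block contains a unit vector, which cannot exist in dimension 0. *)
Lemma schur_dim_gt0 (k : 'I_r) : (0 < n)%N.
Proof.
have [H _ _ _ _] := schur; have [l0 v0] := H k; rewrite lt0n; apply/eqP => n0.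
have := congr1 (fun M : 'M[C]_1 => M 0 0)
  (schur_orth (Ordinal l0) (Ordinal l0) (Ordinal v0) (Ordinal v0)).
rewrite !eqxx /= mxE big1; last by move=> i; have := ltn_ord i; rewrite {2}n0.
by rewrite mxE /= => /esym/eqP; rewrite oner_eq0.
Qed.

Lemma dV_neq0 k : (dV k)%:R != 0 :> C.
Proof. by have [H _ _ _ _] := schur; rewrite pnatr_eq0 -lt0n; case: (H k). Qed.

Lemma dL_neq0 k : (dL k)%:R != 0 :> C.
Proof. by have [H _ _ _ _] := schur; rewrite pnatr_eq0 -lt0n; case: (H k). Qed.

Lemma PiV_comm k (a b : 'I_(dL k)) g : G1 g -> PiV e a b *m g = g *m PiV e a b.
Proof.
case: schur => _ _ _ H _ /H ->; rewrite mulmx_sumr mulmx_suml; apply: eq_bigr => k' _.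
rewrite -scalemxAr -scalemxAl; congr (_ *: _).
rewrite mulmx_sumr mulmx_suml; apply: eq_bigr => s _.
rewrite mulmx_sumr mulmx_suml; apply: eq_bigr => t _.
by rewrite -scalemxAr -scalemxAl PiL_PiV_comm.
Qed.

(** The orthogonal projection, for the trace form, onto the span of the operators [PiV], which are
    pairwise orthogonal with squared norm [dV k]. *)
Definition schur_proj X := \sum_(k < r) (dV k)%:R^-1 *:
  \sum_(a < dL k) \sum_(b < dL k) \tr (X *m adj (PiV e a b)) *: PiV e a b.

Lemma schur_projD X Y : schur_proj (X + Y) = schur_proj X + schur_proj Y.
Proof.
rewrite /schur_proj -big_split; apply: eq_bigr => k _; rewrite /= -scalerDr; congr (_ *: _).
rewrite -big_split; apply: eq_bigr => a _ /=; rewrite -big_split; apply: eq_bigr => b _ /=.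
by rewrite mulmxDl mxtraceD scalerDl.
Qed.

Lemma schur_projZ (c : C) X : schur_proj (c *: X) = c *: schur_proj X.
Proof.
rewrite /schur_proj scaler_sumr; apply: eq_bigr => k _.
rewrite scalerA mulrC -scalerA; congr (_ *: _).
rewrite scaler_sumr; apply: eq_bigr => a _; rewrite scaler_sumr; apply: eq_bigr => b _.
by rewrite -scalemxAl mxtraceZ scalerA.
Qed.

Lemma schur_proj_PiV k (a b : 'I_(dL k)) : schur_proj (PiV e a b) = PiV e a b.
Proof.
rewrite /schur_proj (bigD1 k) //= [X in _ + X]big1 ?addr0; last first.
  move=> k' kk; rewrite big1 ?scaler0 // => c _; rewrite big1 // => d _.
  by rewrite eq_sym in kk; rewrite adj_PiV (PiV_mul_neq _ _ _ _ kk) mxtrace0 scale0r.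
rewrite (bigD1 a) //= [X in _ + X]big1 ?addr0; last first.
  move=> c ca; rewrite big1 // => d _; rewrite adj_PiV PiV_mul mxtraceZ tr_PiV.
  by rewrite [a == c]eq_sym (negbTE ca) mul0r mulr0 scale0r.
rewrite (bigD1 b) //= [X in _ + X]big1 ?addr0; last first.
  by move=> d db; rewrite adj_PiV PiV_mul eq_sym (negbTE db) scale0r mxtrace0 scale0r.
by rewrite adj_PiV PiV_mul mxtraceZ tr_PiV !eqxx !mul1r scalerA mulVf ?scale1r // dV_neq0.
Qed.

Inductive PiV_span : 'M[C]_n -> Prop :=
| PiV_span0 : PiV_span 0
| PiV_span_gen k (a b : 'I_(dL k)) : PiV_span (PiV e a b)
| PiV_spanD X Y : PiV_span X -> PiV_span Y -> PiV_span (X + Y)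
| PiV_spanZ (c : C) X : PiV_span X -> PiV_span (c *: X).

Lemma PiV_span_sum I (s : seq I) (F : I -> 'M[C]_n) :
  (forall i, PiV_span (F i)) -> PiV_span (\sum_(i <- s) F i).
Proof. by move=> H; apply: big_ind => //; [exact: PiV_span0|exact: PiV_spanD]. Qed.

Lemma PiV_spanM X Y : PiV_span X -> PiV_span Y -> PiV_span (X *m Y).
Proof.
move=> sX; elim: sX Y => {X} [|k a b|X1 X2 _ IH1 _ IH2|c X _ IH] Y sY.
- by rewrite mul0mx; exact: PiV_span0.
- elim: sY => {Y} [|k' c d|Y1 Y2 _ IH1 _ IH2|c Y _ IH].
  + by rewrite mulmx0; exact: PiV_span0.
  + have [kk|kk] := eqVneq k k'; last by rewrite PiV_mul_neq //; exact: PiV_span0.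
    by subst k'; rewrite PiV_mul; apply: PiV_spanZ; exact: PiV_span_gen.
  + by rewrite mulmxDr; exact: PiV_spanD.
  + by rewrite -scalemxAr; exact: PiV_spanZ.
- by rewrite mulmxDl; apply: PiV_spanD; [exact: IH1|exact: IH2].
- by rewrite -scalemxAl; apply: PiV_spanZ; exact: IH.
Qed.

(** The span contains 1 by completeness of the basis and is closed under products by the matrix unit
    relations. *)
Lemma gen_alg_PiV_span X : gen_alg G2 X -> PiV_span X.
Proof.
elim=> {X} [|X|X Y _ IH1 _ IH2|c X _ IH|X Y _ IH1 _ IH2].
- rewrite -sum_PiV; apply: PiV_span_sum => k; apply: PiV_span_sum => m; exact: PiV_span_gen.
- case: schur => _ _ _ _ H /H ->; apply: PiV_span_sum => k; apply: PiV_spanZ.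
  apply: PiV_span_sum => a; apply: PiV_span_sum => b; apply: PiV_spanZ; exact: PiV_span_gen.
- exact: PiV_spanD.
- exact: PiV_spanZ.
- exact: PiV_spanM.
Qed.

Lemma schur_proj_span X : PiV_span X -> schur_proj X = X.
Proof.
elim=> {X} [|k a b|X Y _ IH1 _ IH2|c X _ IH].
- by rewrite -[0 in LHS](scale0r 0) schur_projZ scale0r.
- exact: schur_proj_PiV.
- by rewrite schur_projD IH1 IH2.
- by rewrite schur_projZ IH.
Qed.

Lemma commutant_schur_proj X : gen_alg G2 = commutant (gen_alg G1) ->
  (forall g, G1 g -> X *m g = g *m X) -> schur_proj X = X.
Proof.
move=> dual XG; apply: schur_proj_span; apply: gen_alg_PiV_span; rewrite dual => Y.
elim=> {Y} [|Y|Y Z _ IH1 _ IH2|c Y _ IH|Y Z _ IH1 _ IH2].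
- by rewrite mulmx1 mul1mx.
- exact: XG.
- by rewrite mulmxDr mulmxDl IH1 IH2.
- by rewrite -scalemxAr -scalemxAl IH.
- by rewrite mulmxA IH1 -mulmxA IH2 mulmxA.
Qed.

(** On the matrix algebra spanned by the [PiV] of one block, Y |-> tr(X Y) is a trace as soon as X
    commutes with that algebra, hence a multiple of the usual one. Summing the diagonal units fixes
    the factor. *)
Lemma tr_PiV_comm X k (a b : 'I_(dL k)) :
  (forall c d : 'I_(dL k), PiV e c d *m X = X *m PiV e c d) ->
  \tr (X *m PiV e b a) = (a == b)%:R * (\tr (X *m Pik e k) / (dL k)%:R).
Proof.
move=> XP; have E (c : 'I_(dL k)) : \tr (X *m PiV e b a) = (a == b)%:R * \tr (X *m PiV e c c).
  have -> : PiV e b a = PiV e b c *m PiV e c a by rewrite PiV_mul eqxx scale1r.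
  by rewrite mulmxA mxtrace_mulC mulmxA XP -mulmxA PiV_mul -scalemxAr mxtraceZ.
case: (eqVneq a b) E => [<-|_] E; last by rewrite (E a) !mul0r.
have S : \tr (X *m Pik e k) = \tr (X *m PiV e a a) * (dL k)%:R.
  transitivity (\sum_(c < dL k) \tr (X *m PiV e c c)).
    by rewrite -mxtrace_sum -mulmx_sumr.
  transitivity (\sum_(c < dL k) \tr (X *m PiV e a a)).
    by apply: eq_bigr => c _; rewrite -[LHS]mul1r; exact: esym (E c).
  by rewrite sumr_const card_ord mulr_natr.
by rewrite S mulfK ?dL_neq0 // mul1r.
Qed.

(** X is meant to be the Haar average of B: it lies in the commutant and shares with B the traces
    that determine it there, and these traces are those of a scalar on each block. *)
Lemma commutant_schur_scalar X B : gen_alg G2 = commutant (gen_alg G1) ->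
  (forall g, G1 g -> X *m g = g *m X) ->
  (forall k (a b : 'I_(dL k)), PiV e a b *m B = B *m PiV e a b) ->
  (forall k (a b : 'I_(dL k)), \tr (X *m PiV e a b) = \tr (B *m PiV e a b)) ->
  forall k (a b : 'I_(dL k)),
    PiV e a b *m X = (\tr (B *m Pik e k) / (dk dL dV k)%:R) *: PiV e a b.
Proof.
move=> dual XG BP trX k a b.
pose z k := \tr (B *m Pik e k) / (dk dL dV k)%:R.
have -> : X = \sum_(k < r) \sum_(c < dL k) z k *: PiV e c c.
  rewrite -[LHS](commutant_schur_proj dual XG); apply: eq_bigr => j _.
  rewrite scaler_sumr; apply: eq_bigr => c _; rewrite (bigD1 c) //= big1 ?addr0.
    rewrite adj_PiV trX (tr_PiV_comm _ _ (BP j)) eqxx mul1r scalerA /z /dk natrM invfM.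
    by rewrite mulrC mulrA.
  move=> d dc; rewrite adj_PiV trX (tr_PiV_comm _ _ (BP j)) eq_sym (negbTE dc).
  by rewrite mul0r scale0r.
rewrite mulmx_sumr (bigD1 k) //= [X in _ + X]big1 ?addr0; last first.
  move=> j jk; rewrite mulmx_sumr big1 // => c _; rewrite -scalemxAr.
  by rewrite eq_sym in jk; rewrite (PiV_mul_neq _ _ _ _ jk) scaler0.
rewrite mulmx_sumr (bigD1 b) //= [X in _ + X]big1 ?addr0; last first.
  by move=> c cb; rewrite -scalemxAr PiV_mul eq_sym (negbTE cb) scale0r scaler0.
by rewrite -scalemxAr PiV_mul eqxx scale1r.
Qed.

(** * The twirl in the Schur basis *)

Section Twirl.
Variables K A : set 'M[C]_n.
Variables (dK : measure_display) (TK : measurableType dK) (PK : probability TK R).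
Variable kap : TK -> 'M[C]_n.
Variables (dA : measure_display) (TA : measurableType dA) (PA : probability TA R).
Variable alp : TA -> 'M[C]_n.
Hypotheses (Gred : reductive G1) (dual : gen_alg G2 = commutant (gen_alg G1)).
Hypotheses (car : cartan_decomposition G1 K A).
Hypotheses (Khaar : haar_on K PK kap) (Ameas : measure_on A PA alp).

Lemma twirlE rho : twirl PK kap PA alp rho =
  \sum_(k < r) ((dV k)%:R^-1 * (beta PA alp (Pik e k) / (dk dL dV k)%:R)) *:
    \sum_(m1 < dL k) \sum_(m2 < dL k) \tr (rho *m adj (PiV e m1 m2)) *: PiV e m1 m2.
Proof.
have [[_ KG _ _] Kuni _ _] := car.
have trP X k (a b : 'I_(dL k)) : \tr (haar_avg PK kap X *m PiV e a b) = \tr (X *m PiV e a b).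
  by apply: (tr_haar_avg Kuni Khaar) => g /KG; exact: PiV_comm.
have BP k (a b : 'I_(dL k)) : PiV e a b *m second_moment PA alp = second_moment PA alp *m PiV e a b.
  apply: (second_moment_comm car Ameas) => g Gg; first exact: PiV_comm.
  by rewrite adj_PiV PiV_comm.
have comm X := haar_avg_commutant Gred car Khaar X.
rewrite (twirl_factor Gred car Khaar Ameas).
rewrite -[haar_avg _ _ rho](commutant_schur_proj dual (comm _)) mulmx_suml.
apply: eq_bigr => k _; rewrite -scalemxAl -scalerA; congr (_ *: _).
rewrite scaler_sumr mulmx_suml; apply: eq_bigr => a _.
rewrite scaler_sumr mulmx_suml; apply: eq_bigr => b _.
rewrite -scalemxAl (commutant_schur_scalar dual (comm _) BP (trP _)) !adj_PiV trP /beta adj_Pik.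
by rewrite !scalerA mulrC.
Qed.

Lemma beta_compact k : compact G1 -> beta PA alp (Pik e k) = (dk dL dV k)%:R.
Proof.
move=> Gc; rewrite /beta -/(second_moment _ _).
rewrite (second_moment_compact Gred car Ameas (schur_dim_gt0 k) Gc) mul1mx adj_Pik PikE mxtrace_sum.
under eq_bigr do rewrite tr_PiV eqxx mul1r.
by rewrite sumr_const card_ord /dk mulnC mulrnA.
Qed.

End Twirl.

End SchurAlgebra.

(** Exchanging m and lambda turns [PiV] into [PiL] and the role of G1 into that of G2, so the
    formula for the second twirl is an instance of the first. *)
Lemma schur_basis_swap (R : realType) n r (dL dV : 'I_r -> nat)
    (e : forall k : 'I_r, 'I_(dL k) -> 'I_(dV k) -> 'cV[Cx R]_n) (G1 G2 : set 'M[Cx R]_n) :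
  schur_basis e G1 G2 -> schur_basis (fun k l m => e k m l) G2 G1.
Proof.
case=> pos orth one H1 H2; split=> //.
- by move=> k; case: (pos k).
- by move=> k l m k' l' m'; rewrite orth [X in _ && X]andbC.
- by rewrite -[RHS]one; apply: eq_bigr => k _; exact: exchange_big.
Qed.

Lemma beta_Pik_swap (R : realType) n (dA : measure_display) (TA : measurableType dA)
    (PA : probability TA R) (alp : TA -> 'M[Cx R]_n) r (dL dV : 'I_r -> nat)
    (e : forall k : 'I_r, 'I_(dL k) -> 'I_(dV k) -> 'cV[Cx R]_n) k :
  beta PA alp (Pik (fun k l m => e k m l) k) = beta PA alp (Pik e k).
Proof. by congr (beta PA alp _); exact: exchange_big. Qed.

Theorem theorem2 (R : realType) (n : nat) (G1 G2 : set 'M[Cx R]_n)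
  (r : nat) (dL dV : 'I_r -> nat)
  (e : forall k : 'I_r, 'I_(dL k) -> 'I_(dV k) -> 'cV[Cx R]_n)
  (K1 A1 K2 A2 : set 'M[Cx R]_n)
  (dK1 : measure_display) (TK1 : measurableType dK1) (PK1 : probability TK1 R)
  (kap1 : TK1 -> 'M[Cx R]_n)
  (dA1 : measure_display) (TA1 : measurableType dA1) (PA1 : probability TA1 R)
  (alp1 : TA1 -> 'M[Cx R]_n)
  (dK2 : measure_display) (TK2 : measurableType dK2) (PK2 : probability TK2 R)
  (kap2 : TK2 -> 'M[Cx R]_n)
  (dA2 : measure_display) (TA2 : measurableType dA2) (PA2 : probability TA2 R)
  (alp2 : TA2 -> 'M[Cx R]_n) :
  dual_reductive_pair G1 G2 ->
  schur_basis e G1 G2 ->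
  cartan_decomposition G1 K1 A1 ->
  cartan_decomposition G2 K2 A2 ->
  haar_on K1 PK1 kap1 -> measure_on A1 PA1 alp1 ->
  haar_on K2 PK2 kap2 -> measure_on A2 PA2 alp2 ->
  [/\ forall rho : 'M[Cx R]_n, density rho ->
        twirl PK1 kap1 PA1 alp1 rho =
        \sum_(k < r) ((dV k)%:R^-1 * (beta PA1 alp1 (Pik e k) / (dk dL dV k)%:R)) *:
          \sum_(m1 < dL k) \sum_(m2 < dL k)
             \tr (rho *m adj (PiV e m1 m2)) *: PiV e m1 m2,
      forall rho : 'M[Cx R]_n, density rho ->
        twirl PK2 kap2 PA2 alp2 rho =
        \sum_(k < r) ((dL k)%:R^-1 * (beta PA2 alp2 (Pik e k) / (dk dL dV k)%:R)) *:
          \sum_(l1 < dV k) \sum_(l2 < dV k)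
             \tr (rho *m adj (PiL e l1 l2)) *: PiL e l1 l2,
      compact G1 -> forall k, beta PA1 alp1 (Pik e k) = (dk dL dV k)%:R &
      compact G2 -> forall k, beta PA2 alp2 (Pik e k) = (dk dL dV k)%:R].
Proof.
move=> [red1 red2 dual1 dual2] schur car1 car2 haar1 meas1 haar2 meas2.
have schur' := schur_basis_swap schur; split=> [rho _|rho _|Gc k|Gc k].
- exact: (twirlE schur red1 dual2 car1 haar1 meas1 rho).
- rewrite (twirlE schur' red2 dual1 car2 haar2 meas2 rho); apply: eq_bigr => k _.
  by rewrite beta_Pik_swap /dk mulnC.
- exact: (beta_compact schur red1 car1 meas1 k Gc).
- by rewrite -beta_Pik_swap (beta_compact schur' red2 car2 meas2 k Gc) /dk mulnC.
Qed.
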